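(* For $P\in\mathbb N$ let $\phi_P$ be the probability density function of $\log(E_1E_2\cdots E_P)$, where $E_1,\ldots,E_P$ are i.i.d. standard Exponential random variables (mean $1$); equivalently, for any $c>0$, \[ \phi_P(x)=\frac{1}{2\pi\mathrm i}\int_{c-\mathrm i\infty}^{c+\mathrm i\infty}e^{x(1-z)}\bigl(\Gamma(z)\bigr)^P\,\mathrm dz . \] Let $\psi=\Gamma'/\Gamma$ be the Digamma function, which is a strictly increasing bijection from $(0,\infty)$ onto $\mathbb R$, and for $x\in\mathbb R$ let $z_*=\psi^{-1}(x/P)>0$. Then, as $P\to\infty$, uniformly in $x\in\mathbb R$, \[ \phi_P(x)\sim\frac{\bigl(\Gamma(z_* )\bigr)^P\,e^{x(1-z_* )}}{\sqrt{2\pi P\,\psi'(z_* )}} , \] i.e. the ratio of the two sides tends to $1$, the next-order correction being smaller by a factor of order $P^{-1/2}$ relative to the leading term.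
   Context: $\Gamma$ is the Gamma function and $\psi'$ the trigamma function. *)

(* Defs.v *)
From Stdlib Require Import Reals.
Open Scope R_scope.

Definition improper_int_R (f : R -> R) (l : R) : Prop :=
  forall eps : R, 0 < eps ->
  exists M : R, forall a b : R, a <= - M -> M <= b ->
    exists pr : Riemann_integrable f a b, Rabs (RiemannInt pr - l) < eps.

Definition improper_int_0inf (f : R -> R) (l : R) : Prop :=
  forall eps : R, 0 < eps ->
  exists d M : R, 0 < d /\
    forall a b : R, 0 < a -> a <= d -> M <= b ->
    exists pr : Riemann_integrable f a b, Rabs (RiemannInt pr - l) < eps.

Definition is_Gamma (G : R -> R) : Prop :=
  forall z : R, 0 < z ->
    improper_int_0inf (fun t => Rpower t (z - 1) * exp (- t)) (G z).

Definition is_digamma (G psi : R -> R) : Prop :=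
  forall z : R, 0 < z -> derivable_pt_lim G z (G z * psi z).

Definition is_trigamma (psi psi1 : R -> R) : Prop :=
  forall z : R, 0 < z -> derivable_pt_lim psi z (psi1 z).

(* phi P is the density of log(E_1 ... E_P), E_i i.i.d. Exp(1):
   phi 1 x = exp(x - e^x) (density of log E), and
   phi (P+1) = phi P * phi 1 (convolution, since the log's of the E_i are
   independent and the density of a sum of independent variables is the
   convolution of their densities). *)
Definition is_logprod_exp_density (phi : nat -> R -> R) : Prop :=
  (forall x : R, phi 1%nat x = exp (x - exp x)) /\
  (forall (P : nat) (x : R), (1 <= P)%nat ->
     improper_int_R (fun y => phi P y * phi 1%nat (x - y)) (phi (S P) x)).

Definition saddle_approx (G psi1 : R -> R) (P : nat) (x z : R) : R :=
  G z ^ P * exp (x * (1 - z)) / sqrt (2 * PI * INR P * psi1 z).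

(* Main.v *)
(* Tilting by [exp ((z - 1) x)] turns [phi P] into [G z ^ P] times the [P]-fold convolution of the
   density [exp (z y - exp y) / G z], whose mean is [psi z] and whose variance is [psi1 z]; at the
   saddle point the theorem is a local limit theorem at the mean, uniform in [z]. The Fourier
   transform of the tilted density is [Gamma (z + i t) / Gamma z], and the functional equation of
   Gamma writes its centered version [Y] as the infinite product over [k] of [h (t / (z + k))],
   [h u = e^(iu) / (1 + i u)] (the logarithm of a Gamma variable is minus a sum of independent
   exponentials, suitably centered). With [s ^ 2 = psi1 z = sum_k 1 / (z + k) ^ 2] this gives, uniformly in [z],
   [|Y| ^ 2 <= 1 / (1 + s^2 t^2)] and [|Y - e^(- s^2 t^2 / 2)| <= 2 (s |t|)^3]. Fourier inversion and
   [|Y^P - g^P| <= P |Y - g| max(|Y|, |g|)^(P-1)] then bound the relative error by a multiple of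
   [P * P^(-2) * P^(1/2)]. For the finitely many small [P] the ratio is bounded, by the maximum of the
   tilted density and a Stirling lower bound for [G z]. *)
Require Import Defs.
From Stdlib Require Import Reals Lra Lia Psatz.
From Coquelicot Require Import Coquelicot.
Open Scope R_scope.

(** * Absolutely convergent integrals over the real line *)

(** Uniformity in [x] means that [z] runs over the whole positive half-line: for small [z] the
    tilted density resembles a one-sided exponential of scale [1 / z], for large [z] a Gaussian. The
    product treats both regimes at once, because its factors are one function [h] at rescaled
    arguments and the resulting bounds depend on [z] only through [s * t]. [psi] and [psi1] are
    known only as derivatives of an integral. The series for [psi1] comes from its recurrence
    together with its decay at infinity, and that decay from comparing [psi] with [ln], so the Gamma
    integral is never differentiated under the integral sign. Inversion is done at [P = 1] alone,
    where the transform is already absolutely integrable, and is carried to larger [P] by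
    convolution. The integrands are continuous and dominated by products [A t * f y]; truncation to
    squares then takes the place of general convergence theorems. *)

Definition cts (f : R -> R) : Prop := forall x : R, continuous f x.

Lemma cts_ex_RInt (f : R -> R) (a b : R) : cts f -> ex_RInt f a b.
Proof. intros H; apply (ex_RInt_continuous (V := R_CompleteNormedModule)); intros; apply H. Qed.

Lemma cts_abs (f : R -> R) : cts f -> cts (fun x => Rabs (f x)).
Proof.
  intros H x; apply (continuous_comp f Rabs); [apply H|].
  apply continuity_pt_filterlim, Rcontinuity_abs.
Qed.

Lemma cts_plus (f g : R -> R) : cts f -> cts g -> cts (fun x => f x + g x).
Proof. intros Hf Hg x; apply (continuous_plus (V := R_NormedModule)); auto. Qed.

Lemma cts_minus (f g : R -> R) : cts f -> cts g -> cts (fun x => f x - g x).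
Proof. intros Hf Hg x; apply (continuous_minus (V := R_NormedModule)); auto. Qed.

Lemma cts_mult (f g : R -> R) : cts f -> cts g -> cts (fun x => f x * g x).
Proof. intros Hf Hg x; apply (continuous_mult (K := R_AbsRing)); auto. Qed.

Lemma cts_comp (f g : R -> R) : cts f -> cts g -> cts (fun x => g (f x)).
Proof. intros Hf Hg x; apply continuous_comp; auto. Qed.

Lemma cts_const (c : R) : cts (fun _ => c).
Proof. intros x; apply continuous_const. Qed.

Lemma cts_id : cts (fun x => x).
Proof. intros x; apply continuous_id. Qed.

Lemma cts_ext (f g : R -> R) : (forall x, f x = g x) -> cts f -> cts g.
Proof. intros H Hf x. apply (continuous_ext f); auto. Qed.

Lemma cts_derive (f : R -> R) : (forall x, ex_derive f x) -> cts f.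
Proof. intros H x; apply (ex_derive_continuous (K := R_AbsRing) (V := R_NormedModule)); auto. Qed.

Lemma cts_continuity (f : R -> R) (x : R) : cts f -> continuity_pt f x.
Proof. intros H; apply continuity_pt_filterlim, H. Qed.

Lemma RInt_split (f : R -> R) (a b c : R) : cts f -> RInt f a c = RInt f a b + RInt f b c.
Proof.
  intros H; symmetry.
  apply (RInt_Chasles (V := R_CompleteNormedModule)); apply cts_ex_RInt; auto.
Qed.

Lemma RInt_flip (f : R -> R) (a b : R) : cts f -> RInt f a b = - RInt f b a.
Proof.
  intros Cf; symmetry; apply (opp_RInt_swap (V := R_CompleteNormedModule)), cts_ex_RInt, Cf.
Qed.

Lemma RInt_nonneg (f : R -> R) (a b : R) :
  a <= b -> cts f -> (forall x, 0 <= f x) -> 0 <= RInt f a b.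
Proof. intros; apply RInt_ge_0; auto using cts_ex_RInt. Qed.

Lemma RInt_sum (f g : R -> R) (a b : R) : cts f -> cts g ->
  RInt (fun x => f x + g x) a b = RInt f a b + RInt g a b.
Proof. intros; apply (RInt_plus (V := R_CompleteNormedModule)); apply cts_ex_RInt; auto. Qed.

Lemma RInt_diff (f g : R -> R) (a b : R) : cts f -> cts g ->
  RInt (fun x => f x - g x) a b = RInt f a b - RInt g a b.
Proof. intros; apply (RInt_minus (V := R_CompleteNormedModule)); apply cts_ex_RInt; auto. Qed.

Lemma RInt_mul_const (f : R -> R) (c a b : R) : cts f ->
  RInt (fun x => c * f x) a b = c * RInt f a b.
Proof. intros; apply (RInt_scal (V := R_CompleteNormedModule)); apply cts_ex_RInt; auto. Qed.

Lemma RInt_mono (f g : R -> R) (a b : R) :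
  a <= b -> cts f -> cts g -> (forall x, f x <= g x) -> RInt f a b <= RInt g a b.
Proof. intros; apply RInt_le; auto using cts_ex_RInt. Qed.

Lemma RInt_abs_mono (f g : R -> R) (a b : R) :
  a <= b -> cts f -> cts g -> (forall x, Rabs (f x) <= g x) -> Rabs (RInt f a b) <= RInt g a b.
Proof.
  intros Hab Hf Hg H.
  eapply Rle_trans; [apply abs_RInt_le; auto using cts_ex_RInt|].
  apply RInt_mono; auto using cts_abs.
Qed.

Lemma RInt_nonneg_incl (f : R -> R) (a b a' b' : R) :
  cts f -> (forall x, 0 <= f x) -> a' <= a -> a <= b -> b <= b' -> RInt f a b <= RInt f a' b'.
Proof.
  intros Hf H0 H1 H2 H3.
  rewrite (RInt_split f a' a b'), (RInt_split f a b b'); auto.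
  pose proof (RInt_nonneg f a' a H1 Hf H0); pose proof (RInt_nonneg f b b' H3 Hf H0); lra.
Qed.

Lemma Rinv_le_1 (x : R) : 1 <= x -> / x <= 1.
Proof. intros Hx; apply Rle_trans with (/ 1); [apply Rinv_le_contravar; lra|rewrite Rinv_1; lra]. Qed.

Definition has_int (f : R -> R) (l : R) : Prop :=
  forall eps : R, 0 < eps -> exists M : R, forall a b : R, a <= - M -> M <= b ->
    Rabs (RInt f a b - l) < eps.

(** Continuity is part of the notion, so that every proper integral exists without side
    conditions. *)
Definition integrable (f : R -> R) : Prop :=
  cts f /\ exists B : R, forall a b : R, a <= b -> RInt (fun t => Rabs (f t)) a b <= B.

(** A symmetric limit, made total by [Lim]. It carries meaning where [has_int] or [integrable]
    holds, and there it is the improper integral with independent endpoints. *)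
Definition integ (f : R -> R) : R := real (Lim (fun M => RInt f (- M) M) p_infty).

Lemma has_int_integ (f : R -> R) (l : R) : has_int f l -> integ f = l.
Proof.
  intros H; unfold integ.
  rewrite (is_lim_unique _ p_infty (Finite l)); [reflexivity|].
  apply is_lim_spec; intros eps.
  destruct (H eps (cond_pos eps)) as [M HM]; exists M; intros x Hx.
  apply HM; lra.
Qed.

Lemma has_int_unique (f : R -> R) (l l' : R) : has_int f l -> has_int f l' -> l = l'.
Proof. intros H H'; rewrite <- (has_int_integ f l H); apply has_int_integ; auto. Qed.

(** Integrals of a nonnegative function grow with the interval, so the limit is their supremum. *)
Lemma has_int_nonneg_bounded (f : R -> R) : cts f -> (forall x, 0 <= f x) ->
  (exists B, forall a b, a <= b -> RInt f a b <= B) -> exists l, has_int f l.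
Proof.
  intros Hc H0 [B HB].
  destruct (completeness (fun y => exists a b, a <= b /\ y = RInt f a b)) as [l [Hub Hl]].
  - exists B; intros y (a & b & Hab & ->); auto.
  - exists (RInt f 0 0), 0, 0; split; auto; lra.
  - exists l; intros eps Heps.
    assert (exists a b, a <= b /\ l - eps < RInt f a b) as (a0 & b0 & Hab & H1).
    { apply Classical_Prop.NNPP; intros Hn.
      assert (l <= l - eps); [|lra].
      apply Hl; intros y (a & b & Hab & ->).
      destruct (Rle_lt_dec (RInt f a b) (l - eps)); auto.
      exfalso; apply Hn; eauto. }
    exists (Rmax (Rabs a0) (Rabs b0)); intros a b Ha Hb.
    pose proof (Rmax_l (Rabs a0) (Rabs b0)); pose proof (Rmax_r (Rabs a0) (Rabs b0)).
    pose proof (Rabs_maj2 a0); pose proof (Rle_abs b0).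
    pose proof (RInt_nonneg_incl f a0 b0 a b Hc H0).
    assert (RInt f a b <= l) by (apply Hub; exists a, b; split; auto; lra).
    apply Rabs_def1; lra.
Qed.

Lemma has_int_plus (f g : R -> R) (l m : R) : cts f -> cts g ->
  has_int f l -> has_int g m -> has_int (fun x => f x + g x) (l + m).
Proof.
  intros Cf Cg Hf Hg eps Heps.
  destruct (Hf (eps / 2)) as [M HM]; [lra|]. destruct (Hg (eps / 2)) as [N HN]; [lra|].
  exists (Rmax M N); intros a b Ha Hb.
  pose proof (Rmax_l M N); pose proof (Rmax_r M N).
  rewrite RInt_sum; auto.
  replace (RInt f a b + RInt g a b - (l + m)) with ((RInt f a b - l) + (RInt g a b - m)) by ring.
  eapply Rle_lt_trans; [apply Rabs_triang|].
  pose proof (HM a b); pose proof (HN a b); lra.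
Qed.

Lemma has_int_scal (f : R -> R) (c l : R) : cts f ->
  has_int f l -> has_int (fun x => c * f x) (c * l).
Proof.
  intros Cf Hf eps Heps. pose proof (Rabs_pos c).
  destruct (Hf (eps / (Rabs c + 1))) as [M HM]; [apply Rdiv_lt_0_compat; lra|].
  exists M; intros a b Ha Hb. rewrite RInt_mul_const; auto.
  rewrite <- Rmult_minus_distr_l, Rabs_mult.
  specialize (HM a b Ha Hb).
  apply Rle_lt_trans with (Rabs c * (eps / (Rabs c + 1))).
  - apply Rmult_le_compat_l; lra.
  - replace (Rabs c * (eps / (Rabs c + 1))) with (eps * (Rabs c / (Rabs c + 1))) by (field; lra).
    rewrite <- (Rmult_1_r eps) at 2. apply Rmult_lt_compat_l; auto.
    apply Rmult_lt_reg_r with (Rabs c + 1); [lra|]. field_simplify; lra.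
Qed.

Lemma has_int_ext (f g : R -> R) (l : R) : (forall x, f x = g x) -> has_int f l -> has_int g l.
Proof.
  intros H Hf eps Heps; destruct (Hf eps Heps) as [M HM]; exists M; intros a b Ha Hb.
  rewrite <- (RInt_ext f g) by auto; auto.
Qed.

Lemma integrable_abs (f : R -> R) : integrable f -> integrable (fun x => Rabs (f x)).
Proof.
  intros [Hc [B HB]]; split; [apply cts_abs; auto|]; exists B; intros a b Hab.
  rewrite (RInt_ext _ (fun t => Rabs (f t))); [auto|]; intros; apply Rabs_Rabsolu.
Qed.

Lemma integrable_dominated (f g : R -> R) :
  cts f -> integrable g -> (forall x, Rabs (f x) <= g x) -> integrable f.
Proof.
  intros Cf [Cg [B HB]] H; split; auto. exists B; intros a b Hab.
  eapply Rle_trans; [apply RInt_mono; [auto|apply cts_abs; auto|apply cts_abs, Cg|]|apply HB; auto].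
  intros x; eapply Rle_trans; [apply H|apply Rle_abs].
Qed.

(** Absolute convergence implies convergence: [f] is the difference of the nonnegative functions
    [|f| + f] and [|f|]. *)
Lemma integrable_has_int (f : R -> R) : integrable f -> has_int f (integ f).
Proof.
  intros [Cf [B HB]].
  enough (exists l, has_int f l) as [l Hl] by (rewrite (has_int_integ f l Hl); auto).
  destruct (has_int_nonneg_bounded (fun x => Rabs (f x))) as [l Hl];
    [apply cts_abs; auto|intros; apply Rabs_pos|eauto|].
  assert (C2 : cts (fun x => Rabs (f x) + f x)) by (apply cts_plus; auto using cts_abs).
  destruct (has_int_nonneg_bounded (fun x => Rabs (f x) + f x)) as [m Hm]; auto.
  - intros x; pose proof (Rabs_maj2 (f x)); lra.
  - exists (2 * B); intros a b Hab.
    eapply Rle_trans;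
      [apply (RInt_mono _ (fun x => 2 * Rabs (f x))); auto|].
    + apply cts_mult; [apply cts_const|apply cts_abs; auto].
    + intros x; pose proof (Rle_abs (f x)); lra.
    + rewrite RInt_mul_const by (apply cts_abs; auto). pose proof (HB a b Hab); lra.
  - exists (m + (-1) * l).
    apply (has_int_ext (fun x => (Rabs (f x) + f x) + (-1) * Rabs (f x))); [intros; ring|].
    apply has_int_plus; auto.
    + apply cts_mult; [apply cts_const|apply cts_abs; auto].
    + apply has_int_scal; auto; apply cts_abs; auto.
Qed.

Lemma integrable_nonneg (f : R -> R) (l : R) :
  cts f -> (forall x, 0 <= f x) -> has_int f l -> integrable f.
Proof.
  intros Cf H0 Hf; split; auto.
  destruct (Hf 1) as [M HM]; [lra|].
  exists (l + 1); intros a b Hab.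
  rewrite (RInt_ext _ f) by (intros; apply Rabs_pos_eq; auto).
  pose proof (RInt_nonneg_incl f a b (Rmin a (- M)) (Rmax b M) Cf H0
    (Rmin_l _ _) Hab (Rmax_l _ _)).
  pose proof (HM (Rmin a (- M)) (Rmax b M) (Rmin_r _ _) (Rmax_r _ _)) as H1.
  apply Rabs_def2 in H1; lra.
Qed.

Lemma integ_ext (f g : R -> R) : (forall x, f x = g x) -> integ f = integ g.
Proof.
  intros H; unfold integ; f_equal; apply Lim_ext; intros; apply RInt_ext; auto.
Qed.

Lemma integrable_ext (f g : R -> R) : (forall x, f x = g x) -> integrable f -> integrable g.
Proof.
  intros H [Cf [B HB]]; split; [apply (cts_ext f); auto|].
  exists B; intros a b Hab. rewrite (RInt_ext _ (fun t => Rabs (f t))); auto.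
  intros; rewrite H; auto.
Qed.

Lemma integrable_plus (f g : R -> R) :
  integrable f -> integrable g -> integrable (fun x => f x + g x).
Proof.
  intros [Cf [B HB]] [Cg [B' HB']]; split; [apply cts_plus; auto|].
  exists (B + B'); intros a b Hab.
  eapply Rle_trans; [apply (RInt_mono _ (fun x => Rabs (f x) + Rabs (g x))); auto|].
  - apply cts_abs, cts_plus; auto.
  - apply cts_plus; apply cts_abs; auto.
  - intros; apply Rabs_triang.
  - rewrite RInt_sum by (apply cts_abs; auto). apply Rplus_le_compat; auto.
Qed.

Lemma integrable_scal (c : R) (f : R -> R) : integrable f -> integrable (fun x => c * f x).
Proof.
  intros [Cf [B HB]]; split; [apply cts_mult; auto using cts_const|].
  exists (Rabs c * B); intros a b Hab.
  rewrite (RInt_ext _ (fun x => Rabs c * Rabs (f x))) by (intros; apply Rabs_mult).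
  rewrite RInt_mul_const by (apply cts_abs; auto).
  apply Rmult_le_compat_l; auto using Rabs_pos.
Qed.

Lemma integ_plus (f g : R -> R) : integrable f -> integrable g ->
  integ (fun x => f x + g x) = integ f + integ g.
Proof.
  intros Hf Hg; apply has_int_integ, has_int_plus; auto using integrable_has_int;
    [apply Hf|apply Hg].
Qed.

Lemma integ_scal (c : R) (f : R -> R) : integrable f ->
  integ (fun x => c * f x) = c * integ f.
Proof.
  intros Hf; apply has_int_integ, has_int_scal; auto using integrable_has_int; apply Hf.
Qed.

Lemma integ_lincomb (f g : R -> R) (a b : R) : integrable f -> integrable g ->
  integ (fun x => a * f x + b * g x) = a * integ f + b * integ g.
Proof. intros Hf Hg; rewrite integ_plus, !integ_scal; auto using integrable_scal. Qed.

Lemma integrable_minus (f g : R -> R) :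
  integrable f -> integrable g -> integrable (fun x => f x - g x).
Proof.
  intros Hf Hg; apply (integrable_ext (fun x => f x + (-1) * g x)); [intros; ring|].
  apply integrable_plus; auto; apply integrable_scal; auto.
Qed.

Lemma integ_minus (f g : R -> R) : integrable f -> integrable g ->
  integ (fun x => f x - g x) = integ f - integ g.
Proof.
  intros Hf Hg; rewrite (integ_ext _ (fun x => f x + (-1) * g x)) by (intros; ring).
  rewrite integ_plus, integ_scal; auto; [ring|apply integrable_scal; auto].
Qed.

Lemma integ_nonneg (f : R -> R) : integrable f -> (forall x, 0 <= f x) -> 0 <= integ f.
Proof.
  intros Hf H0; destruct (Rle_lt_dec 0 (integ f)) as [|Hn]; auto; exfalso.
  destruct (integrable_has_int f Hf (- integ f)) as [M HM]; [lra|].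
  pose proof (RInt_nonneg f (- Rabs M) (Rabs M)) as H1.
  pose proof (Rabs_pos M); pose proof (Rle_abs M).
  specialize (HM (- Rabs M) (Rabs M)).
  assert (0 <= RInt f (- Rabs M) (Rabs M)) by (apply H1; auto; [lra|apply Hf]).
  assert (H4 := HM ltac:(lra) ltac:(lra)); apply Rabs_def2 in H4; lra.
Qed.

Lemma integ_le (f g : R -> R) : integrable f -> integrable g -> (forall x, f x <= g x) ->
  integ f <= integ g.
Proof.
  intros Hf Hg H.
  pose proof (integ_nonneg (fun x => g x - f x) (integrable_minus g f Hg Hf)) as H1.
  rewrite integ_minus in H1; auto.
  enough (0 <= integ g - integ f) by lra. apply H1; intros x; pose proof (H x); lra.
Qed.

Lemma integ_abs_le (f g : R -> R) : integrable f -> integrable g ->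
  (forall x, Rabs (f x) <= g x) -> Rabs (integ f) <= integ g.
Proof.
  intros Hf Hg H; apply Rabs_le; split.
  - replace (- integ g) with ((-1) * integ g) by ring. rewrite <- integ_scal by auto.
    apply integ_le; auto using integrable_scal.
    intros x; pose proof (H x); pose proof (Rabs_maj2 (f x)); lra.
  - apply integ_le; auto; intros x; pose proof (H x); pose proof (Rle_abs (f x)); lra.
Qed.

Lemma RInt_le_integ (f : R -> R) (a b : R) :
  a <= b -> integrable f -> (forall x, 0 <= f x) -> RInt f a b <= integ f.
Proof.
  intros Hab Hf H0; apply le_epsilon; intros eps Heps.
  destruct (integrable_has_int f Hf eps Heps) as [M HM].
  pose proof (RInt_nonneg_incl f a b (Rmin a (- M)) (Rmax b M) (proj1 Hf) H0
    (Rmin_l _ _) Hab (Rmax_l _ _)).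
  pose proof (HM (Rmin a (- M)) (Rmax b M) (Rmin_r _ _) (Rmax_r _ _)) as H1.
  apply Rabs_def2 in H1; lra.
Qed.

Lemma has_int_antiderivative (F f : R -> R) (l m : R) :
  cts f -> (forall x, is_derive F x (f x)) ->
  is_lim F m_infty l -> is_lim F p_infty m -> has_int f (m - l).
Proof.
  intros Cf HF Hl Hm eps Heps.
  apply is_lim_spec in Hl; apply is_lim_spec in Hm.
  assert (He : 0 < eps / 2) by lra.
  destruct (Hl (mkposreal _ He)) as [A HA]; destruct (Hm (mkposreal _ He)) as [B HB].
  simpl in HA, HB.
  exists (Rmax (- A) B + 1); intros a b Ha Hb.
  pose proof (Rmax_l (- A) B); pose proof (Rmax_r (- A) B).
  rewrite (is_RInt_unique f a b (F b - F a)).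
  2: { apply (is_RInt_derive (V := R_CompleteNormedModule)); auto. }
  specialize (HA a ltac:(lra)); specialize (HB b ltac:(lra)).
  replace (F b - F a - (m - l)) with ((F b - m) - (F a - l)) by ring.
  apply Rabs_def2 in HA; apply Rabs_def2 in HB; apply Rabs_def1; lra.
Qed.

Lemma cts_affine (u v : R) : cts (fun x => u * x + v).
Proof. apply cts_derive; intros; auto_derive; auto. Qed.

Lemma RInt_affine (f : R -> R) (u v a b : R) : cts f ->
  u * RInt (fun y => f (u * y + v)) a b = RInt f (u * a + v) (u * b + v).
Proof.
  intros Cf. rewrite <- (RInt_comp_lin f u v a b).
  - rewrite <- RInt_mul_const; [reflexivity|].
    apply (cts_comp (fun x => u * x + v)); auto using cts_affine.
  - apply cts_ex_RInt; auto.
Qed.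

Lemma integrable_reflect (f : R -> R) (x : R) :
  integrable f -> integrable (fun y => f (x - y)).
Proof.
  intros [Cf [B HB]]; split.
  { apply (cts_comp (fun y => x - y)); auto. apply cts_minus; auto using cts_const, cts_id. }
  exists B; intros a b Hab.
  rewrite (RInt_ext _ (fun t => Rabs (f (-1 * t + x)))) by (intros; do 2 f_equal; ring).
  pose proof (RInt_affine (fun t => Rabs (f t)) (-1) x a b (cts_abs f Cf)) as H.
  rewrite (RInt_flip (fun t => Rabs (f t)) (-1 * a + x)) in H by (apply cts_abs, Cf).
  pose proof (HB (-1 * b + x) (-1 * a + x)) as H1.
  simpl in H; lra.
Qed.

Lemma integ_reflect (f : R -> R) (x : R) : integrable f -> integ (fun y => f (x - y)) = integ f.
Proof.
  intros Hf; apply has_int_integ; intros eps Heps.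
  destruct (integrable_has_int f Hf eps Heps) as [M HM].
  exists (M + Rabs x); intros a b Ha Hb.
  pose proof (Rle_abs x); pose proof (Rabs_maj2 x).
  rewrite (RInt_ext _ (fun t => f (-1 * t + x))) by (intros; f_equal; ring).
  pose proof (RInt_affine f (-1) x a b (proj1 Hf)) as H1.
  rewrite (RInt_flip f (-1 * a + x)) in H1 by apply Hf.
  replace (RInt (fun t => f (-1 * t + x)) a b) with (RInt f (-1 * b + x) (-1 * a + x)) by lra.
  apply HM; lra.
Qed.

Lemma has_int_rescale (f : R -> R) (c v l : R) : 0 < c -> cts f -> has_int f l ->
  has_int (fun y => f (c * y + v)) (l / c).
Proof.
  intros Hc Cf Hf eps Heps.
  destruct (Hf (c * eps)) as [M HM]; [apply Rmult_lt_0_compat; auto|].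
  exists ((Rabs M + Rabs v) / c); intros a b Ha Hb.
  pose proof (Rle_abs v); pose proof (Rabs_maj2 v); pose proof (Rle_abs M).
  assert (c * a <= - (Rabs M + Rabs v)).
  { apply (Rmult_le_compat_l c) in Ha; [|lra].
    replace (c * - ((Rabs M + Rabs v) / c)) with (- (Rabs M + Rabs v)) in Ha by (field; lra); lra. }
  assert (Rabs M + Rabs v <= c * b).
  { apply (Rmult_le_compat_l c) in Hb; [|lra].
    replace (c * ((Rabs M + Rabs v) / c)) with (Rabs M + Rabs v) in Hb by (field; lra); lra. }
  pose proof (RInt_affine f c v a b Cf) as Haff.
  specialize (HM (c * a + v) (c * b + v) ltac:(lra) ltac:(lra)). rewrite <- Haff in HM.
  apply Rmult_lt_reg_l with c; auto.
  rewrite <- (Rabs_pos_eq c) at 1 by lra. rewrite <- Rabs_mult.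
  replace (c * (RInt (fun y => f (c * y + v)) a b - l / c)) with
    (c * RInt (fun y => f (c * y + v)) a b - l) by (field; lra); auto.
Qed.

(** * Parametric integrals and Fubini *)

Definition cts2 (K : R -> R -> R) : Prop := forall t y : R, continuity_2d_pt K t y.

Lemma cts2_swap (K : R -> R -> R) : cts2 K -> cts2 (fun y t => K t y).
Proof.
  intros H y t eps; destruct (H t y eps) as [d Hd]; exists d; intros u v Hu Hv; apply Hd; auto.
Qed.

Lemma cts2_section (K : R -> R -> R) (t : R) : cts2 K -> cts (K t).
Proof.
  intros H y; apply continuity_pt_filterlim, continuity_pt_locally; intros eps.
  destruct (H t y eps) as [d Hd]; exists d; intros v Hv; apply Hd; auto.
  rewrite Rminus_eq_0, Rabs_R0; apply cond_pos.
Qed.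

Lemma cts2_section_l (K : R -> R -> R) (y : R) : cts2 K -> cts (fun t => K t y).
Proof. intros H; apply (cts2_section (fun y t => K t y)), cts2_swap, H. Qed.

Lemma cts2_mult (K L : R -> R -> R) : cts2 K -> cts2 L -> cts2 (fun t y => K t y * L t y).
Proof. intros HK HL t y; apply continuity_2d_pt_mult; auto. Qed.

Lemma cts2_plus (K L : R -> R -> R) : cts2 K -> cts2 L -> cts2 (fun t y => K t y + L t y).
Proof. intros HK HL t y; apply continuity_2d_pt_plus; auto. Qed.

Lemma cts2_comp (g : R -> R) (K : R -> R -> R) : cts g -> cts2 K -> cts2 (fun t y => g (K t y)).
Proof. intros Hg HK t y; apply continuity_1d_2d_pt_comp; auto; apply cts_continuity, Hg. Qed.

Lemma cts2_fst (g : R -> R) : cts g -> cts2 (fun t _ => g t).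
Proof. intros Hg; apply (cts2_comp g (fun t _ => t)); auto; intros t y; apply continuity_2d_pt_id1. Qed.

Lemma cts2_snd (g : R -> R) : cts g -> cts2 (fun _ y => g y).
Proof. intros Hg; apply (cts2_comp g (fun _ y => y)); auto; intros t y; apply continuity_2d_pt_id2. Qed.

Lemma RInt_param_cts_le (K : R -> R -> R) (a b : R) : a <= b -> cts2 K -> cts (fun t => RInt (K t) a b).
Proof.
  intros Hab H t; apply continuity_pt_filterlim, continuity_pt_locally; intros eps.
  (* The summand [1] keeps the denominator positive when [a = b]. *)
  assert (He : 0 < eps / (2 * (b - a + 1))).
  { apply Rdiv_lt_0_compat; [apply cond_pos|lra]. }
  destruct (uniform_continuity_2d K (t - 1) (t + 1) a b ltac:(intros; apply H) (mkposreal _ He))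
    as [d Hd].
  assert (Hd1 : 0 < Rmin d 1) by (apply Rmin_pos; [apply cond_pos|lra]).
  exists (mkposreal _ Hd1); intros u Hu; simpl in Hu.
  unfold ball in Hu; simpl in Hu; unfold AbsRing_ball, abs, minus, plus, opp in Hu; simpl in Hu.
  pose proof (Rmin_l d 1); pose proof (Rmin_r d 1).
  assert (Hu1 : Rabs (u - t) < Rmin d 1) by exact Hu.
  apply Rabs_def2 in Hu.
  rewrite <- RInt_diff by (apply cts2_section; auto).
  eapply Rle_lt_trans; [apply (abs_RInt_le_const _ a b (eps / (2 * (b - a + 1))))|].
  - auto.
  - apply cts_ex_RInt, cts_minus; apply cts2_section; auto.
  - intros y Hy; left; apply (Hd t y u y); try lra.
    rewrite Rminus_eq_0, Rabs_R0; apply cond_pos.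
  - pose proof (cond_pos eps).
    replace ((b - a) * (eps / (2 * (b - a + 1)))) with (eps * ((b - a) / (2 * (b - a + 1))))
      by (field; lra).
    rewrite <- (Rmult_1_r eps) at 2. apply Rmult_lt_compat_l; auto.
    apply Rmult_lt_reg_r with (2 * (b - a + 1)); [lra|]. field_simplify; lra.
Qed.

Lemma RInt_param_cts (K : R -> R -> R) (a b : R) : cts2 K -> cts (fun t => RInt (K t) a b).
Proof.
  intros H; destruct (Rle_lt_dec a b); [apply RInt_param_cts_le; auto|].
  apply (cts_ext (fun t => 0 - RInt (K t) b a)).
  - intros t; rewrite (RInt_flip (K t) a b) by (apply cts2_section, H); ring.
  - apply cts_minus; [apply cts_const|apply RInt_param_cts_le; auto; lra].
Qed.

Lemma is_derive_RInt_upper (f : R -> R) (a b : R) : cts f -> is_derive (fun x => RInt f a x) b (f b).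
Proof.
  intros Cf; apply (is_derive_RInt (V := R_CompleteNormedModule) f (fun x => RInt f a x) a b); auto.
  exists (mkposreal 1 Rlt_0_1); intros x _.
  apply (RInt_correct (V := R_CompleteNormedModule)), cts_ex_RInt; auto.
Qed.

(** Both sides vanish at [b = a] and have the same derivative [RInt (K b) c d] in [b], the right one
    by differentiation under the integral sign. *)
Lemma RInt_fubini (K : R -> R -> R) (a b c d : R) : a <= b -> cts2 K ->
  RInt (fun t => RInt (K t) c d) a b = RInt (fun y => RInt (fun t => K t y) a b) c d.
Proof.
  intros Hab H.
  set (D := fun x => RInt (fun t => RInt (K t) c d) a x - RInt (fun y => RInt (fun t => K t y) a x) c d).
  assert (HD : forall x, is_derive D x 0).
  { intros x; unfold D.
    replace 0 with (minus (RInt (K x) c d) (RInt (K x) c d)) by (apply (minus_eq_zero (G := R_AbelianGroup))).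
    apply (is_derive_minus (K := R_AbsRing) (V := R_NormedModule)).
    - apply (is_derive_RInt_upper (fun t => RInt (K t) c d)), RInt_param_cts, H.
    - assert (HK : forall u v, is_derive (fun z => RInt (fun t => K t v) a z) u (K u v))
        by (intros; apply (is_derive_RInt_upper (fun t => K t v)), cts2_section_l, H).
      rewrite (RInt_ext (K x) (fun y => Derive (fun u => RInt (fun t => K t y) a u) x))
        by (intros y _; symmetry; apply is_derive_unique, HK).
      apply (is_derive_RInt_param (fun x y => RInt (fun t => K t y) a x)).
      + apply filter_forall; intros u t _; eexists; apply HK.
      + intros t _; apply (continuity_2d_pt_ext K); auto.
        intros u v; symmetry; apply is_derive_unique, HK.
      + apply filter_forall; intros u; apply cts_ex_RInt.
        apply (RInt_param_cts (fun y t => K t y)), cts2_swap, H. }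
  assert (E : D a = 0).
  { unfold D; rewrite RInt_point, (RInt_ext _ (fun _ => 0))
      by (intros; apply (RInt_point (V := R_CompleteNormedModule))).
    rewrite RInt_const; unfold zero, scal; simpl; unfold mult; simpl; ring. }
  enough (D b = 0) by (unfold D in *; lra).
  destruct Hab as [Hab| <-]; auto.
  rewrite <- E; symmetry; apply (eq_is_derive (V := R_NormedModule) D a b); auto.
Qed.

(** On the pieces of a wide window [[a', b']] outside [[a, b]] the integrals of [g] are controlled
    by those of [h]; the window replaces the whole line up to [eps]. *)
Lemma integ_tail_le (g h : R -> R) (a b : R) : a <= b -> integrable g -> integrable h ->
  (forall x, Rabs (g x) <= h x) -> Rabs (integ g - RInt g a b) <= integ h - RInt h a b.
Proof.
  intros Hab Hg Hh H; apply le_epsilon; intros eps Heps.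
  assert (H0 : forall x, 0 <= h x) by (intros x; eapply Rle_trans; [apply Rabs_pos|apply H]).
  destruct (integrable_has_int g Hg eps Heps) as [M HM].
  set (a' := Rmin a (- M)); set (b' := Rmax b M).
  specialize (HM a' b' (Rmin_r _ _) (Rmax_r _ _)).
  assert (Ha : a' <= a) by apply Rmin_l. assert (Hb : b <= b') by apply Rmax_l.
  destruct Hg as [Cg _]; pose proof (proj1 Hh) as Ch.
  pose proof (RInt_le_integ h a' b' ltac:(lra) Hh H0) as H1.
  rewrite (RInt_split h a' a b'), (RInt_split h a b b') in H1 by auto.
  rewrite (RInt_split g a' a b'), (RInt_split g a b b') in HM by auto.
  pose proof (RInt_abs_mono g h a' a Ha Cg Ch H) as H2.
  pose proof (RInt_abs_mono g h b b' Hb Cg Ch H) as H3.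
  replace (integ g - RInt g a b) with
    (- (RInt g a' a + (RInt g a b + RInt g b b') - integ g) + (RInt g a' a + RInt g b b')) by ring.
  eapply Rle_trans; [apply Rabs_triang|].
  pose proof (Rabs_triang (RInt g a' a) (RInt g b b')). rewrite Rabs_Ropp; lra.
Qed.

Lemma integ_tail_small (h : R -> R) (eps : R) : 0 < eps -> integrable h ->
  exists M0, forall M, M0 <= M -> integ h - RInt h (- M) M < eps.
Proof.
  intros Heps Hh; destruct (integrable_has_int h Hh eps Heps) as [M HM].
  exists M; intros N HN. specialize (HM (- N) N ltac:(lra) HN). apply Rabs_def2 in HM; lra.
Qed.

Section Dominated.

Variables (K : R -> R -> R) (A f : R -> R).
Hypotheses (HK : cts2 K) (Hf : integrable f) (HA0 : forall t, 0 <= A t) (Hf0 : forall y, 0 <= f y)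
  (HB : forall t y, Rabs (K t y) <= A t * f y).

Lemma dominated_section (t : R) : integrable (K t).
Proof.
  apply (integrable_dominated _ (fun y => A t * f y)); auto.
  - apply cts2_section; auto.
  - apply integrable_scal; auto.
Qed.

Lemma dominated_tail (t M : R) : 0 <= M ->
  Rabs (integ (K t) - RInt (K t) (- M) M) <= A t * (integ f - RInt f (- M) M).
Proof.
  intros HM. rewrite Rmult_minus_distr_l, <- integ_scal, <- RInt_mul_const; auto; [|apply Hf].
  apply integ_tail_le; auto; [lra|apply dominated_section|apply integrable_scal; auto].
Qed.

(** Tails beyond [[- M, M]] are small uniformly for parameters near [t], since [A] stays below
    [A t + 1] there; the middle piece is continuous by [RInt_param_cts]. *)
Lemma integ_param_cts : cts A -> cts (fun t => integ (K t)).
Proof.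
  intros CA t; apply continuity_pt_filterlim, continuity_pt_locally; intros eps.
  set (B := A t + 1). assert (0 < B) by (unfold B; pose proof (HA0 t); lra).
  pose proof (cond_pos eps).
  assert (He : 0 < eps / (3 * B)) by (apply Rdiv_lt_0_compat; lra).
  assert (He3 : 0 < eps / 3) by lra.
  destruct (integ_tail_small f _ He Hf) as [M0 HM0].
  set (M := Rmax M0 0). assert (HM : 0 <= M) by apply Rmax_r.
  specialize (HM0 M (Rmax_l _ _)).
  pose proof (CA t) as CAt; apply continuity_pt_filterlim in CAt.
  destruct (proj1 (continuity_pt_locally _ _) CAt (mkposreal 1 Rlt_0_1)) as [d1 Hd1].
  pose proof (RInt_param_cts K (- M) M HK t) as CK; apply continuity_pt_filterlim in CK.
  destruct (proj1 (continuity_pt_locally _ _) CK (mkposreal _ He3)) as [d2 Hd2].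
  assert (Hd : 0 < Rmin d1 d2) by (apply Rmin_pos; apply cond_pos).
  exists (mkposreal _ Hd); intros u Hu.
  specialize (Hd1 u (ball_le _ _ _ (Rmin_l d1 d2) _ Hu)).
  specialize (Hd2 u (ball_le _ _ _ (Rmin_r d1 d2) _ Hu)). simpl in Hd1, Hd2.
  assert (HT : forall s, A s <= B ->
    Rabs (integ (K s) - RInt (K s) (- M) M) <= eps / 3).
  { intros s Hs; eapply Rle_trans; [apply dominated_tail; auto|].
    replace (eps / 3) with (B * (eps / (3 * B))) by (field; lra).
    pose proof (integ_tail_le f f (- M) M ltac:(lra) Hf Hf) as Hp.
    pose proof (RInt_le_integ f (- M) M ltac:(lra) Hf Hf0).
    apply Rmult_le_compat; auto; lra. }
  pose proof (HT t ltac:(unfold B; lra)) as H1.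
  pose proof (HT u ltac:(unfold B; apply Rabs_def2 in Hd1; lra)) as H2.
  apply Rabs_le_between in H1; apply Rabs_le_between in H2; apply Rabs_def2 in Hd2.
  apply Rabs_def1; lra.
Qed.

Lemma integrable_integ_param : integrable A -> integrable (fun t => integ (K t)).
Proof.
  intros HA; apply (integrable_dominated _ (fun t => integ f * A t)).
  - apply integ_param_cts, HA.
  - apply integrable_scal; auto.
  - intros t; rewrite Rmult_comm, <- integ_scal by auto.
    apply integ_abs_le; auto; [apply dominated_section|apply integrable_scal; auto].
Qed.

(** The complement of the square is covered by the strips [|t| > M] and [|y| > M]; the product bound
    gives one term for each. *)
Lemma dominated_square (M : R) : 0 <= M -> integrable A ->
  Rabs (integ (fun t => integ (K t)) - RInt (fun t => RInt (K t) (- M) M) (- M) M) <=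
  integ f * (integ A - RInt A (- M) M) + integ A * (integ f - RInt f (- M) M).
Proof.
  intros HM HA.
  replace (integ (fun t => integ (K t)) - RInt (fun t => RInt (K t) (- M) M) (- M) M) with
    ((integ (fun t => integ (K t)) - RInt (fun t => integ (K t)) (- M) M) +
     RInt (fun t => integ (K t) - RInt (K t) (- M) M) (- M) M).
  2:{ rewrite RInt_diff; [ring|apply integ_param_cts, HA|apply RInt_param_cts, HK]. }
  eapply Rle_trans; [apply Rabs_triang|]. apply Rplus_le_compat.
  - rewrite Rmult_minus_distr_l, <- integ_scal, <- RInt_mul_const; auto; [|apply HA].
    apply integ_tail_le; [lra|apply integrable_integ_param; auto|apply integrable_scal; auto|].
    intros t; rewrite Rmult_comm, <- integ_scal by auto.
    apply integ_abs_le; auto; [apply dominated_section|apply integrable_scal; auto].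
  - eapply Rle_trans; [apply (RInt_abs_mono _ (fun t => (integ f - RInt f (- M) M) * A t)); [lra| | |]|].
    + apply cts_minus; [apply integ_param_cts, HA|apply RInt_param_cts, HK].
    + apply cts_mult; [apply cts_const|apply HA].
    + intros t; rewrite Rmult_comm; apply dominated_tail; auto.
    + rewrite RInt_mul_const by apply HA. rewrite Rmult_comm.
      pose proof (RInt_le_integ f (- M) M ltac:(lra) Hf Hf0).
      pose proof (RInt_le_integ A (- M) M ltac:(lra) HA HA0).
      apply Rmult_le_compat_r; lra.
Qed.

End Dominated.

(** For large [M] both iterated integrals are within [eps / 2] of the integral over the same square,
    where the order is free by [RInt_fubini]. *)
Lemma integ_fubini (K : R -> R -> R) (A f : R -> R) :
  cts2 K -> integrable A -> integrable f -> (forall t, 0 <= A t) -> (forall y, 0 <= f y) ->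
  (forall t y, Rabs (K t y) <= A t * f y) ->
  integ (fun t => integ (K t)) = integ (fun y => integ (fun t => K t y)).
Proof.
  intros HK HA Hf HA0 Hf0 HB.
  apply Rminus_diag_uniq, Rabs_eq_0, Rle_antisym; [|apply Rabs_pos].
  apply le_epsilon; intros eps Heps; rewrite Rplus_0_l.
  pose proof (integ_nonneg A HA HA0); pose proof (integ_nonneg f Hf Hf0).
  set (B := integ A + integ f + 1).
  assert (He : 0 < eps / (2 * B)) by (apply Rdiv_lt_0_compat; unfold B; lra).
  destruct (integ_tail_small A _ He HA) as [M1 HM1].
  destruct (integ_tail_small f _ He Hf) as [M2 HM2].
  set (M := Rmax 0 (Rmax M1 M2)).
  assert (HM : 0 <= M) by apply Rmax_l.
  specialize (HM1 M (Rle_trans _ _ _ (Rmax_l _ _) (Rmax_r _ _))).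
  specialize (HM2 M (Rle_trans _ _ _ (Rmax_r _ _) (Rmax_r _ _))).
  pose proof (dominated_square K A f HK Hf HA0 Hf0 HB M HM HA) as H1.
  pose proof (dominated_square (fun y t => K t y) f A (cts2_swap K HK) HA Hf0 HA0
    ltac:(intros; rewrite Rmult_comm; apply HB) M HM Hf) as H2.
  rewrite RInt_fubini in H1 by (auto; lra).
  pose proof (RInt_le_integ f (- M) M ltac:(lra) Hf Hf0).
  pose proof (RInt_le_integ A (- M) M ltac:(lra) HA HA0).
  set (I1 := integ (fun t => integ (K t))) in *.
  set (I2 := integ (fun y => integ (fun t => K t y))) in *.
  set (S := RInt (fun y => RInt (fun t => K t y) (- M) M) (- M) M) in *.
  assert (H5 : integ f * (integ A - RInt A (- M) M) + integ A * (integ f - RInt f (- M) M) <= eps / 2).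
  { replace (eps / 2) with (B * (eps / (2 * B))) by (field; unfold B; lra).
    apply Rle_trans with ((integ f + integ A) * (eps / (2 * B))); [nra|].
    apply Rmult_le_compat_r; [lra|unfold B; lra]. }
  apply Rabs_le_between in H1; apply Rabs_le_between in H2; apply Rabs_le; lra.
Qed.

(** * Gamma, digamma and trigamma *)

(** The Gamma integrand in the variable [y = ln t]; [ek 1] is the density of the logarithm of a
    standard exponential. *)
Definition ek (z y : R) : R := exp (z * y - exp y).

Lemma ek_pos (z y : R) : 0 < ek z y.
Proof. apply exp_pos. Qed.

Lemma ek_cts (z : R) : cts (ek z).
Proof. apply cts_derive; intros; unfold ek; auto_derive; auto. Qed.

Lemma ek_shift (z h y : R) : ek (z + h) y = ek z y * exp (h * y).
Proof. unfold ek; rewrite <- exp_plus; f_equal; ring. Qed.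

Lemma ek_succ (z y : R) : ek (z + 1) y = ek z y * exp y.
Proof. rewrite ek_shift; do 2 f_equal; ring. Qed.

Lemma exp_neg_le (u : R) : 0 < u -> exp (- u) <= / u.
Proof.
  intros Hu; rewrite exp_Ropp; apply Rinv_le_contravar; auto.
  pose proof (exp_ineq1_le u); lra.
Qed.

(** The purpose is the vanishing of boundary terms, for which the rate [1 / |y|] suffices. The
    threshold [4 * (z + 1)] is where [y^2 / 4], a lower bound for [exp y], overtakes
    [(z + 1) * y]. *)
Lemma ek_decay (z y : R) : 0 < z -> y < 0 \/ 4 * (z + 1) < y -> ek z y <= (/ z + 1) / Rabs y.
Proof.
  intros Hz [Hy|Hy]; unfold ek.
  - apply Rle_trans with (exp (- (z * - y))).
    { left; apply exp_increasing; pose proof (exp_pos y); lra. }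
    assert (0 < z * - y) by (apply Rmult_lt_0_compat; lra).
    eapply Rle_trans; [apply exp_neg_le; auto|].
    rewrite Rabs_left by auto.
    replace (/ (z * - y)) with (/ z * / - y) by (field; lra).
    unfold Rdiv; apply Rmult_le_compat_r; [|lra].
    left; apply Rinv_0_lt_compat; lra.
  - assert (exp y >= (z + 1) * y).
    { replace y with (y / 2 + y / 2) at 1 by field. rewrite exp_plus.
      pose proof (exp_ineq1_le (y / 2)); nra. }
    apply Rle_trans with (exp (- y)).
    { destruct (Req_dec (z * y - exp y) (- y)) as [->|]; [lra|].
      left; apply exp_increasing; lra. }
    eapply Rle_trans; [apply exp_neg_le; lra|].
    rewrite Rabs_pos_eq by lra.
    replace (/ y) with (1 * / y) by ring. unfold Rdiv; apply Rmult_le_compat_r.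
    + left; apply Rinv_0_lt_compat; lra.
    + assert (0 < / z) by (apply Rinv_0_lt_compat; auto). lra.
Qed.

Lemma ek_vanish (z : R) (g : R -> R) (eps : R) : 0 < z -> (forall y, Rabs (g y) <= 1) -> 0 < eps ->
  exists M, forall y, y < - M \/ M < y -> Rabs (ek z y * g y) < eps.
Proof.
  intros Hz Hg Heps.
  assert (Hiz : 0 < / z) by (apply Rinv_0_lt_compat; auto).
  set (q := (/ z + 1) / eps). assert (Hq : 0 < q) by (apply Rdiv_lt_0_compat; lra).
  exists (4 * (z + 1) + q); intros y Hy.
  assert (Hy' : q < Rabs y).
  { destruct Hy; [rewrite Rabs_left by lra|rewrite Rabs_pos_eq by lra]; lra. }
  rewrite Rabs_mult, (Rabs_pos_eq (ek z y)) by (left; apply ek_pos).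
  apply Rle_lt_trans with (ek z y).
  { rewrite <- (Rmult_1_r (ek z y)) at 2; apply Rmult_le_compat_l; auto; left; apply ek_pos. }
  eapply Rle_lt_trans; [apply ek_decay; auto; lra|].
  apply Rmult_lt_reg_r with (Rabs y); [lra|].
  replace ((/ z + 1) / Rabs y * Rabs y) with (eps * q) by (unfold q; field; lra).
  apply Rmult_lt_compat_l; auto.
Qed.

Lemma ek_lim (z : R) (g : R -> R) : 0 < z -> (forall y, Rabs (g y) <= 1) ->
  is_lim (fun y => ek z y * g y) m_infty 0 /\ is_lim (fun y => ek z y * g y) p_infty 0.
Proof.
  intros Hz Hg; split; apply is_lim_spec; intros eps;
    destruct (ek_vanish z g eps Hz Hg (cond_pos eps)) as [M HM].
  - exists (- M); intros y Hy; rewrite Rminus_0_r; auto.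
  - exists M; intros y Hy; rewrite Rminus_0_r; auto.
Qed.

(** The substitution [t = exp y] absorbs [dt = exp y dy], which raises the exponent [z - 1] to
    [z]. *)
Lemma Gamma_has_int (G : R -> R) (z : R) : is_Gamma G -> 0 < z -> has_int (ek z) (G z).
Proof.
  intros HG Hz eps Heps.
  destruct (HG z Hz eps Heps) as (d & M & Hd & H).
  (* The cutoff in [y] puts [exp a] below [d] and [exp b] above [M]; [Rmax M 1] keeps the argument
     of the logarithm positive. *)
  exists (Rmax (- ln d) (ln (Rmax M 1))); intros a b Ha Hb.
  pose proof (Rmax_l (- ln d) (ln (Rmax M 1))); pose proof (Rmax_r (- ln d) (ln (Rmax M 1))).
  pose proof (Rmax_l M 1); pose proof (Rmax_r M 1).
  assert (Hexp : forall u v, u <= v -> exp u <= exp v).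
  { intros u v [Huv| ->]; [left; apply exp_increasing; auto|lra]. }
  destruct (H (exp a) (exp b)) as [pr Hpr].
  - apply exp_pos.
  - rewrite <- (exp_ln d) by auto; apply Hexp; lra.
  - apply Rle_trans with (Rmax M 1); auto.
    rewrite <- (exp_ln (Rmax M 1)) by lra; apply Hexp; lra.
  - rewrite <- (RInt_Reals _ _ _ pr) in Hpr.
    rewrite <- (RInt_comp (fun t => Rpower t (z - 1) * exp (- t)) exp exp a b) in Hpr.
    + rewrite (RInt_ext _ (ek z)) in Hpr; auto.
      intros y _; unfold scal; simpl; unfold mult; simpl; unfold Rpower, ek.
      rewrite ln_exp, <- !exp_plus; f_equal; ring.
    + intros y _. apply (ex_derive_continuous (K := R_AbsRing) (V := R_NormedModule)).
      unfold Rpower; auto_derive; repeat split; auto; apply exp_pos.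
    + intros y _; split; [apply is_derive_exp|].
      apply (ex_derive_continuous (K := R_AbsRing) (V := R_NormedModule)); auto_derive; auto.
Qed.

(** [Ck] and [Sk] are the real and imaginary parts of Gamma at [z + i t]. *)
Definition Ck (z t : R) : R := integ (fun y => ek z y * cos (t * y)).
Definition Sk (z t : R) : R := integ (fun y => ek z y * sin (t * y)).

Lemma cts_cos : cts cos.
Proof. apply cts_derive; intros; auto_derive; auto. Qed.

Lemma cts_sin : cts sin.
Proof. apply cts_derive; intros; auto_derive; auto. Qed.

Lemma Rabs_cos_le (x : R) : Rabs (cos x) <= 1.
Proof. pose proof (COS_bound x); apply Rabs_le; lra. Qed.

Lemma Rabs_sin_le (x : R) : Rabs (sin x) <= 1.
Proof. pose proof (SIN_bound x); apply Rabs_le; lra. Qed.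

Section GammaFacts.

Variable G : R -> R.
Hypothesis HG : is_Gamma G.

Lemma ek_integrable (z : R) : 0 < z -> integrable (ek z).
Proof.
  intros Hz; apply (integrable_nonneg _ (G z)); [apply ek_cts| |apply Gamma_has_int; auto].
  intros; left; apply ek_pos.
Qed.

Lemma integ_ek (z : R) : 0 < z -> integ (ek z) = G z.
Proof. intros; apply has_int_integ, Gamma_has_int; auto. Qed.

Lemma Gamma_pos (z : R) : 0 < z -> 0 < G z.
Proof.
  intros Hz; rewrite <- integ_ek by auto.
  apply Rlt_le_trans with (RInt (ek z) 0 1).
  - apply RInt_gt_0; [lra| |]; intros; [apply ek_pos|apply ek_cts].
  - apply RInt_le_integ; [lra|apply ek_integrable; auto|intros; left; apply ek_pos].
Qed.

Lemma ek_mult_integrable (z : R) (g : R -> R) : 0 < z -> cts g -> (forall y, Rabs (g y) <= 1) ->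
  integrable (fun y => ek z y * g y).
Proof.
  intros Hz Cg Hg; apply (integrable_dominated _ (ek z)).
  - apply cts_mult; auto using ek_cts.
  - apply ek_integrable; auto.
  - intros y; rewrite Rabs_mult, (Rabs_pos_eq (ek z y)) by (left; apply ek_pos).
    rewrite <- (Rmult_1_r (ek z y)) at 2; apply Rmult_le_compat_l; auto; left; apply ek_pos.
Qed.

Lemma ek_cos_integrable (z t : R) : 0 < z -> integrable (fun y => ek z y * cos (t * y)).
Proof.
  intros Hz; apply ek_mult_integrable; auto using Rabs_cos_le.
  apply (cts_comp (fun y => t * y)); [apply cts_mult; auto using cts_const, cts_id|apply cts_cos].
Qed.

Lemma ek_sin_integrable (z t : R) : 0 < z -> integrable (fun y => ek z y * sin (t * y)).
Proof.
  intros Hz; apply ek_mult_integrable; auto using Rabs_sin_le.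
  apply (cts_comp (fun y => t * y)); [apply cts_mult; auto using cts_const, cts_id|apply cts_sin].
Qed.

Lemma integ_comb3 (f g h : R -> R) (a b c : R) : integrable f -> integrable g -> integrable h ->
  has_int (fun x => a * f x + b * g x + c * h x) (a * integ f + b * integ g + c * integ h).
Proof.
  intros Hf Hg Hh. rewrite <- !integ_scal, <- !integ_plus by auto using integrable_plus, integrable_scal.
  apply integrable_has_int; auto using integrable_plus, integrable_scal.
Qed.

(** Integration by parts: the derivative of [ek z y * cos (t * y)] integrates to [0]. Together with
    [Sk_succ] this is the functional equation of Gamma at [z + i t]; the case [t = 0] gives
    [Gamma_succ]. *)
Lemma Ck_succ (z t : R) : 0 < z -> Ck (z + 1) t = z * Ck z t - t * Sk z t.
Proof.
  intros Hz.
  assert (H : has_int (fun y => z * (ek z y * cos (t * y)) + (-1) * (ek (z + 1) y * cos (t * y)) +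
    (- t) * (ek z y * sin (t * y))) (0 - 0)).
  { destruct (ek_lim z (fun y => cos (t * y)) Hz ltac:(intros; apply Rabs_cos_le)).
    apply (has_int_antiderivative (fun y => ek z y * cos (t * y))); auto.
    - apply cts_derive; intros; unfold ek; auto_derive; auto.
    - intros y; rewrite ek_succ; unfold ek, Rminus; auto_derive; auto; ring. }
  pose proof (has_int_unique _ _ _ H (integ_comb3 _ _ _ z (-1) (- t)
    (ek_cos_integrable z t Hz) (ek_cos_integrable (z + 1) t ltac:(lra)) (ek_sin_integrable z t Hz))) as E.
  unfold Ck, Sk; lra.
Qed.

Lemma Sk_succ (z t : R) : 0 < z -> Sk (z + 1) t = z * Sk z t + t * Ck z t.
Proof.
  intros Hz.
  assert (H : has_int (fun y => z * (ek z y * sin (t * y)) + (-1) * (ek (z + 1) y * sin (t * y)) +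
    t * (ek z y * cos (t * y))) (0 - 0)).
  { destruct (ek_lim z (fun y => sin (t * y)) Hz ltac:(intros; apply Rabs_sin_le)).
    apply (has_int_antiderivative (fun y => ek z y * sin (t * y))); auto.
    - apply cts_derive; intros; unfold ek; auto_derive; auto.
    - intros y; rewrite ek_succ; unfold ek, Rminus; auto_derive; auto; ring. }
  pose proof (has_int_unique _ _ _ H (integ_comb3 _ _ _ z (-1) t
    (ek_sin_integrable z t Hz) (ek_sin_integrable (z + 1) t ltac:(lra)) (ek_cos_integrable z t Hz))) as E.
  unfold Ck, Sk; lra.
Qed.

Lemma Ck_0 (z : R) : 0 < z -> Ck z 0 = G z.
Proof.
  intros Hz; rewrite <- integ_ek by auto; apply integ_ext; intros y.
  rewrite Rmult_0_l, cos_0; ring.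
Qed.

Lemma Gamma_succ (z : R) : 0 < z -> G (z + 1) = z * G z.
Proof. intros Hz; rewrite <- !Ck_0, Ck_succ by lra; ring. Qed.

End GammaFacts.

(** * Digamma against the logarithm, and the trigamma series *)

Section Digamma.

Variables G psi psi1 : R -> R.
Hypotheses (HG : is_Gamma G) (Hpsi : is_digamma G psi) (Hpsi1 : is_trigamma psi psi1).

Lemma is_derive_eq_loc (f g : R -> R) (x a b : R) : 0 < x -> (forall y, 0 < y -> f y = g y) ->
  is_derive f x a -> is_derive g x b -> a = b.
Proof.
  intros Hx E Hf Hg. rewrite <- (is_derive_unique f x a Hf), <- (is_derive_unique g x b Hg).
  apply Derive_ext_loc. exists (mkposreal x Hx); intros y Hy; apply E.
  apply Rabs_def2 in Hy; unfold minus, plus, opp in Hy; simpl in Hy; lra.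
Qed.

Lemma digamma_succ (z : R) : 0 < z -> psi (z + 1) = psi z + / z.
Proof.
  intros Hz.
  assert (H1 : is_derive (fun x => G (x + 1)) z (G (z + 1) * psi (z + 1))).
  { pose proof (Hpsi (z + 1) ltac:(lra)) as H; apply is_derive_Reals in H.
    auto_derive; [eexists; apply H|].
    rewrite (is_derive_unique (fun x : R => G x) _ _ H); ring. }
  assert (H2 : is_derive (fun x => x * G x) z (G z + z * (G z * psi z))).
  { pose proof (Hpsi z Hz) as H; apply is_derive_Reals in H.
    auto_derive; [eexists; apply H|].
    rewrite (is_derive_unique (fun x : R => G x) _ _ H); ring. }
  pose proof (is_derive_eq_loc _ _ z _ _ Hz (Gamma_succ G HG) H1 H2) as E.
  rewrite Gamma_succ in E by auto. pose proof (Gamma_pos G HG z Hz).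
  apply Rmult_eq_reg_l with (z * G z); [|nra].
  rewrite E; field; lra.
Qed.

Lemma trigamma_succ (z : R) : 0 < z -> psi1 z = psi1 (z + 1) + / z ^ 2.
Proof.
  intros Hz.
  assert (H1 : is_derive (fun x => psi (x + 1)) z (psi1 (z + 1))).
  { pose proof (Hpsi1 (z + 1) ltac:(lra)) as H; apply is_derive_Reals in H.
    auto_derive; [eexists; apply H|].
    rewrite (is_derive_unique (fun x : R => psi x) _ _ H); ring. }
  assert (H2 : is_derive (fun x => psi x + / x) z (psi1 z - / z ^ 2)).
  { pose proof (Hpsi1 z Hz) as H; apply is_derive_Reals in H.
    auto_derive; [split; [eexists; apply H|split; auto; lra]|].
    rewrite (is_derive_unique (fun x : R => psi x) _ _ H); field; lra. }
  pose proof (is_derive_eq_loc _ _ z _ _ Hz digamma_succ H1 H2); lra.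
Qed.

Lemma derive_lower_bound (f : R -> R) (d c r : R) : 0 < r -> is_derive f 0 d -> f 0 = 0 ->
  (forall h, 0 < h <= r -> c * h <= f h) -> c <= d.
Proof.
  intros Hr Hd H0 H; apply is_derive_Reals in Hd. apply le_epsilon; intros eps Heps.
  destruct (Hd eps Heps) as [del Hdel].
  pose proof (cond_pos del).
  set (h := Rmin (del / 2) r).
  assert (Hh : 0 < h) by (apply Rmin_pos; lra).
  assert (h <= del / 2) by apply Rmin_l. assert (h <= r) by apply Rmin_r.
  specialize (Hdel h ltac:(lra)).
  rewrite (Rabs_pos_eq h), Rplus_0_l, H0 in Hdel by lra.
  specialize (Hdel ltac:(lra)). specialize (H h ltac:(lra)).
  apply Rabs_def2 in Hdel.
  assert (c <= (f h - 0) / h); [|lra].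
  apply Rmult_le_reg_r with h; [lra|]. field_simplify; lra.
Qed.

Lemma derive_opp_arg (f : R -> R) (d : R) : is_derive f 0 d -> is_derive (fun h => f (- h)) 0 (- d).
Proof.
  intros H. rewrite <- Ropp_0 in H. auto_derive; [eexists; apply H|].
  rewrite (is_derive_unique (fun x : R => f x) _ _ H); ring.
Qed.

Lemma digamma_centered_derive (w : R) : 0 < w ->
  is_derive (fun h => G (w + h) * exp (- h * ln w) - G w) 0 (G w * (psi w - ln w)).
Proof.
  intros Hw; pose proof (Hpsi w Hw) as H; apply is_derive_Reals in H.
  rewrite <- (Rplus_0_r w) in H at 1.
  auto_derive; [eexists; apply H|].
  rewrite (is_derive_unique (fun x : R => G x) _ _ H), Ropp_0, Rmult_0_l, Rplus_0_r, exp_0; ring.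
Qed.

(** Jensen's inequality for the logarithm of a Gamma variable of mean [w], applied to the increment
    in [h] so that no derivative is taken inside the integral. *)
Lemma digamma_le_ln (w : R) : 1 < w -> psi w <= ln w.
Proof.
  intros Hw; pose proof (Gamma_pos G HG w ltac:(lra)) as HGw.
  pose proof (derive_opp_arg _ _ (digamma_centered_derive w ltac:(lra))) as Hd.
  enough (0 <= - (G w * (psi w - ln w))) by nra.
  apply (derive_lower_bound _ _ _ (w / 2) ltac:(lra) Hd).
  - rewrite Ropp_0, Rplus_0_r, Ropp_0, Rmult_0_l, exp_0; ring.
  - intros h Hh.
    enough (G w <= G (w + - h) * exp (- - h * ln w)) by lra.
    rewrite <- (integ_ek G HG (w + - h)) by lra.
    rewrite Rmult_comm, <- integ_scal by (apply (ek_integrable G); auto; lra).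
    (* The bounds [exp (h * b) >= 1 + h * b] and [b = ln w - y >= 1 - exp y / w] leave a combination
       of [ek w] and [ek (w + 1)] whose integral is exactly [G w]. *)
    assert (E : G w = integ (fun y => (1 + h) * ek w y + (- h / w) * ek (w + 1) y)).
    { rewrite integ_lincomb, !(integ_ek G), (Gamma_succ G) by (auto; try apply (ek_integrable G); auto; lra).
      field; lra. }
    rewrite E. apply integ_le.
    - apply integrable_plus; apply integrable_scal, (ek_integrable G); auto; lra.
    - apply integrable_scal, (ek_integrable G); auto; lra.
    - intros y; rewrite ek_succ, (ek_shift w (- h)).
      replace (exp (- - h * ln w) * (ek w y * exp (- h * y))) with (ek w y * exp (h * (ln w - y)))
        by (replace (h * (ln w - y)) with (- - h * ln w + - h * y) by ring; rewrite exp_plus; ring).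
      replace ((1 + h) * ek w y + - h / w * (ek w y * exp y)) with
        (ek w y * (1 + h * (1 - exp y / w))) by (field; lra).
      apply Rmult_le_compat_l; [left; apply ek_pos|].
      pose proof (exp_ineq1_le (h * (ln w - y))).
      assert (1 - exp y / w <= ln w - y); [|nra].
      pose proof (exp_ineq1_le (y - ln w)) as H5.
      unfold Rminus in H5; rewrite exp_plus, exp_Ropp, exp_ln in H5 by lra.
      unfold Rdiv; lra.
Qed.

(** The same comparison with [1 - w * exp (- y) <= y - ln w]; here the mean [1 / (w - 1)] of the
    reciprocal of the Gamma variable produces the error term. *)
Lemma digamma_ge_ln (w : R) : 1 < w -> ln w - / (w - 1) <= psi w.
Proof.
  intros Hw; pose proof (Gamma_pos G HG w ltac:(lra)) as HGw.
  pose proof (digamma_centered_derive w ltac:(lra)) as Hd.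
  enough (- G w / (w - 1) <= G w * (psi w - ln w)).
  { apply Rmult_le_reg_l with (G w); auto. unfold Rdiv in *; nra. }
  apply (derive_lower_bound _ _ _ 1 Rlt_0_1 Hd).
  - rewrite Rplus_0_r, Ropp_0, Rmult_0_l, exp_0; ring.
  - intros h Hh.
    enough (G w * (1 - h / (w - 1)) <= G (w + h) * exp (- h * ln w)).
    { unfold Rdiv in *; nra. }
    rewrite <- (integ_ek G HG (w + h)) by lra.
    rewrite (Rmult_comm (integ _)), <- integ_scal by (apply (ek_integrable G); auto; lra).
    assert (E : G w * (1 - h / (w - 1)) = integ (fun y => (1 + h) * ek w y + (- h * w) * ek (w - 1) y)).
    { rewrite integ_lincomb, !(integ_ek G) by (auto; try apply (ek_integrable G); auto; lra).
      replace (G w) with ((w - 1) * G (w - 1)).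
      2:{ rewrite <- (Gamma_succ G HG) by lra; f_equal; ring. }
      field; lra. }
    rewrite E. apply integ_le.
    + apply integrable_plus; apply integrable_scal, (ek_integrable G); auto; lra.
    + apply integrable_scal, (ek_integrable G); auto; lra.
    + intros y; rewrite (ek_shift w h).
      replace (ek (w - 1) y) with (ek w y * exp (- y))
        by (replace (w - 1) with (w + (-1)) by ring; rewrite ek_shift; do 2 f_equal; ring).
      replace (exp (- h * ln w) * (ek w y * exp (h * y))) with (ek w y * exp (h * (y - ln w)))
        by (replace (h * (y - ln w)) with (- h * ln w + h * y) by ring; rewrite exp_plus; ring).
      replace ((1 + h) * ek w y + - h * w * (ek w y * exp (- y))) with
        (ek w y * (1 + h * (1 - w * exp (- y)))) by ring.
      apply Rmult_le_compat_l; [left; apply ek_pos|].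
      pose proof (exp_ineq1_le (h * (y - ln w))).
      assert (1 - w * exp (- y) <= y - ln w); [|nra].
      pose proof (exp_ineq1_le (ln w - y)) as H5.
      unfold Rminus in H5; rewrite exp_plus, exp_ln in H5 by lra. lra.
Qed.

(** Raising the base point [u] by one lowers the increment by [1 / u - 1 / (u + h)], which lies
    between [0] and the telescoping difference [h / (u - 1) - h / u]. *)
Lemma digamma_diff_shift (h w : R) (K : nat) : 0 < h -> 1 < w ->
  psi (w + INR K + h) - psi (w + INR K) <= psi (w + h) - psi w <=
  h / (w - 1) + (psi (w + INR K + h) - psi (w + INR K)) - h / (w + INR K - 1).
Proof.
  intros Hh Hw; induction K as [|K IH].
  - simpl; rewrite Rplus_0_r; lra.
  - rewrite S_INR. pose proof (pos_INR K).
    set (u := w + INR K) in *.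
    replace (w + (INR K + 1) + h) with ((u + h) + 1) by (unfold u; ring).
    replace (w + (INR K + 1)) with (u + 1) by (unfold u; ring).
    assert (1 < u) by (unfold u; lra).
    rewrite !digamma_succ by lra.
    assert (0 <= / u - / (u + h) <= h / (u - 1) - h / (u + 1 - 1)).
    { replace (/ u - / (u + h)) with (h * / (u * (u + h))) by (field; lra).
      replace (h / (u - 1) - h / (u + 1 - 1)) with (h * / (u * (u - 1))) by (field; lra).
      split.
      - apply Rmult_le_pos; [lra|left; apply Rinv_0_lt_compat; nra].
      - apply Rmult_le_compat_l; [lra|apply Rinv_le_contravar; nra]. }
    lra.
Qed.

(** This bound does not shrink with [h], but it vanishes as [w] grows, which is what removes the
    shifted increment in [digamma_diff_bounds]. *)
Lemma digamma_diff_small (h w : R) : 0 < h -> 1 < w ->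
  Rabs (psi (w + h) - psi w) <= (h + 1) / (w - 1).
Proof.
  intros Hh Hw.
  pose proof (digamma_le_ln w Hw); pose proof (digamma_ge_ln w Hw).
  pose proof (digamma_le_ln (w + h) ltac:(lra)); pose proof (digamma_ge_ln (w + h) ltac:(lra)).
  assert (ln w <= ln (w + h)) by (left; apply ln_increasing; lra).
  assert (ln (w + h) <= ln w + h / (w - 1)).
  { replace (w + h) with (w * (1 + h / w)) by (field; lra).
    assert (0 < h / w) by (apply Rdiv_lt_0_compat; lra).
    rewrite ln_mult by lra. apply Rplus_le_compat_l.
    apply Rle_trans with (h / w).
    - pose proof (exp_ineq1_le (ln (1 + h / w))) as Hln; rewrite exp_ln in Hln; lra.
    - unfold Rdiv; apply Rmult_le_compat_l; [lra|apply Rinv_le_contravar; lra]. }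
  assert (/ (w + h - 1) <= / (w - 1)) by (apply Rinv_le_contravar; lra).
  assert (0 < h / (w - 1)) by (apply Rdiv_lt_0_compat; lra).
  replace ((h + 1) / (w - 1)) with (h / (w - 1) + / (w - 1)) by (field; lra).
  apply Rabs_le; lra.
Qed.

(** As the shift [K] tends to infinity the shifted increment disappears and only the head
    [h / (w - 1)] of the telescoping sum remains. *)
Lemma digamma_diff_bounds (h w : R) : 0 < h -> 1 < w ->
  0 <= psi (w + h) - psi w <= h / (w - 1).
Proof.
  intros Hh Hw.
  assert (HK : forall eps, 0 < eps -> exists K : nat,
    Rabs (psi (w + INR K + h) - psi (w + INR K)) <= eps /\ 0 <= h / (w + INR K - 1) <= eps).
  { intros eps Heps.
    destruct (INR_unbounded ((h + 1) / eps)) as [K HKK].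
    exists K. assert (0 < (h + 1) / eps) by (apply Rdiv_lt_0_compat; lra).
    assert (HKe : (h + 1) / (w + INR K - 1) <= eps).
    { apply Rmult_le_reg_r with (w + INR K - 1); [lra|].
      replace ((h + 1) / (w + INR K - 1) * (w + INR K - 1)) with (eps * ((h + 1) / eps))
        by (field; lra).
      apply Rmult_le_compat_l; lra. }
    split.
    - eapply Rle_trans; [apply digamma_diff_small; lra|auto].
    - assert (0 < / (w + INR K - 1)) by (apply Rinv_0_lt_compat; lra).
      unfold Rdiv in *; nra. }
  split; apply le_epsilon; intros eps Heps.
  - destruct (HK eps Heps) as (K & H1 & H2).
    pose proof (digamma_diff_shift h w K Hh Hw). apply Rabs_le_between in H1; lra.
  - destruct (HK eps Heps) as (K & H1 & H2).
    pose proof (digamma_diff_shift h w K Hh Hw). apply Rabs_le_between in H1; lra.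
Qed.

(** The derivative inherits the bounds on increments, which are linear in [h]. The upper one gives
    the decay that makes the partial sums of the series converge to [psi1]. *)
Lemma trigamma_bounds (w : R) : 1 < w -> 0 <= psi1 w <= / (w - 1).
Proof.
  intros Hw.
  assert (Hd : is_derive (fun h => psi (w + h) - psi w) 0 (psi1 w)).
  { pose proof (Hpsi1 w ltac:(lra)) as H; apply is_derive_Reals in H.
    rewrite <- (Rplus_0_r w) in H at 1.
    auto_derive; [eexists; apply H|]. rewrite (is_derive_unique (fun x : R => psi x) _ _ H); ring. }
  split.
  - apply (derive_lower_bound _ _ _ 1 Rlt_0_1 Hd).
    + rewrite Rplus_0_r; ring.
    + intros h Hh; pose proof (digamma_diff_bounds h w (proj1 Hh) Hw); lra.
  - enough (- / (w - 1) <= - psi1 w) by lra.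
    apply (derive_lower_bound (fun h => - (psi (w + h) - psi w)) _ _ 1 Rlt_0_1).
    + apply (is_derive_opp (K := R_AbsRing) (V := R_NormedModule)); auto.
    + rewrite Rplus_0_r; ring.
    + intros h Hh; pose proof (digamma_diff_bounds h w (proj1 Hh) Hw); unfold Rdiv in *; lra.
Qed.

(** The recursion peels off the first term and shifts [z], in step with [hprod] and with the
    recurrences of [psi1] and [Yk]. *)
Fixpoint inv_sq_sum (z : R) (K : nat) : R :=
  match K with O => 0 | S k => / z ^ 2 + inv_sq_sum (z + 1) k end.

Lemma trigamma_sum (z : R) (K : nat) : 0 < z -> psi1 z = inv_sq_sum z K + psi1 (z + INR K).
Proof.
  revert z; induction K as [|K IH]; intros z Hz.
  - simpl; rewrite Rplus_0_r; ring.
  - rewrite trigamma_succ, (IH (z + 1)) by lra. cbn [inv_sq_sum]; rewrite S_INR.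
    replace (z + 1 + INR K) with (z + (INR K + 1)) by ring; ring.
Qed.

Lemma trigamma_ge (z : R) : 0 < z -> / z ^ 2 <= psi1 z.
Proof.
  intros Hz; rewrite trigamma_succ by auto.
  pose proof (trigamma_bounds (z + 1) ltac:(lra)); lra.
Qed.

Lemma trigamma_le (z : R) : 0 < z -> psi1 z <= / z ^ 2 + / z.
Proof.
  intros Hz; rewrite trigamma_succ by auto.
  pose proof (trigamma_bounds (z + 1) ltac:(lra)) as H.
  replace (z + 1 - 1) with z in H by ring; lra.
Qed.

Lemma trigamma_pos (z : R) : 0 < z -> 0 < psi1 z.
Proof.
  intros Hz; eapply Rlt_le_trans; [|apply trigamma_ge; auto].
  apply Rinv_0_lt_compat, pow_lt; auto.
Qed.

End Digamma.

(** * The product formula for the Fourier transform of the tilted density *)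

Definition cis (a : R) : C := (cos a, sin a).

Lemma cis_plus (a b : R) : cis (a + b) = (cis a * cis b)%C.
Proof. unfold cis, Cmult; simpl; rewrite cos_plus, sin_plus; f_equal; ring. Qed.

Lemma cis_0 : cis 0 = 1%C.
Proof. unfold cis; rewrite cos_0, sin_0; reflexivity. Qed.

Lemma Cmod_cis (a : R) : Cmod (cis a) = 1.
Proof.
  unfold Cmod, cis; simpl fst; simpl snd. transitivity (sqrt 1); [f_equal|apply sqrt_1].
  pose proof (sin2_cos2 a) as H; unfold Rsqr in H; nra.
Qed.

Lemma Cmod_le_sum (a b : R) : Cmod (a, b) <= Rabs a + Rabs b.
Proof.
  unfold Cmod; simpl fst; simpl snd.
  rewrite <- (sqrt_pow2 (Rabs a + Rabs b)) by (pose proof (Rabs_pos a); pose proof (Rabs_pos b); lra).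
  apply sqrt_le_1_alt. rewrite <- (pow2_abs a), <- (pow2_abs b).
  pose proof (Rabs_pos a); pose proof (Rabs_pos b); nra.
Qed.

Lemma sin_le_id (u : R) : 0 <= u -> sin u <= u.
Proof. intros [H| <-]; [left; apply sin_lt_x; auto|rewrite sin_0; lra]. Qed.

Lemma Rabs_sin_le_abs (u : R) : Rabs (sin u) <= Rabs u.
Proof.
  destruct (Rle_lt_dec 0 u) as [H|H].
  - rewrite (Rabs_pos_eq u) by auto. apply Rabs_le; split; [|apply sin_le_id; auto].
    destruct (Rle_lt_dec u 1) as [H1|H1].
    + pose proof (sin_ge_0 u H); pose proof PI_RGT_0; pose proof PI2_1; lra.
    + pose proof (SIN_bound u); lra.
  - rewrite (Rabs_left u), <- Rabs_Ropp, <- sin_neg by auto.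
    apply Rabs_le; split; [|apply sin_le_id; lra].
    destruct (Rle_lt_dec (- u) 1) as [H1|H1].
    + pose proof (sin_ge_0 (- u)); pose proof PI_RGT_0; pose proof PI2_1; lra.
    + pose proof (SIN_bound (- u)); lra.
Qed.

Lemma cos_half (u : R) : cos u = 1 - 2 * (sin (u / 2)) ^ 2.
Proof. replace u with (2 * (u / 2)) at 1 by field; rewrite cos_2a_sin; ring. Qed.

Lemma cos_ge_quadratic (u : R) : 1 - u ^ 2 / 2 <= cos u.
Proof.
  rewrite cos_half. pose proof (Rabs_sin_le_abs (u / 2)) as H.
  apply pow_maj_Rabs with (n := 2%nat) in H. rewrite pow2_abs in H; lra.
Qed.

Lemma Rabs_cos_minus_1 (u : R) : Rabs (cos u - 1) <= Rabs u.
Proof.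
  pose proof (COS_bound u); pose proof (cos_ge_quadratic u).
  rewrite Rabs_left1 by lra.
  pose proof (Rabs_pos u) as H1. pose proof (pow2_abs u) as H2.
  destruct (Rle_lt_dec (Rabs u) 2); nra.
Qed.

Lemma Cmod_cis_minus_1 (a : R) : Cmod (cis a - 1) <= 2 * Rabs a.
Proof.
  eapply Rle_trans; [apply Cmod_le_sum|]. simpl. rewrite Ropp_0, Rplus_0_r.
  pose proof (Rabs_cos_minus_1 a) as H1; pose proof (Rabs_sin_le_abs a).
  unfold Rminus in H1; lra.
Qed.

Lemma sin_ge_cubic (u : R) : 0 <= u -> u - u ^ 3 / 6 <= sin u.
Proof.
  intros [Hu| <-]; [|rewrite sin_0; lra].
  destruct (MVT_gen (fun x => sin x - x + x ^ 3 / 6) 0 u (fun x => cos x - 1 + x ^ 2 / 2)) as (c & _ & H).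
  - intros x _; auto_derive; auto; field.
  - intros x _; apply (cts_continuity (fun x => sin x - x + x ^ 3 / 6)), cts_derive.
    intros; auto_derive; auto.
  - rewrite sin_0 in H. pose proof (cos_ge_quadratic c). nra.
Qed.

Lemma exp_neg_bounds (v : R) : 0 <= v -> 1 - v <= exp (- v) <= 1 - v + v ^ 2.
Proof.
  intros Hv; split; [pose proof (exp_ineq1_le (- v)); lra|].
  rewrite exp_Ropp. apply Rle_trans with (/ (1 + v)).
  - apply Rinv_le_contravar; [lra|apply exp_ineq1_le].
  - apply Rmult_le_reg_r with (1 + v); [lra|]. rewrite Rinv_l by lra.
    assert (0 <= v ^ 3) by (apply pow_le; auto). nra.
Qed.

(** These are the two components of [cis u - e * (1 + i u)] with [e] the Gaussian factor, the
    numerator of [hfac u - e]; the expansions agree through order two. *)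
Lemma cis_gauss_aux (u : R) : 0 <= u <= 1 ->
  Rabs (cos u - exp (- (u ^ 2 / 2))) <= u ^ 3 /\
  Rabs (sin u - u * exp (- (u ^ 2 / 2))) <= u ^ 3.
Proof.
  intros [H0 H1].
  pose proof (exp_neg_bounds (u ^ 2 / 2) ltac:(nra)) as He.
  pose proof (cos_ge_quadratic u) as Hc1.
  pose proof (sin_ge_cubic u H0) as Hs; pose proof (sin_le_id u H0) as Hs'.
  assert (Hu3 : 0 <= u ^ 3) by (apply pow_le; auto).
  assert (Hu4 : u ^ 4 <= u ^ 3) by (simpl; nra).
  assert (Hu4' : 0 <= u ^ 4) by (apply pow_le; auto).
  assert (Hc2 : cos u <= 1 - u ^ 2 / 2 + u ^ 4 / 24).
  { rewrite cos_half.
    pose proof (sin_ge_cubic (u / 2) ltac:(lra)) as H2.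
    assert (0 <= u / 2 - (u / 2) ^ 3 / 6) by (simpl; nra).
    assert ((u / 2 - (u / 2) ^ 3 / 6) ^ 2 <= sin (u / 2) ^ 2) by (apply pow_incr; auto).
    replace ((u / 2 - (u / 2) ^ 3 / 6) ^ 2) with (u ^ 2 / 4 - u ^ 4 / 48 + u ^ 6 / 2304) in H2
      by field.
    assert (0 <= u ^ 6) by (apply pow_le; auto).
    nra. }
  split; apply Rabs_le.
  - replace ((u ^ 2 / 2) ^ 2) with (u ^ 4 / 4) in He by field. lra.
  - assert (u * (1 - u ^ 2 / 2) <= u * exp (- (u ^ 2 / 2))) by (apply Rmult_le_compat_l; lra).
    assert (u * exp (- (u ^ 2 / 2)) <= u * 1).
    { apply Rmult_le_compat_l; auto. rewrite <- exp_0.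
      destruct H0 as [H0| <-]; [left; apply exp_increasing; nra|].
      right; f_equal; field. }
    replace (u * (1 - u ^ 2 / 2)) with (u - u ^ 3 / 2) in * by field. lra.
Qed.

(* The Fourier transform of [1 - X], with [X] a standard exponential variable. *)
Definition hfac (u : R) : C := (cis u / (1, u))%C.

Lemma Cmod_hfac_sq (u : R) : Cmod (hfac u) ^ 2 = / (1 + u ^ 2).
Proof.
  assert (H : (1, u) <> RtoC 0) by (intros E; injection E; lra).
  unfold hfac; rewrite Cmod_div, Cmod_cis by auto.
  unfold Rdiv; rewrite Rmult_1_l, pow_inv. f_equal.
  unfold Cmod; simpl fst; simpl snd. rewrite pow2_sqrt; nra.
Qed.

Lemma Cmod_hfac_le (u : R) : Cmod (hfac u) <= 1.
Proof.
  pose proof (Cmod_ge_0 (hfac u)); pose proof (Cmod_hfac_sq u) as H1.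
  assert (/ (1 + u ^ 2) <= 1) by (apply Rinv_le_1; nra).
  nra.
Qed.

Lemma exp_neg_le_1 (v : R) : 0 <= v -> exp (- v) <= 1.
Proof. intros Hv; pose proof (exp_ineq1_le v). rewrite exp_Ropp; apply Rinv_le_1; lra. Qed.

(** For [|u| <= 1] the denominator [1 + i u] has modulus at least [1], and parity reduces to
    [u >= 0]. For [|u| > 1] both terms have modulus at most [1], and [2 <= 2 |u|^3]. *)
Lemma hfac_gauss (u : R) : Cmod (hfac u - exp (- (u ^ 2 / 2))) <= 2 * Rabs u ^ 3.
Proof.
  destruct (Rle_lt_dec (Rabs u) 1) as [Hu|Hu].
  - assert (Hn : (1, u) <> RtoC 0) by (intros E; injection E; lra).
    replace (hfac u - exp (- (u ^ 2 / 2)))%C with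
      ((cos u - exp (- (u ^ 2 / 2)), sin u - u * exp (- (u ^ 2 / 2)))%R / (1, u))%C.
    2:{ unfold hfac. replace (cos u - exp (- (u ^ 2 / 2)), sin u - u * exp (- (u ^ 2 / 2))) with
          (cis u - exp (- (u ^ 2 / 2)) * (1, u))%C.
        - field; auto.
        - unfold cis, Cmult, Cminus, Cplus, Copp, RtoC; simpl; f_equal; ring. }
    rewrite Cmod_div by auto.
    assert (H1 : 1 <= Cmod (1, u)).
    { unfold Cmod; simpl fst; simpl snd.
      apply Rle_trans with (sqrt 1); [rewrite sqrt_1; lra|apply sqrt_le_1_alt; nra]. }
    apply Rle_trans with (Cmod (cos u - exp (- (u ^ 2 / 2)), sin u - u * exp (- (u ^ 2 / 2)))).
    { unfold Rdiv; rewrite <- (Rmult_1_r (Cmod (cos u - _, _))) at 2.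
      apply Rmult_le_compat_l; [apply Cmod_ge_0|].
      apply Rinv_le_1; lra. }
    eapply Rle_trans; [apply Cmod_le_sum|].
    destruct (cis_gauss_aux (Rabs u) ltac:(split; auto using Rabs_pos)) as [Hc Hs].
    rewrite pow2_abs in Hc, Hs.
    assert (Rabs (cos u - exp (- (u ^ 2 / 2))) <= Rabs u ^ 3).
    { replace (cos u) with (cos (Rabs u)); auto.
      unfold Rabs; destruct (Rcase_abs u); auto using cos_neg. }
    assert (Rabs (sin u - u * exp (- (u ^ 2 / 2))) <= Rabs u ^ 3); [|lra].
    revert Hs; unfold Rabs at 2 3; destruct (Rcase_abs u); auto.
    rewrite sin_neg. intros Hs; rewrite <- Rabs_Ropp.
    replace (- (sin u - u * exp (- (u ^ 2 / 2)))) with (- sin u - - u * exp (- (u ^ 2 / 2))) by ring; auto.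
  - unfold Cminus; eapply Rle_trans; [apply Cmod_triangle|].
    rewrite Cmod_opp, Cmod_R, Rabs_pos_eq by (left; apply exp_pos).
    pose proof (Cmod_hfac_le u); pose proof (exp_neg_le_1 (u ^ 2 / 2) ltac:(nra)).
    assert (1 <= Rabs u ^ 3) by (apply pow_R1_Rle; lra). lra.
Qed.

Fixpoint hprod (z t : R) (K : nat) : C :=
  match K with O => 1%C | S k => (hfac (t / z) * hprod (z + 1) t k)%C end.

Lemma inv_sq_sum_nonneg (z : R) (K : nat) : 0 < z -> 0 <= inv_sq_sum z K.
Proof.
  revert z; induction K as [|K IH]; intros z Hz; simpl; [lra|].
  pose proof (IH (z + 1) ltac:(lra)).
  assert (0 < / (z * (z * 1))) by (apply Rinv_0_lt_compat; nra). lra.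
Qed.

(** Expanding the product of the [1 + t^2 / (z + k)^2] gives [1 + t^2 * inv_sq_sum z K] plus
    nonnegative terms. *)
Lemma Cmod_hprod_sq (z t : R) (K : nat) : 0 < z ->
  (1 + t ^ 2 * inv_sq_sum z K) * Cmod (hprod z t K) ^ 2 <= 1.
Proof.
  revert z; induction K as [|K IH]; intros z Hz.
  - simpl; rewrite Cmod_1; lra.
  - cbn [hprod inv_sq_sum]. rewrite Cmod_mult, Rpow_mult_distr, Cmod_hfac_sq.
    specialize (IH (z + 1) ltac:(lra)).
    pose proof (inv_sq_sum_nonneg (z + 1) K ltac:(lra)).
    set (S := inv_sq_sum (z + 1) K) in *. set (m := Cmod (hprod (z + 1) t K) ^ 2) in *.
    assert (0 <= m) by apply pow2_ge_0.
    replace ((t / z) ^ 2) with (t ^ 2 * / z ^ 2) by (field; lra).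
    set (a := t ^ 2 * / z ^ 2).
    assert (Ha : 0 <= a).
    { apply Rmult_le_pos; [apply pow2_ge_0|left; apply Rinv_0_lt_compat, pow_lt; auto]. }
    apply Rle_trans with ((1 + a) * (1 + t ^ 2 * S) * (/ (1 + a) * m)).
    + apply Rmult_le_compat_r.
      * apply Rmult_le_pos; auto; left; apply Rinv_0_lt_compat; lra.
      * assert (0 <= t ^ 2 * S) by (apply Rmult_le_pos; auto; apply pow2_ge_0).
        replace (t ^ 2 * (/ z ^ 2 + S)) with (a + t ^ 2 * S) by (unfold a; ring). nra.
    + replace ((1 + a) * (1 + t ^ 2 * S) * (/ (1 + a) * m)) with ((1 + t ^ 2 * S) * m) by (field; lra).
      auto.
Qed.

Lemma Cmod_hprod_le (z t : R) (K : nat) : 0 < z -> Cmod (hprod z t K) <= 1.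
Proof.
  intros Hz; pose proof (Cmod_hprod_sq z t K Hz); pose proof (Cmod_ge_0 (hprod z t K)).
  pose proof (inv_sq_sum_nonneg z K Hz).
  assert (0 <= t ^ 2 * inv_sq_sum z K) by (apply Rmult_le_pos; auto; apply pow2_ge_0).
  destruct (Rle_lt_dec (Cmod (hprod z t K)) 1); auto. nra.
Qed.

(** Lindeberg's replacement of one factor at a time, all other factors having modulus at most [1].
    The cost [2 |t|^3 / (z + k)^3] is weakened to [2 |t|^3 s / (z + k)^2], so that the costs add up
    to a multiple of the variance. *)
Lemma hprod_gauss (z t s : R) (K : nat) : 0 < z -> / z <= s ->
  Cmod (hprod z t K - exp (- (t ^ 2 * inv_sq_sum z K / 2))) <= 2 * Rabs t ^ 3 * s * inv_sq_sum z K.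
Proof.
  revert z; induction K as [|K IH]; intros z Hz Hs.
  - simpl hprod; simpl inv_sq_sum.
    replace (- (t ^ 2 * 0 / 2)) with 0 by field. rewrite exp_0.
    replace (1 - 1)%C with (RtoC 0) by ring. rewrite Cmod_0; lra.
  - cbn [hprod inv_sq_sum].
    assert (Hz1 : / (z + 1) <= s).
    { eapply Rle_trans; [|apply Hs]. apply Rinv_le_contravar; lra. }
    specialize (IH (z + 1) ltac:(lra) Hz1).
    pose proof (inv_sq_sum_nonneg (z + 1) K ltac:(lra)) as HS.
    set (S := inv_sq_sum (z + 1) K) in *. set (H := hprod (z + 1) t K) in *.
    pose proof (hfac_gauss (t / z)) as Hg.
    replace ((t / z) ^ 2 / 2) with (t ^ 2 * / z ^ 2 / 2) in Hg by (field; lra).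
    replace (- (t ^ 2 * (/ z ^ 2 + S) / 2)) with (- (t ^ 2 * / z ^ 2 / 2) + - (t ^ 2 * S / 2)) by (field; lra).
    rewrite exp_plus, RtoC_mult.
    set (e1 := exp (- (t ^ 2 * / z ^ 2 / 2))) in *.
    replace (hfac (t / z) * H - e1 * exp (- (t ^ 2 * S / 2)))%C with
      (hfac (t / z) * (H - exp (- (t ^ 2 * S / 2))) + (hfac (t / z) - e1) * exp (- (t ^ 2 * S / 2)))%C by ring.
    eapply Rle_trans; [apply Cmod_triangle|]. rewrite !Cmod_mult, (Cmod_R (exp _)).
    rewrite (Rabs_pos_eq (exp _)) by (left; apply exp_pos).
    assert (HtS : 0 <= t ^ 2 * S / 2) by (pose proof (pow2_ge_0 t); nra).
    pose proof (exp_neg_le_1 _ HtS) as He. pose proof (exp_pos (- (t ^ 2 * S / 2))).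
    pose proof (Cmod_hfac_le (t / z)).
    pose proof (Cmod_ge_0 (H - exp (- (t ^ 2 * S / 2)))).
    pose proof (Cmod_ge_0 (hfac (t / z) - e1)). pose proof (Cmod_ge_0 (hfac (t / z))).
    assert (Hg' : 2 * Rabs (t / z) ^ 3 <= 2 * Rabs t ^ 3 * s * / z ^ 2).
    { unfold Rdiv; rewrite Rabs_mult, (Rabs_pos_eq (/ z)) by (left; apply Rinv_0_lt_compat; auto).
      rewrite Rpow_mult_distr.
      replace ((/ z) ^ 3) with (/ z * / z ^ 2) by (field; lra).
      assert (0 <= Rabs t ^ 3) by (apply pow_le, Rabs_pos).
      assert (0 <= / z ^ 2) by (left; apply Rinv_0_lt_compat, pow_lt; auto).
      assert (0 <= Rabs t ^ 3 * / z ^ 2) by (apply Rmult_le_pos; auto).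
      nra. }
    nra.
Qed.

(** * The centered transform and its limit for large parameters *)

Section Normalized.

Variables G psi psi1 : R -> R.
Hypotheses (HG : is_Gamma G) (Hpsi : is_digamma G psi) (Hpsi1 : is_trigamma psi psi1).

Definition Fk (z t : R) : C := (Ck z t, Sk z t).

(* The Fourier transform of the density [ek z / G z], centered at its mean [psi z]. *)
Definition Yk (z t : R) : C := (Fk z t * cis (- (t * psi z)) * / G z)%C.

Lemma Fk_succ (z t : R) : 0 < z -> Fk (z + 1) t = ((z, t) * Fk z t)%C.
Proof.
  intros Hz; unfold Fk, Cmult; simpl.
  rewrite (Ck_succ G), (Sk_succ G); auto.
Qed.

(** The functional equation contributes [1 / (1 + i t / z)], and the recurrence of [psi] moves
    exactly the phase [t / z] from the centering into the same factor. *)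
Lemma Yk_succ (z t : R) : 0 < z -> Yk z t = (hfac (t / z) * Yk (z + 1) t)%C.
Proof.
  intros Hz; unfold Yk, hfac.
  pose proof (Gamma_pos G HG z Hz).
  rewrite Fk_succ, (Gamma_succ G), (digamma_succ G) by auto.
  replace (- (t * (psi z + / z))) with (- (t * psi z) + - (t / z)) by (field; lra).
  rewrite cis_plus.
  assert (E : (cis (t / z) * cis (- (t / z)))%C = 1%C).
  { rewrite <- cis_plus, <- cis_0; f_equal; ring. }
  assert (E2 : (z, t) = (RtoC z * (1, t / z)%R)%C).
  { unfold Cmult, RtoC; simpl; f_equal; field; lra. }
  assert (Hn : (1, t / z) <> RtoC 0) by (intros E1; injection E1; lra).
  assert (HzC : RtoC z <> 0%C) by (intros E1; apply RtoC_inj in E1; lra).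
  assert (HGC : RtoC (G z) <> 0%C) by (intros E1; apply RtoC_inj in E1; lra).
  rewrite E2, RtoC_mult.
  transitivity (Fk z t * cis (- (t * psi z)) * (cis (t / z) * cis (- (t / z))) / G z)%C.
  - rewrite E; field; auto.
  - field; auto.
Qed.

Lemma Yk_prod (z t : R) (K : nat) : 0 < z -> Yk z t = (hprod z t K * Yk (z + INR K) t)%C.
Proof.
  revert z; induction K as [|K IH]; intros z Hz.
  - simpl; rewrite Rplus_0_r; ring.
  - rewrite Yk_succ, (IH (z + 1)), S_INR by lra. cbn [hprod].
    replace (z + 1 + INR K) with (z + (INR K + 1)) by ring; ring.
Qed.

(** The parenthesis is the square of [exp (b / 2) - exp (- (b / 2))]. Exponential moments of
    [y - ln w] are exact Gamma quotients, hence this choice of majorant. *)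
Lemma sq_le_exp_sum (b : R) : b ^ 2 <= 4 * (exp b + exp (- b) - 2).
Proof.
  assert (H : forall s, 0 <= s -> s <= exp s - exp (- s)).
  { intros s Hs; pose proof (exp_ineq1_le s); pose proof (exp_neg_le_1 s Hs); lra. }
  assert (Hb : b ^ 2 / 4 <= (exp (b / 2) - exp (- (b / 2))) ^ 2).
  { destruct (Rle_lt_dec 0 b).
    - pose proof (H (b / 2) ltac:(lra)); nra.
    - pose proof (H (- (b / 2)) ltac:(lra)) as H1; rewrite Ropp_involutive in H1; nra. }
  replace ((exp (b / 2) - exp (- (b / 2))) ^ 2) with (exp b + exp (- b) - 2) in Hb; [lra|].
  replace b with (b / 2 + b / 2) at 1 by field.
  replace (- b) with (- (b / 2) + - (b / 2)) by field.
  rewrite !exp_plus.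
  assert (E : exp (b / 2) * exp (- (b / 2)) = 1) by (rewrite <- exp_plus, <- exp_0; f_equal; ring).
  nra.
Qed.

(** With [b = y - ln w], the bounds [|b| <= 1 / r + r * b^2 / 4] and [sq_le_exp_sum] reduce the
    claim to the mean of [exp b + exp (- b) - 2], which is [1 / (w - 1)]; the choice [r^2 = w - 1]
    balances the two terms. *)
Lemma ek_concentration (w T : R) (g : R -> R) : 1 < w -> 0 <= T -> cts g ->
  (forall y, Rabs (g y) <= T * Rabs (y - ln w)) ->
  Rabs (integ (fun y => ek w y * g y)) <= 2 * T / sqrt (w - 1) * G w.
Proof.
  intros Hw HT Cg Hg.
  set (r := sqrt (w - 1)). assert (Hr : 0 < r) by (apply sqrt_lt_R0; lra).
  assert (Hr2 : r * r = w - 1) by (apply sqrt_sqrt; lra).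
  (* This is [T * (1 / r + r * (exp b + exp (- b) - 2)) * ek w y], with the exponentials absorbed
     into shifts of [w]. *)
  set (h := fun y => (T / r - 2 * (T * r)) * ek w y + (T * r / w) * ek (w + 1) y + (T * r * w) * ek (w - 1) y).
  assert (Hh : has_int h (2 * T / r * G w)).
  { replace (2 * T / r * G w) with ((T / r - 2 * (T * r)) * integ (ek w) + (T * r / w) * integ (ek (w + 1)) +
      (T * r * w) * integ (ek (w - 1))).
    - apply integ_comb3; apply (ek_integrable G); auto; lra.
    - rewrite !(integ_ek G), (Gamma_succ G) by (auto; lra).
      assert (EG : G w = r * r * G (w - 1)).
      { rewrite Hr2, <- (Gamma_succ G) by (auto; lra); f_equal; ring. }
      rewrite EG. set (g1 := G (w - 1)). assert (Ew : w = r * r + 1) by lra.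
      rewrite Ew; field; split; nra. }
  rewrite <- (has_int_integ _ _ Hh).
  assert (Hb : forall y, Rabs (ek w y * g y) <= h y).
  { intros y; pose proof (ek_pos w y) as He.
    rewrite Rabs_mult, Rabs_pos_eq by lra.
    replace (h y) with (ek w y * (T * (/ r + r * (exp (y - ln w) + exp (- (y - ln w)) - 2)))).
    - apply Rmult_le_compat_l; [lra|].
      eapply Rle_trans; [apply Hg|]. apply Rmult_le_compat_l; auto.
      pose proof (sq_le_exp_sum (y - ln w)) as H1. set (b := y - ln w) in *.
      rewrite <- (pow2_abs b) in H1. pose proof (Rabs_pos b).
      (* AM-GM *)
      assert (Rabs b <= / r + r * (Rabs b ^ 2 / 4)).
      { apply Rmult_le_reg_r with r; auto. rewrite Rmult_plus_distr_r, Rinv_l by lra.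
        pose proof (pow2_ge_0 (r * Rabs b / 2 - 1)); nra. }
      nra.
    - unfold h. rewrite ek_succ.
      replace (ek (w - 1) y) with (ek w y * exp (- y))
        by (replace (w - 1) with (w + (-1)) by ring; rewrite ek_shift; do 2 f_equal; ring).
      replace (- (y - ln w)) with (ln w + - y) by ring.
      unfold Rminus; rewrite !exp_plus, exp_Ropp, exp_ln by lra. field; lra. }
  assert (Ih : integrable h).
  { apply (integrable_nonneg _ (2 * T / r * G w)); auto.
    - unfold h; repeat apply cts_plus; (apply cts_mult; [apply cts_const|apply ek_cts]).
    - intros y; eapply Rle_trans; [apply Rabs_pos|apply Hb]. }
  apply integ_abs_le; auto.
  apply (integrable_dominated _ h); auto. apply cts_mult; auto using ek_cts.
Qed.

(** The transform is first centered at [ln w], where [ek_concentration] applies. The real and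
    imaginary parts cost [2] each, and moving the center to [psi w] costs another [2]. *)
Lemma Yk_near_1 (w t : R) : 2 <= w -> Cmod (Yk w t - 1) <= 6 * Rabs t / sqrt (w - 1).
Proof.
  intros Hw. set (L := ln w).
  pose proof (Gamma_pos G HG w ltac:(lra)) as HGw.
  set (X := (Fk w t * cis (- (t * L)) * / G w)%C).
  assert (Hs1 : 1 <= sqrt (w - 1)) by (rewrite <- sqrt_1 at 1; apply sqrt_le_1_alt; lra).
  assert (EY : Yk w t = (X * cis (- (t * (psi w - L))))%C).
  { unfold Yk, X. replace (- (t * psi w)) with (- (t * L) + - (t * (psi w - L))) by ring.
    rewrite cis_plus; ring. }
  assert (Ca : cts (fun y => t * (y - L))).
  { apply cts_mult; [apply cts_const|apply cts_minus; auto using cts_id, cts_const]. }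
  assert (Ic : integrable (fun y => ek w y * cos (t * (y - L)))).
  { apply (ek_mult_integrable G); auto using Rabs_cos_le; [lra|].
    apply (cts_comp (fun y => t * (y - L))); auto using cts_cos. }
  assert (Ec : Ck w t * cos (t * L) + Sk w t * sin (t * L) = integ (fun y => ek w y * cos (t * (y - L)))).
  { unfold Ck, Sk.
    rewrite (integ_ext (fun y => ek w y * cos (t * (y - L)))
      (fun y => cos (t * L) * (ek w y * cos (t * y)) + sin (t * L) * (ek w y * sin (t * y)))).
    - rewrite (integ_lincomb _ _ (cos (t * L)) (sin (t * L))
        (ek_cos_integrable G HG w t ltac:(lra)) (ek_sin_integrable G HG w t ltac:(lra))); ring.
    - intros y; replace (t * (y - L)) with (t * y - t * L) by ring. rewrite cos_minus; ring. }
  assert (Es : Sk w t * cos (t * L) - Ck w t * sin (t * L) = integ (fun y => ek w y * sin (t * (y - L)))).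
  { unfold Ck, Sk.
    rewrite (integ_ext (fun y => ek w y * sin (t * (y - L)))
      (fun y => cos (t * L) * (ek w y * sin (t * y)) + - sin (t * L) * (ek w y * cos (t * y)))).
    - rewrite (integ_lincomb _ _ (cos (t * L)) (- sin (t * L))
        (ek_sin_integrable G HG w t ltac:(lra)) (ek_cos_integrable G HG w t ltac:(lra))); ring.
    - intros y; replace (t * (y - L)) with (t * y - t * L) by ring. rewrite sin_minus; ring. }
  assert (EX : (X - 1)%C = (integ (fun y => ek w y * (cos (t * (y - L)) - 1)) / G w,
                        integ (fun y => ek w y * sin (t * (y - L))) / G w)).
  { rewrite <- Es.
    replace (integ (fun y => ek w y * (cos (t * (y - L)) - 1))) with
      (Ck w t * cos (t * L) + Sk w t * sin (t * L) - G w).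
    - unfold X, Fk, cis. rewrite cos_neg, sin_neg, <- RtoC_inv by lra.
      unfold Cminus, Cplus, Copp, Cmult, RtoC; simpl; f_equal; field; lra.
    - rewrite Ec, <- (integ_ek G HG w), <- integ_minus by (auto; try lra; apply (ek_integrable G); auto; lra).
      apply integ_ext; intros; ring. }
  assert (HX : Cmod (X - 1) <= 4 * Rabs t / sqrt (w - 1)).
  { rewrite EX; eapply Rle_trans; [apply Cmod_le_sum|].
    unfold Rdiv at 1 2; rewrite !Rabs_mult, !(Rabs_pos_eq (/ G w)) by (left; apply Rinv_0_lt_compat; auto).
    assert (H1 : Rabs (integ (fun y => ek w y * (cos (t * (y - L)) - 1))) <= 2 * Rabs t / sqrt (w - 1) * G w).
    { apply ek_concentration; auto using Rabs_pos; [lra| |].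
      - apply cts_minus; [|apply cts_const]. apply (cts_comp (fun y => t * (y - L))); auto using cts_cos.
      - intros y; rewrite <- Rabs_mult; apply Rabs_cos_minus_1. }
    assert (H2 : Rabs (integ (fun y => ek w y * sin (t * (y - L)))) <= 2 * Rabs t / sqrt (w - 1) * G w).
    { apply ek_concentration; auto using Rabs_pos; [lra| |].
      - apply (cts_comp (fun y => t * (y - L))); auto using cts_sin.
      - intros y; rewrite <- Rabs_mult; apply Rabs_sin_le_abs. }
    rewrite <- Rmult_plus_distr_r. apply Rmult_le_reg_r with (G w); auto.
    rewrite Rmult_assoc, Rinv_l by lra. unfold Rdiv in *; lra. }
  rewrite EY.
  replace (X * cis (- (t * (psi w - L))) - 1)%C with
    ((X - 1) * cis (- (t * (psi w - L))) + (cis (- (t * (psi w - L))) - 1))%C by ring.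
  eapply Rle_trans; [apply Cmod_triangle|]. rewrite Cmod_mult, Cmod_cis, Rmult_1_r.
  pose proof (Cmod_cis_minus_1 (- (t * (psi w - L)))) as H3.
  rewrite Rabs_Ropp, Rabs_mult in H3.
  pose proof (digamma_le_ln G psi HG Hpsi w ltac:(lra)). pose proof (digamma_ge_ln G psi HG Hpsi w ltac:(lra)).
  fold L in H, H0.
  assert (H4 : Rabs (psi w - L) <= / sqrt (w - 1)).
  { apply Rle_trans with (/ (w - 1)).
    - apply Rabs_le; assert (0 < / (w - 1)) by (apply Rinv_0_lt_compat; lra); lra.
    - apply Rinv_le_contravar; [lra|].
      rewrite <- (sqrt_sqrt (w - 1)) at 2 by lra. nra. }
  pose proof (Rabs_pos t). unfold Rdiv in *. nra.
Qed.

End Normalized.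

(** * Explicit integrals *)

(** Made for integrands in [|t|]: [g] is the smooth expression that agrees with [f] on the
    half-line, and [F] is an antiderivative of [g] on the whole line. *)
Lemma has_int_even (f g F : R -> R) (L : R) :
  cts f -> (forall t, f (- t) = f t) -> (forall t, 0 <= t -> f t = g t) ->
  cts g -> (forall t, is_derive F t (g t)) -> is_lim F p_infty L ->
  has_int f (2 * (L - F 0)).
Proof.
  intros Cf Hev Hfg Cg HF HL eps Heps.
  assert (Hpos : forall b, 0 <= b -> RInt f 0 b = F b - F 0).
  { intros b Hb. rewrite (RInt_ext f g).
    - apply is_RInt_unique, (is_RInt_derive (V := R_CompleteNormedModule)); auto.
    - intros x Hx; apply Hfg. rewrite Rmin_left in Hx by auto; lra. }
  apply is_lim_spec in HL. assert (He : 0 < eps / 2) by lra.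
  destruct (HL (mkposreal _ He)) as [M HM]; simpl in HM.
  exists (Rmax 0 (M + 1)); intros a b Ha Hb.
  pose proof (Rmax_l 0 (M + 1)); pose proof (Rmax_r 0 (M + 1)).
  rewrite (RInt_split f a 0 b) by auto.
  assert (E : RInt f a 0 = RInt f 0 (- a)).
  { pose proof (RInt_affine f (-1) 0 a 0 Cf) as H1.
    rewrite (RInt_ext _ f) in H1.
    2:{ intros x _. rewrite <- Hev; f_equal; ring. }
    replace (-1 * a + 0) with (- a) in H1 by ring. replace (-1 * 0 + 0) with 0 in H1 by ring.
    rewrite (RInt_flip f (- a) 0) in H1 by auto. lra. }
  rewrite E, !Hpos by lra.
  pose proof (HM b ltac:(lra)) as H1; pose proof (HM (- a) ltac:(lra)) as H2.
  apply Rabs_def2 in H1; apply Rabs_def2 in H2; apply Rabs_def1; lra.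
Qed.

Lemma is_lim_atan_p : is_lim atan p_infty (PI / 2).
Proof.
  apply is_lim_spec; intros eps. pose proof (cond_pos eps). pose proof PI_RGT_0.
  set (a := PI / 2 - Rmin eps (PI / 4)).
  pose proof (Rmin_l eps (PI / 4)); pose proof (Rmin_r eps (PI / 4)).
  assert (0 < Rmin eps (PI / 4)) by (apply Rmin_pos; lra).
  exists (tan a); intros x Hx. apply atan_increasing in Hx.
  rewrite atan_tan in Hx by (unfold a; lra).
  pose proof (atan_bound x). apply Rabs_def1; unfold a in *; lra.
Qed.

Lemma is_derive_atan_lorentz (t : R) : is_derive atan t (/ (1 + t ^ 2)).
Proof.
  apply is_derive_Reals, derivable_pt_lim_atan.
Qed.

Lemma cts_lorentz : cts (fun u => / (1 + u ^ 2)).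
Proof. apply cts_derive; intros u; auto_derive; nra. Qed.

Lemma has_int_lorentz : has_int (fun u => / (1 + u ^ 2)) PI.
Proof.
  replace PI with (2 * (PI / 2 - atan 0)) by (rewrite atan_0; field).
  apply (has_int_even _ (fun u => / (1 + u ^ 2))); auto using cts_lorentz, is_lim_atan_p.
  - intros t; f_equal; ring.
  - apply is_derive_atan_lorentz.
Qed.

Lemma integrable_lorentz : integrable (fun u => / (1 + u ^ 2)).
Proof.
  apply (integrable_nonneg _ PI); auto using cts_lorentz, has_int_lorentz.
  intros u; left; apply Rinv_0_lt_compat; nra.
Qed.

Lemma integrable_rescale (f : R -> R) (c v : R) : 0 < c -> integrable f ->
  integrable (fun y => f (c * y + v)).
Proof.
  intros Hc [Cf HB]; split; [apply (cts_comp (fun y => c * y + v)); auto using cts_affine|].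
  destruct HB as [B HB]; exists (B / c); intros a b Hab.
  pose proof (RInt_affine (fun t => Rabs (f t)) c v a b (cts_abs f Cf)) as H1; simpl in H1.
  pose proof (HB (c * a + v) (c * b + v) ltac:(nra)) as H2. rewrite <- H1 in H2.
  apply Rmult_le_reg_l with c; auto. replace (c * (B / c)) with B by (field; lra); auto.
Qed.

(** The Fourier transform of [exp (- (eps * Rabs t))] at [s]: an approximate identity of total mass
    [2 * PI]. *)
Definition poisson (eps s : R) : R := 2 * eps / (eps ^ 2 + s ^ 2).

Lemma poisson_pos (eps s : R) : 0 < eps -> 0 < poisson eps s.
Proof. intros; unfold poisson; apply Rdiv_lt_0_compat; nra. Qed.

Lemma poisson_lorentz (eps x y : R) : 0 < eps ->
  poisson eps (y - x) = 2 / eps * / (1 + (/ eps * y + - x / eps) ^ 2).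
Proof. intros He; unfold poisson; field; pose proof (pow2_ge_0 (y + - x)); split; nra. Qed.

Lemma integrable_poisson (eps x : R) : 0 < eps -> integrable (fun y => poisson eps (y - x)).
Proof.
  intros He; apply (integrable_ext (fun y => 2 / eps * / (1 + (/ eps * y + - x / eps) ^ 2))).
  - intros y; symmetry; apply poisson_lorentz; auto.
  - apply integrable_scal, (integrable_rescale (fun u => / (1 + u ^ 2))); auto using integrable_lorentz.
    apply Rinv_0_lt_compat; auto.
Qed.

Lemma integ_poisson (eps x : R) : 0 < eps -> integ (fun y => poisson eps (y - x)) = 2 * PI.
Proof.
  intros He.
  assert (Hie : 0 < / eps) by (apply Rinv_0_lt_compat; auto).
  rewrite (integ_ext _ _ (fun y => poisson_lorentz eps x y He)).
  rewrite integ_scal by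
    (apply (integrable_rescale (fun u => / (1 + u ^ 2))); auto using integrable_lorentz).
  rewrite (has_int_integ _ _
    (has_int_rescale (fun u => / (1 + u ^ 2)) (/ eps) (- x / eps) PI Hie cts_lorentz has_int_lorentz)).
  field; lra.
Qed.

Lemma cts_exp_abs (eps : R) : cts (fun t => exp (- (eps * Rabs t))).
Proof.
  apply (cts_comp (fun t => - (eps * Rabs t)) exp); [|apply cts_derive; intros; auto_derive; auto].
  apply (cts_comp (fun t => Rabs t) (fun u => - (eps * u))); [apply cts_abs, cts_id|].
  apply cts_derive; intros; auto_derive; auto.
Qed.

Lemma is_lim_exp_bounded (eps C0 : R) (B0 : R -> R) : 0 < eps -> (forall t, Rabs (B0 t) <= C0) ->
  is_lim (fun t => exp (- (eps * t)) * B0 t) p_infty 0.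
Proof.
  intros He HB; apply is_lim_spec; intros eta. pose proof (cond_pos eta).
  assert (0 <= C0) by (eapply Rle_trans; [apply Rabs_pos|apply (HB 0)]).
  exists ((C0 + 1) / (eps * eta)); intros t Ht.
  assert (Hee : 0 < eps * eta) by (apply Rmult_lt_0_compat; auto).
  assert (0 < (C0 + 1) / (eps * eta)) by (apply Rdiv_lt_0_compat; lra).
  assert (Het : 0 < eps * t) by (apply Rmult_lt_0_compat; lra).
  rewrite Rminus_0_r, Rabs_mult, Rabs_pos_eq by (left; apply exp_pos).
  apply Rle_lt_trans with (/ (eps * t) * C0).
  - apply Rmult_le_compat; auto using exp_neg_le, Rabs_pos; left; apply exp_pos.
  - apply Rmult_lt_reg_l with (eps * t); auto.
    replace (eps * t * (/ (eps * t) * C0)) with C0 by (field; split; nra).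
    apply (Rmult_lt_compat_r (eps * eta)) in Ht; auto.
    replace ((C0 + 1) / (eps * eta) * (eps * eta)) with (C0 + 1) in Ht by (field; split; lra). lra.
Qed.

Lemma has_int_exp_abs_cos (eps s : R) : 0 < eps ->
  has_int (fun t => exp (- (eps * Rabs t)) * cos (t * s)) (poisson eps s).
Proof.
  intros He. assert (Hd : 0 < eps ^ 2 + s ^ 2) by nra.
  set (F := fun t => exp (- (eps * t)) * ((s * sin (t * s) - eps * cos (t * s)) / (eps ^ 2 + s ^ 2))).
  replace (poisson eps s) with (2 * (0 - F 0)).
  2:{ unfold F, poisson. rewrite Rmult_0_r, Ropp_0, exp_0, Rmult_0_l, sin_0, cos_0; field; lra. }
  apply (has_int_even _ (fun t => exp (- (eps * t)) * cos (t * s))).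
  - apply cts_mult; [apply cts_exp_abs|].
    apply cts_derive; intros; auto_derive; auto.
  - intros t; rewrite Rabs_Ropp, Ropp_mult_distr_l_reverse, cos_neg; auto.
  - intros t Ht; rewrite Rabs_pos_eq; auto.
  - apply cts_derive; intros; auto_derive; auto.
  - intros t; unfold F; auto_derive; [lra|field; lra].
  - unfold F. apply (is_lim_exp_bounded eps ((Rabs s + eps) / (eps ^ 2 + s ^ 2))); auto.
    intros t; unfold Rdiv; rewrite Rabs_mult, (Rabs_pos_eq (/ _)) by (left; apply Rinv_0_lt_compat; auto).
    apply Rmult_le_compat_r; [left; apply Rinv_0_lt_compat; auto|].
    unfold Rminus; eapply Rle_trans; [apply Rabs_triang|].
    rewrite Rabs_Ropp, !Rabs_mult, (Rabs_pos_eq eps) by lra.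
    pose proof (Rabs_sin_le (t * s)); pose proof (Rabs_cos_le (t * s)); pose proof (Rabs_pos s). nra.
Qed.

Lemma integrable_exp_abs (eps : R) : 0 < eps -> integrable (fun t => exp (- (eps * Rabs t))).
Proof.
  intros He; apply (integrable_nonneg _ (poisson eps 0)).
  - apply cts_exp_abs.
  - intros; left; apply exp_pos.
  - apply (has_int_ext (fun t => exp (- (eps * Rabs t)) * cos (t * 0))).
    + intros t; rewrite Rmult_0_r, cos_0; ring.
    + apply has_int_exp_abs_cos; auto.
Qed.

Lemma cts_cubic_kernel (q : nat) : cts (fun u => Rabs u ^ 3 * (/ (1 + u ^ 2)) ^ q).
Proof.
  apply cts_mult.
  - apply (cts_comp (fun u => Rabs u) (fun u => u ^ 3)); [apply cts_abs, cts_id|].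
    apply cts_derive; intros; auto_derive; auto.
  - apply (cts_comp (fun u => / (1 + u ^ 2)) (fun u => u ^ q)); [apply cts_lorentz|].
    apply cts_derive; intros; auto_derive; auto.
Qed.

(** The substitution [v = 1 + u^2] turns the half-line integrand into [(v - 1) v^(- m - 3) / 2],
    whence [F]. The value is of order [m^(-2)], the source of the factor [P^(-2)] in the error. *)
Lemma has_int_cubic_moment (m : nat) :
  has_int (fun u => Rabs u ^ 3 * (/ (1 + u ^ 2)) ^ (m + 3)) (/ ((INR m + 1) * (INR m + 2))).
Proof.
  pose proof (pos_INR m) as Hm.
  set (F := fun u =>
    - (1 / 2) * ((/ (1 + u ^ 2)) ^ (m + 1) / (INR m + 1) - (/ (1 + u ^ 2)) ^ (m + 2) / (INR m + 2))).
  replace (/ ((INR m + 1) * (INR m + 2))) with (2 * (0 - F 0)).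
  2:{ unfold F. replace (/ (1 + 0 ^ 2)) with 1 by (simpl; field). rewrite !pow1; field; lra. }
  apply (has_int_even _ (fun u => u ^ 3 * (/ (1 + u ^ 2)) ^ (m + 3))).
  - apply cts_cubic_kernel.
  - intros t; rewrite Rabs_Ropp; do 3 f_equal; ring.
  - intros t Ht; rewrite Rabs_pos_eq; auto.
  - apply cts_derive; intros; auto_derive; nra.
  - intros u; unfold F. assert (0 < 1 + u ^ 2) by nra.
    replace (m + 1)%nat with (S m) by lia. replace (m + 2)%nat with (S (S m)) by lia.
    replace (m + 3)%nat with (S (S (S m))) by lia.
    auto_derive; [repeat split; auto; lra|].
    cbn [Init.Nat.pred pow].
    (* The derivative of the power leaves [INR (S m)] in unfolded form. *)
    change (match m with O => 1 | S _ => INR m + 1 end) with (INR (S m)); rewrite !S_INR.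
    field; simpl in *; lra.
  - assert (Hb : forall k, forall u, 1 < u -> 0 <= (/ (1 + u ^ 2)) ^ (k + 1) <= / u).
    { intros k u Hu. assert (0 < / (1 + u ^ 2)) by (apply Rinv_0_lt_compat; nra).
      assert (/ (1 + u ^ 2) <= 1) by (apply Rinv_le_1; nra).
      split; [apply pow_le; lra|].
      rewrite Nat.add_1_r; simpl.
      apply Rle_trans with (/ (1 + u ^ 2) * 1).
      - apply Rmult_le_compat_l; [lra|].
        apply Rle_trans with (1 ^ k); [apply pow_incr; simpl in *; lra|rewrite pow1; lra].
      - rewrite Rmult_1_r; apply Rinv_le_contravar; simpl; nra. }
    apply is_lim_spec; intros eta. pose proof (cond_pos eta).
    exists (Rmax 1 (/ eta)); intros u Hu.
    pose proof (Rmax_l 1 (/ eta)); pose proof (Rmax_r 1 (/ eta)).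
    assert (/ u < eta).
    { rewrite <- (Rinv_inv eta). apply Rinv_lt_contravar; [|lra].
      apply Rmult_lt_0_compat; [apply Rinv_0_lt_compat; auto|lra]. }
    pose proof (Hb m u ltac:(lra)) as Hm1. pose proof (Hb (m + 1)%nat u ltac:(lra)) as Hm2.
    replace (m + 1 + 1)%nat with (m + 2)%nat in Hm2 by lia.
    assert (Hq : forall q p, 0 <= q -> 1 <= p -> 0 <= q / p <= q).
    { intros q p Hq Hp. assert (0 < / p <= 1).
      { split; [apply Rinv_0_lt_compat; lra|apply Rinv_le_1; lra]. }
      unfold Rdiv; nra. }
    pose proof (Hq _ (INR m + 1) (proj1 Hm1) ltac:(lra)). pose proof (Hq _ (INR m + 2) (proj1 Hm2) ltac:(lra)).
    unfold F; apply Rabs_def1; lra.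
Qed.

Lemma is_derive_half_sq (f : R -> R) (x d : R) : is_derive f x d ->
  is_derive (fun x => f x ^ 2 / 2) x (d * f x).
Proof.
  intros H; auto_derive; [eexists; apply H|].
  rewrite (is_derive_unique (fun x : R => f x) x d H); field.
Qed.

Lemma has_int_gauss : has_int (fun u => exp (- (u ^ 2 / 2))) (sqrt (2 * PI)).
Proof.
  set (g := fun u => exp (- (u ^ 2 / 2))).
  set (h := fun x s => exp (- (x ^ 2 * (1 + s ^ 2) / 2)) / (1 + s ^ 2)).
  assert (Cg : cts g) by (apply cts_derive; intros; unfold g; auto_derive; auto).
  assert (Hd : forall s : R, 0 < 1 + s ^ 2) by (intros; nra).
  assert (C2 : cts2 (fun x s => - x * exp (- (x ^ 2 * (1 + s ^ 2) / 2)))).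
  { apply cts2_mult; [apply (cts2_fst (fun x => - x)), cts_derive; intros; auto_derive; auto|].
    apply (cts2_comp (fun v => exp (- (v / 2)))); [apply cts_derive; intros; auto_derive; auto|].
    apply cts2_mult; [apply (cts2_fst (fun x => x ^ 2))|apply (cts2_snd (fun s => 1 + s ^ 2))];
      apply cts_derive; intros; auto_derive; auto. }
  assert (Dh : forall x s, is_derive (fun x => h x s) x (- x * exp (- (x ^ 2 * (1 + s ^ 2) / 2)))).
  { intros x s; unfold h, Rdiv; pose proof (Hd s); auto_derive; [lra|]. 
    simpl in *; field; lra. }
  assert (Ch : forall x, cts (h x)).
  { intros x; apply cts_derive; intros s; unfold h; pose proof (Hd s); auto_derive; lra. }
  (* [(int_0^x e^(-u^2/2) du)^2 / 2 + int_0^1 e^(-x^2(1+s^2)/2) / (1+s^2) ds] is constant. *)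
  set (D := fun x => (RInt g 0 x) ^ 2 / 2 + RInt (h x) 0 1).
  assert (HD : forall x : R, is_derive D x 0).
  { intros x. pose proof (is_derive_RInt_upper g 0 x Cg) as H1.
    assert (H2 : is_derive (fun x => RInt (h x) 0 1) x (- g x * RInt g 0 x)).
    { replace (- g x * RInt g 0 x) with (RInt (fun s => Derive (fun u => h u s) x) 0 1).
      - apply (is_derive_RInt_param (fun x s => h x s)).
        + apply filter_forall; intros u s _; eexists; apply Dh.
        + intros s _; apply (continuity_2d_pt_ext (fun x s => - x * exp (- (x ^ 2 * (1 + s ^ 2) / 2)))); auto.
          intros u v; symmetry; apply is_derive_unique, Dh.
        + apply filter_forall; intros u; apply cts_ex_RInt, Ch.
      - pose proof (RInt_affine g x 0 0 1 Cg) as H3.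
        replace (x * 0 + 0) with 0 in H3 by ring. replace (x * 1 + 0) with x in H3 by ring.
        rewrite <- H3.
        assert (H4 : forall s : R, Derive (fun u => h u s) x = - g x * x * g (x * s + 0)).
        { intros s; rewrite (is_derive_unique (fun u : R => h u s) x _ (Dh x s)).
          replace (- (x ^ 2 * (1 + s ^ 2) / 2)) with (- (x ^ 2 / 2) + - ((x * s + 0) ^ 2 / 2)) by field.
          unfold g; rewrite exp_plus; ring. }
        rewrite (RInt_ext _ (fun s => (- g x * x) * g (x * s + 0))) by (intros; apply H4).
        rewrite RInt_mul_const; [apply Rmult_assoc|].
        apply (cts_comp (fun s => x * s + 0)); auto using cts_affine. }
    replace 0 with (plus (g x * RInt g 0 x) (- g x * RInt g 0 x)) at 1
      by (unfold plus; simpl; ring).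
    apply (is_derive_plus (K := R_AbsRing) (V := R_NormedModule)); auto.
    apply (is_derive_half_sq (fun x => RInt g 0 x)); auto. }
  (* At [0] only the arctangent integral over [[0, 1]] remains. *)
  assert (D0 : D 0 = PI / 4).
  { unfold D. rewrite RInt_point. unfold zero; simpl.
    rewrite (RInt_ext _ (fun s => / (1 + s ^ 2))).
    - rewrite (is_RInt_unique _ 0 1 (atan 1 - atan 0)).
      + rewrite atan_0, atan_1; field.
      + apply (is_RInt_derive (V := R_CompleteNormedModule)).
        * intros s _; apply is_derive_atan_lorentz.
        * intros s _; apply cts_lorentz.
    - intros s _; unfold h. replace (- (0 ^ 2 * (1 + s ^ 2) / 2)) with 0 by field.
      rewrite exp_0; apply Rmult_1_l. }
  assert (Dx : forall x, 0 < x -> D x = PI / 4).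
  { intros x Hx; rewrite <- D0; symmetry; apply (eq_is_derive (V := R_NormedModule) D 0 x); auto. }
  (* The second integral in [D] is at most [2 / x^2], by [exp (- v) <= 1 / v]; hence the square of
     the first tends to [PI / 2]. *)
  assert (Hsq : forall x, 0 < x -> Rabs ((RInt g 0 x) ^ 2 - PI / 2) <= 4 / x ^ 2).
  { intros x Hx; specialize (Dx x Hx); unfold D in Dx.
    assert (Hx2 : 0 < x ^ 2) by nra.
    assert (0 <= RInt (h x) 0 1 <= 2 / x ^ 2).
    { split.
      - apply RInt_nonneg; [lra|apply Ch|]. intros s; unfold h; apply Rlt_le, Rdiv_lt_0_compat; auto using exp_pos.
      - apply Rle_trans with (RInt (fun _ => 2 / x ^ 2) 0 1).
        + apply RInt_mono; [lra|apply Ch|apply cts_const|].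
          intros s; unfold h. pose proof (Hd s) as Hs.
          apply Rle_trans with (/ (x ^ 2 * (1 + s ^ 2) / 2) / (1 + s ^ 2)).
          * apply Rmult_le_compat_r; [left; apply Rinv_0_lt_compat; auto|].
            apply exp_neg_le, Rdiv_lt_0_compat; [apply Rmult_lt_0_compat; auto|lra].
          * replace (/ (x ^ 2 * (1 + s ^ 2) / 2) / (1 + s ^ 2)) with (2 / x ^ 2 * / (1 + s ^ 2) ^ 2)
              by (field; split; lra).
            rewrite <- (Rmult_1_r (2 / x ^ 2)) at 2.
            apply Rmult_le_compat_l; [left; apply Rdiv_lt_0_compat; lra|].
            apply Rinv_le_1; nra.
        + rewrite RInt_const; unfold scal; simpl; unfold mult; simpl; lra. }
    replace (4 / x ^ 2) with (2 * (2 / x ^ 2)) by (field; lra).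
    apply Rabs_le; lra. }
  replace (sqrt (2 * PI)) with (2 * (sqrt (PI / 2) - RInt g 0 0)).
  2:{ rewrite RInt_point. unfold zero; simpl. rewrite Rminus_0_r.
      replace 2 with (sqrt (2 * 2)) at 1 by (rewrite sqrt_square; lra).
      pose proof PI_RGT_0. rewrite <- sqrt_mult by lra; f_equal; field. }
  apply (has_int_even g g (fun x => RInt g 0 x)); auto.
  - intros t; unfold g; do 2 f_equal. field.
  - intros t; apply is_derive_RInt_upper; auto.
  - apply is_lim_spec; intros eta; pose proof (cond_pos eta). pose proof PI_RGT_0.
    set (q := sqrt (PI / 2)). assert (Hq : 0 < q) by (apply sqrt_lt_R0; lra).
    assert (Hq2 : q * q = PI / 2) by (apply sqrt_sqrt; lra).
    exists (Rmax 1 (4 / (q * eta))); intros x Hx.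
    pose proof (Rmax_l 1 (4 / (q * eta))); pose proof (Rmax_r 1 (4 / (q * eta))).
    pose proof (Hsq x ltac:(lra)) as H3.
    set (I := RInt g 0 x) in *.
    assert (0 <= I).
    { apply RInt_nonneg; auto; [lra|]. intros; left; apply exp_pos. }
    replace (I ^ 2 - PI / 2) with ((I - q) * (I + q)) in H3 by (rewrite <- Hq2; ring).
    rewrite Rabs_mult, (Rabs_pos_eq (I + q)) in H3 by lra.
    assert (Rabs (I - q) * q <= 4 / x ^ 2).
    { eapply Rle_trans; [|apply H3]. apply Rmult_le_compat_l; [apply Rabs_pos|lra]. }
    assert (4 / x ^ 2 <= 4 / x).
    { unfold Rdiv; apply Rmult_le_compat_l; [lra|apply Rinv_le_contravar; nra]. }
    assert (4 / x < q * eta).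
    { apply Rmult_lt_reg_r with x; [lra|]. replace (4 / x * x) with 4 by (field; lra).
      assert (Hqe : 0 < q * eta) by (apply Rmult_lt_0_compat; auto).
      apply Rmult_lt_reg_l with (/ (q * eta)); [apply Rinv_0_lt_compat; auto|].
      replace (/ (q * eta) * (q * eta * x)) with x by (field; split; lra).
      unfold Rdiv in *; lra. }
    apply Rmult_lt_reg_r with q; auto; lra.
Qed.

(** * Uniform bounds and Fourier inversion *)

Section Limits.

Variables G psi psi1 : R -> R.
Hypotheses (HG : is_Gamma G) (Hpsi : is_digamma G psi) (Hpsi1 : is_trigamma psi psi1).

Lemma Yk_lim (z t : R) : 0 < z -> is_lim_seq (fun K => Cmod (Yk G psi (z + INR K) t - 1)) 0.
Proof.
  intros Hz; apply is_lim_seq_spec; intros eps; pose proof (cond_pos eps).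
  destruct (INR_unbounded ((6 * Rabs t / eps) ^ 2 + 3)) as [N HN].
  exists N; intros K HK. apply le_INR in HK.
  pose proof (pow2_ge_0 (6 * Rabs t / eps)).
  rewrite Rminus_0_r, Rabs_pos_eq by apply Cmod_ge_0.
  eapply Rle_lt_trans; [apply Yk_near_1; auto; lra|].
  set (r := sqrt (z + INR K - 1)).
  assert (Hr2 : r * r = z + INR K - 1) by (apply sqrt_sqrt; lra).
  assert (Hr : 0 < r) by (apply sqrt_lt_R0; lra).
  assert (H1 : 6 * Rabs t / eps < r).
  { assert (0 <= 6 * Rabs t / eps).
    { apply Rmult_le_pos; [pose proof (Rabs_pos t); lra|left; apply Rinv_0_lt_compat; auto]. }
    nra. }
  apply Rmult_lt_reg_r with (r / eps); [apply Rdiv_lt_0_compat; auto|].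
  replace (6 * Rabs t / r * (r / eps)) with (6 * Rabs t / eps) by (field; split; lra).
  replace (eps * (r / eps)) with r by (field; lra); auto.
Qed.

Lemma trigamma_shift_lim (z : R) : 0 < z -> is_lim_seq (fun K => psi1 (z + INR K)) 0.
Proof.
  intros Hz; apply is_lim_seq_spec; intros eps; pose proof (cond_pos eps).
  assert (0 < / eps) by (apply Rinv_0_lt_compat; auto).
  destruct (INR_unbounded (/ eps + 1)) as [N HN].
  exists N; intros K HK. apply le_INR in HK.
  pose proof (trigamma_bounds G psi psi1 HG Hpsi Hpsi1 (z + INR K) ltac:(lra)) as H1.
  rewrite Rminus_0_r, Rabs_pos_eq by lra.
  eapply Rle_lt_trans; [apply H1|]. rewrite <- (Rinv_inv eps).
  apply Rinv_lt_contravar; [apply Rmult_lt_0_compat; lra|lra].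
Qed.

Lemma inv_sq_sum_lim (z : R) : 0 < z -> is_lim_seq (inv_sq_sum z) (psi1 z).
Proof.
  intros Hz; apply (is_lim_seq_ext (fun K => psi1 z - psi1 (z + INR K))).
  - intros K; rewrite (trigamma_sum G psi psi1 HG Hpsi Hpsi1 z K) by auto; ring.
  - replace (Finite (psi1 z)) with (Finite (psi1 z - 0)) by (f_equal; ring).
    apply is_lim_seq_minus'; [apply is_lim_seq_const|apply trigamma_shift_lim; auto].
Qed.

(** The bound on finite products survives the limit in [K]: the remaining transform at [z + K] tends
    to [1], and the partial sums tend to [psi1 z]. *)
Lemma Yk_sq_le (z t : R) : 0 < z -> (1 + psi1 z * t ^ 2) * Cmod (Yk G psi z t) ^ 2 <= 1.
Proof.
  intros Hz.
  assert (H : Rbar_le ((1 + psi1 z * t ^ 2) * Cmod (Yk G psi z t) ^ 2) ((1 + 0) * (1 + 0))).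
  { apply (is_lim_seq_le (fun K => (1 + inv_sq_sum z K * t ^ 2) * Cmod (Yk G psi z t) ^ 2)
      (fun K => (1 + Cmod (Yk G psi (z + INR K) t - 1)) * (1 + Cmod (Yk G psi (z + INR K) t - 1)))).
    - intros K. rewrite (Yk_prod G psi HG Hpsi z t K) by auto.
      rewrite Cmod_mult, Rpow_mult_distr.
      pose proof (Cmod_hprod_sq z t K Hz) as H1.
      set (y := Yk G psi (z + INR K) t).
      assert (H2 : Cmod y <= 1 + Cmod (y - 1)).
      { replace y with (1 + (y - 1))%C at 1 by ring.
        eapply Rle_trans; [apply Cmod_triangle|]. rewrite Cmod_1; lra. }
      pose proof (Cmod_ge_0 y). rewrite <- Rmult_assoc.
      apply Rle_trans with (1 * Cmod y ^ 2); [|nra].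
      apply Rmult_le_compat_r; [apply pow2_ge_0|]. rewrite (Rmult_comm _ (t ^ 2)); auto.
    - apply is_lim_seq_mult'; [|apply is_lim_seq_const].
      apply is_lim_seq_plus'; [apply is_lim_seq_const|].
      apply is_lim_seq_mult'; [apply inv_sq_sum_lim; auto|apply is_lim_seq_const].
    - apply is_lim_seq_mult'; apply is_lim_seq_plus'; try apply is_lim_seq_const; apply Yk_lim; auto. }
  simpl in H; lra.
Qed.

Lemma Cmod_Yk_le (z t : R) : 0 < z -> Cmod (Yk G psi z t) <= 1.
Proof.
  intros Hz; pose proof (Yk_sq_le z t Hz); pose proof (Cmod_ge_0 (Yk G psi z t)).
  pose proof (trigamma_pos G psi psi1 HG Hpsi Hpsi1 z Hz).
  assert (0 <= psi1 z * t ^ 2) by (apply Rmult_le_pos; [lra|apply pow2_ge_0]).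
  destruct (Rle_lt_dec (Cmod (Yk G psi z t)) 1); auto. nra.
Qed.

Lemma exp_neg_lipschitz (a b : R) : 0 <= a <= b -> Rabs (exp (- a) - exp (- b)) <= b - a.
Proof.
  intros Hab. replace (- b) with (- a + - (b - a)) by ring. rewrite exp_plus.
  pose proof (exp_neg_bounds (b - a) ltac:(lra)). pose proof (exp_neg_le_1 (b - a) ltac:(lra)).
  pose proof (exp_neg_le_1 a ltac:(lra)). pose proof (exp_pos (- a)).
  rewrite Rabs_pos_eq; nra.
Qed.

(** For each [K] there are three errors: the tail transform against [1], the product against the
    Gaussian of the partial variance, and the variance still missing. The first and last vanish as
    [K] grows, and [s * psi1 z = s^3] in the middle one. *)
Lemma Yk_gauss (z t : R) : 0 < z ->
  Cmod (Yk G psi z t - exp (- (psi1 z * t ^ 2 / 2))) <= 2 * (sqrt (psi1 z) * Rabs t) ^ 3.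
Proof.
  intros Hz.
  pose proof (trigamma_pos G psi psi1 HG Hpsi Hpsi1 z Hz) as Hp.
  set (s := sqrt (psi1 z)).
  assert (Hs : 0 < s) by (apply sqrt_lt_R0; auto).
  assert (Hs2 : s * s = psi1 z) by (apply sqrt_sqrt; lra).
  (* The first term of the series already gives [1 / z^2 <= s^2]. *)
  assert (Hzs : / z <= s).
  { pose proof (trigamma_ge G psi psi1 HG Hpsi Hpsi1 z Hz) as H1. rewrite <- pow_inv in H1.
    assert (0 < / z) by (apply Rinv_0_lt_compat; auto). nra. }
  assert (H : Rbar_le (Cmod (Yk G psi z t - exp (- (psi1 z * t ^ 2 / 2))))
    (0 + 2 * Rabs t ^ 3 * s * psi1 z + 0 * (t ^ 2 / 2))).
  { apply (is_lim_seq_le (fun K => Cmod (Yk G psi z t - exp (- (psi1 z * t ^ 2 / 2))))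
      (fun K => Cmod (Yk G psi (z + INR K) t - 1) + 2 * Rabs t ^ 3 * s * inv_sq_sum z K +
        psi1 (z + INR K) * (t ^ 2 / 2))).
    - intros K. rewrite (Yk_prod G psi HG Hpsi z t K) by auto.
      set (y := Yk G psi (z + INR K) t). set (hp := hprod z t K).
      set (e := exp (- (psi1 z * t ^ 2 / 2))). set (eK := exp (- (t ^ 2 * inv_sq_sum z K / 2))).
      replace (hp * y - e)%C with (hp * (y - 1) + (hp - eK) + (eK - e))%C by ring.
      eapply Rle_trans; [apply Cmod_triangle|].
      apply Rplus_le_compat; [eapply Rle_trans; [apply Cmod_triangle|]; apply Rplus_le_compat|].
      + rewrite Cmod_mult. pose proof (Cmod_hprod_le z t K Hz). fold hp in H.
        pose proof (Cmod_ge_0 (y - 1)). nra.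
      + apply hprod_gauss; auto.
      + rewrite <- RtoC_minus, Cmod_R. unfold eK, e.
        pose proof (trigamma_sum G psi psi1 HG Hpsi Hpsi1 z K Hz) as HS.
        pose proof (inv_sq_sum_nonneg z K Hz) as HS0.
        assert (Hp0 : 0 <= psi1 (z + INR K)).
        { left; apply (trigamma_pos G psi psi1); auto. pose proof (pos_INR K); lra. }
        pose proof (pow2_ge_0 t).
        eapply Rle_trans; [apply exp_neg_lipschitz|]; rewrite HS; nra.
    - apply is_lim_seq_const.
    - apply is_lim_seq_plus'; [apply is_lim_seq_plus'; [apply Yk_lim; auto|]|].
      + apply is_lim_seq_mult'; [apply is_lim_seq_const|apply inv_sq_sum_lim; auto].
      + apply is_lim_seq_mult'; [apply trigamma_shift_lim; auto|apply is_lim_seq_const]. }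
  simpl in H. eapply Rle_trans; [apply H|].
  rewrite <- Hs2; right; ring.
Qed.

(** Every [z + k] with [k < K] lies below [z + K], so each factor is at most its value at that
    endpoint; the induction keeps the endpoint [w] fixed while [z] moves. *)
Lemma Cmod_hprod_pow (z t : R) (K : nat) : 0 < z ->
  Cmod (hprod z t K) ^ 2 <= (/ (1 + (t / (z + INR K)) ^ 2)) ^ K.
Proof.
  assert (Hgen : forall w K z, 0 < z -> z + INR K <= w ->
    Cmod (hprod z t K) ^ 2 <= (/ (1 + (t / w) ^ 2)) ^ K).
  { intros w K'; induction K' as [|k IH]; intros z' Hz' Hw.
    - simpl; rewrite Cmod_1; lra.
    - rewrite S_INR in Hw. pose proof (pos_INR k).
      cbn [hprod]. rewrite Cmod_mult, Rpow_mult_distr, Cmod_hfac_sq.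
      change ((/ (1 + (t / w) ^ 2)) ^ S k) with (/ (1 + (t / w) ^ 2) * (/ (1 + (t / w) ^ 2)) ^ k).
      apply Rmult_le_compat.
      + left; apply Rinv_0_lt_compat; nra.
      + apply pow2_ge_0.
      + apply Rinv_le_contravar; [nra|]. apply Rplus_le_compat_l.
        unfold Rdiv; rewrite (Rpow_mult_distr t (/ w) 2), (Rpow_mult_distr t (/ z') 2).
        apply Rmult_le_compat_l; [apply pow2_ge_0|].
        apply pow_incr; split; [left; apply Rinv_0_lt_compat; lra|apply Rinv_le_contravar; lra].
      + apply IH; lra. }
  intros Hz; apply Hgen; auto; lra.
Qed.

Lemma Cmod_Fk (z t : R) : 0 < z -> Cmod (Fk z t) = G z * Cmod (Yk G psi z t).
Proof.
  intros Hz; pose proof (Gamma_pos G HG z Hz) as HGz. unfold Yk.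
  rewrite !Cmod_mult, Cmod_cis, <- RtoC_inv, Cmod_R, Rabs_pos_eq by
    (try (left; apply Rinv_0_lt_compat); lra).
  field; lra.
Qed.

(** Four factors of the product give decay of order [t^(-4)], so that the transform stays integrable
    after multiplication by [|t|], as [poisson_damping] requires. *)
Lemma Cmod_Fk_decay (z t : R) : 0 < z ->
  Cmod (Fk z t) <= G z * (/ (1 + (t / (z + 4)) ^ 2)) ^ 2.
Proof.
  intros Hz; pose proof (Gamma_pos G HG z Hz).
  rewrite Cmod_Fk by auto. apply Rmult_le_compat_l; [lra|].
  rewrite (Yk_prod G psi HG Hpsi z t 4), Cmod_mult by auto.
  pose proof (Cmod_hprod_pow z t 4 Hz) as H1.
  replace (INR 4) with 4 in * by (simpl; ring).
  pose proof (Cmod_Yk_le (z + 4) t ltac:(lra)) as H2.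
  set (u := / (1 + (t / (z + 4)) ^ 2)) in *.
  assert (0 < u) by (apply Rinv_0_lt_compat; nra).
  pose proof (Cmod_ge_0 (hprod z t 4)). pose proof (Cmod_ge_0 (Yk G psi (z + 4) t)).
  assert (Cmod (hprod z t 4) <= u ^ 2).
  { replace (u ^ 4) with ((u ^ 2) ^ 2) in H1 by ring.
    assert (0 <= u ^ 2) by apply pow2_ge_0. nra. }
  nra.
Qed.

End Limits.

(** * Fourier inversion through Poisson smoothing *)

Section Inversion.

Variables G psi psi1 : R -> R.
Hypotheses (HG : is_Gamma G) (Hpsi : is_digamma G psi) (Hpsi1 : is_trigamma psi psi1).

Lemma Ck_cts (z : R) : 0 < z -> cts (Ck z).
Proof.
  intros Hz. apply (integ_param_cts (fun t y => ek z y * cos (t * y)) (fun _ => 1) (ek z)).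
  - apply cts2_mult; [apply cts2_snd, ek_cts|].
    apply (cts2_comp cos); [apply cts_cos|].
    apply cts2_mult; [apply cts2_fst, cts_id|apply cts2_snd, cts_id].
  - apply (ek_integrable G); auto.
  - intros; lra.
  - intros; left; apply ek_pos.
  - intros t y; rewrite Rabs_mult, Rmult_comm, (Rabs_pos_eq (ek z y)) by (left; apply ek_pos).
    apply Rmult_le_compat_r; [left; apply ek_pos|apply Rabs_cos_le].
  - apply cts_const.
Qed.

Lemma Sk_cts (z : R) : 0 < z -> cts (Sk z).
Proof.
  intros Hz. apply (integ_param_cts (fun t y => ek z y * sin (t * y)) (fun _ => 1) (ek z)).
  - apply cts2_mult; [apply cts2_snd, ek_cts|].
    apply (cts2_comp sin); [apply cts_sin|].
    apply cts2_mult; [apply cts2_fst, cts_id|apply cts2_snd, cts_id].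
  - apply (ek_integrable G); auto.
  - intros; lra.
  - intros; left; apply ek_pos.
  - intros t y; rewrite Rabs_mult, Rmult_comm, (Rabs_pos_eq (ek z y)) by (left; apply ek_pos).
    apply Rmult_le_compat_r; [left; apply ek_pos|apply Rabs_sin_le].
  - apply cts_const.
Qed.

(** Integrand of the inversion formula for the [P]-fold convolution. The real part suffices, the
    imaginary part being odd in [t]. *)
Definition pw (P : nat) (z t x : R) : R := Re (Fk z t ^ P * cis (- (t * x))).

Lemma pw_expand (P : nat) (z t x : R) :
  pw P z t x = Re (Fk z t ^ P) * cos (t * x) + Im (Fk z t ^ P) * sin (t * x).
Proof. unfold pw, cis, Cmult, Re, Im; simpl; rewrite cos_neg, sin_neg; ring. Qed.

Lemma pow_Fk_cts (P : nat) (z : R) : 0 < z ->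
  cts (fun t => Re (Fk z t ^ P)) /\ cts (fun t => Im (Fk z t ^ P)).
Proof.
  intros Hz; pose proof (Ck_cts z Hz); pose proof (Sk_cts z Hz).
  induction P as [|P [IH1 IH2]].
  - split; [apply (cts_const 1)|apply (cts_const 0)].
  - split; [apply (cts_ext (fun t => Ck z t * Re (Fk z t ^ P) - Sk z t * Im (Fk z t ^ P)))|
            apply (cts_ext (fun t => Ck z t * Im (Fk z t ^ P) + Sk z t * Re (Fk z t ^ P)))];
      try (intros t; rewrite Cpow_S; reflexivity).
    + apply cts_minus; apply cts_mult; auto.
    + apply cts_plus; apply cts_mult; auto.
Qed.

Lemma pw_cts2 (P : nat) (z : R) : 0 < z -> cts2 (pw P z).
Proof.
  intros Hz; destruct (pow_Fk_cts P z Hz) as [H1 H2].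
  assert (Ctx : cts2 (fun t x => t * x))
    by (apply cts2_mult; [apply cts2_fst, cts_id|apply cts2_snd, cts_id]).
  intros t x; apply (continuity_2d_pt_ext
    (fun t x => Re (Fk z t ^ P) * cos (t * x) + Im (Fk z t ^ P) * sin (t * x))).
  - intros; symmetry; apply pw_expand.
  - apply cts2_plus; apply cts2_mult.
    + apply (cts2_fst (fun t => Re (Fk z t ^ P))); auto.
    + apply (cts2_comp cos); auto using cts_cos.
    + apply (cts2_fst (fun t => Im (Fk z t ^ P))); auto.
    + apply (cts2_comp sin); auto using cts_sin.
Qed.

Definition env (z t : R) : R := (/ (1 + (t / (z + 4)) ^ 2)) ^ 2.

Lemma env_lorentz (z t : R) : 0 < z -> 0 <= env z t <= / (1 + (/ (z + 4) * t + 0) ^ 2).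
Proof.
  intros Hz; unfold env; split; [apply pow2_ge_0|].
  replace (/ (z + 4) * t + 0) with (t / (z + 4)) by (unfold Rdiv; ring).
  set (u := t / (z + 4)). assert (/ (1 + u ^ 2) <= 1) by (apply Rinv_le_1; nra).
  assert (0 < / (1 + u ^ 2)) by (apply Rinv_0_lt_compat; nra). nra.
Qed.

Lemma env_cts (z : R) : 0 < z -> cts (env z).
Proof.
  intros Hz; apply cts_derive; intros t; unfold env; auto_derive.
  pose proof (pow2_ge_0 (t * / (z + 4))) as H; simpl in H; lra.
Qed.

Lemma env_integrable (z : R) : 0 < z -> integrable (env z).
Proof.
  intros Hz; apply (integrable_dominated _ (fun t => / (1 + (/ (z + 4) * t + 0) ^ 2))).
  - apply env_cts; auto.
  - apply (integrable_rescale (fun u => / (1 + u ^ 2))); auto using integrable_lorentz.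
    apply Rinv_0_lt_compat; lra.
  - intros t; destruct (env_lorentz z t Hz); rewrite Rabs_pos_eq; auto.
Qed.

(** One factor supplies the decay and the others are at most [G z], so a single envelope serves
    every [P]. *)
Lemma Cmod_pow_Fk_le (P : nat) (z t : R) : 0 < z -> (1 <= P)%nat ->
  Cmod (Fk z t ^ P) <= G z ^ P * env z t.
Proof.
  intros Hz HP; pose proof (Gamma_pos G HG z Hz).
  pose proof (Cmod_Fk_decay G psi psi1 HG Hpsi Hpsi1 z t Hz) as H1. fold (env z t) in H1.
  rewrite Cmod_pow. destruct P as [|P]; [lia|]. rewrite <- !tech_pow_Rmult.
  assert (H2 : Cmod (Fk z t) <= G z).
  { rewrite (Cmod_Fk G psi) by auto. pose proof (Cmod_Yk_le G psi psi1 HG Hpsi Hpsi1 z t Hz); nra. }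
  pose proof (Cmod_ge_0 (Fk z t)).
  assert (Cmod (Fk z t) ^ P <= G z ^ P) by (apply pow_incr; auto).
  assert (0 <= Cmod (Fk z t) ^ P) by (apply pow_le; auto).
  apply Rle_trans with (G z * env z t * G z ^ P); [apply Rmult_le_compat; auto|lra].
Qed.

Lemma pw_bound (P : nat) (z t x : R) : 0 < z -> (1 <= P)%nat ->
  Rabs (pw P z t x) <= G z ^ P * env z t.
Proof.
  intros Hz HP; unfold pw; eapply Rle_trans; [apply re_le_Cmod|].
  rewrite Cmod_mult, Cmod_cis, Rmult_1_r; apply Cmod_pow_Fk_le; auto.
Qed.

Lemma pw_integrable (P : nat) (z x : R) : 0 < z -> (1 <= P)%nat -> integrable (fun t => pw P z t x).
Proof.
  intros Hz HP; apply (integrable_dominated _ (fun t => G z ^ P * env z t)).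
  - apply (cts2_section_l (pw P z)), pw_cts2; auto.
  - apply integrable_scal, env_integrable; auto.
  - intros t; apply pw_bound; auto.
Qed.

Lemma integ_pw_cts (P : nat) (z : R) : 0 < z -> (1 <= P)%nat ->
  cts (fun x => integ (fun t => pw P z t x)).
Proof.
  intros Hz HP.
  apply (integ_param_cts (fun x t => pw P z t x) (fun _ => 1) (fun t => G z ^ P * env z t)).
  - apply cts2_swap, pw_cts2; auto.
  - apply integrable_scal, env_integrable; auto.
  - intros; lra.
  - intros t; apply Rmult_le_pos; [apply pow_le; left; apply Gamma_pos; auto|apply env_lorentz; auto].
  - intros x t; rewrite Rmult_1_l; apply pw_bound; auto.
  - apply cts_const.
Qed.

(** Convolution with [ek z] multiplies the transform by [Fk z t]: after the reflection of [y] into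
    [x - y] the integral splits into [Ck] and [Sk]. *)
Lemma pw_integ_conv (P : nat) (z t x : R) : 0 < z ->
  integ (fun y => pw P z t y * ek z (x - y)) = pw (S P) z t x.
Proof.
  intros Hz.
  set (a := Re (Fk z t ^ P * cis (- (t * x)))). set (b := Im (Fk z t ^ P * cis (- (t * x)))).
  assert (E : forall u, pw P z t (x - u) * ek z u =
    a * (ek z u * cos (t * u)) + (- b) * (ek z u * sin (t * u))).
  { intros u; unfold pw. replace (- (t * (x - u))) with (- (t * x) + t * u) by ring.
    rewrite cis_plus, Cmult_assoc. unfold a, b, cis, Cmult, Re, Im; simpl; ring. }
  assert (I1 := ek_cos_integrable G HG z t Hz). assert (I2 := ek_sin_integrable G HG z t Hz).
  assert (I : integrable (fun u => pw P z t (x - u) * ek z u)).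
  { apply (integrable_ext _ _ (fun u => eq_sym (E u))).
    apply integrable_plus; apply integrable_scal; auto. }
  transitivity (integ (fun y => (fun u => pw P z t (x - u) * ek z u) (x - y))).
  { apply integ_ext; intros y; f_equal; f_equal; ring. }
  rewrite (integ_reflect (fun u => pw P z t (x - u) * ek z u) x I).
  rewrite (integ_ext _ _ E), (integ_lincomb _ _ _ _ I1 I2).
  fold (Ck z t) (Sk z t). unfold pw; rewrite Cpow_S.
  unfold a, b, Fk, cis, Cmult, Re, Im; simpl; ring.
Qed.

Lemma pw_conv (P : nat) (z x : R) : 0 < z -> (1 <= P)%nat ->
  integ (fun y => integ (fun t => pw P z t y) * ek z (x - y)) = integ (fun t => pw (S P) z t x).
Proof.
  intros Hz HP.
  rewrite (integ_ext (fun t => pw (S P) z t x) (fun t => integ (fun y => pw P z t y * ek z (x - y))))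
    by (intros; symmetry; apply pw_integ_conv; auto).
  rewrite (integ_fubini (fun t y => pw P z t y * ek z (x - y)) (fun t => G z ^ P * env z t)
    (fun y => ek z (x - y))).
  - apply integ_ext; intros y.
    rewrite (integ_ext (fun t => pw P z t y * ek z (x - y)) (fun t => ek z (x - y) * pw P z t y))
      by (intros; ring).
    rewrite integ_scal by (apply pw_integrable; auto); ring.
  - apply cts2_mult; [apply pw_cts2; auto|].
    apply (cts2_snd (fun y => ek z (x - y))), integrable_reflect, (ek_integrable G); auto.
  - apply integrable_scal, env_integrable; auto.
  - apply integrable_reflect, (ek_integrable G); auto.
  - intros t; apply Rmult_le_pos; [apply pow_le; left; apply Gamma_pos; auto|apply env_lorentz; auto].
  - intros; left; apply ek_pos.
  - intros t y; rewrite Rabs_mult, (Rabs_pos_eq (ek z _)) by (left; apply ek_pos).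
    apply Rmult_le_compat_r; [left; apply ek_pos|apply pw_bound; auto].
Qed.

(** By Fubini the damping factor in the inversion integral becomes the Poisson kernel acting on
    [ek z]. *)
Lemma pw_poisson (z x eps : R) : 0 < z -> 0 < eps ->
  integ (fun t => exp (- (eps * Rabs t)) * pw 1 z t x) =
  integ (fun y => ek z y * poisson eps (y - x)).
Proof.
  intros Hz He.
  set (K := fun t y => exp (- (eps * Rabs t)) * (ek z y * cos (t * (y - x)))).
  transitivity (integ (fun t => integ (K t))).
  - apply integ_ext; intros t; unfold K.
    rewrite integ_scal.
    + f_equal. rewrite pw_expand.
      rewrite (integ_ext _ (fun y => cos (t * x) * (ek z y * cos (t * y)) + sin (t * x) * (ek z y * sin (t * y)))).
      * rewrite (integ_lincomb _ _ _ _ (ek_cos_integrable G HG z t Hz) (ek_sin_integrable G HG z t Hz)).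
        fold (Ck z t) (Sk z t). unfold Fk, Cpow; simpl; ring.
      * intros y; replace (t * (y - x)) with (t * y - t * x) by ring; rewrite cos_minus; ring.
    + apply (ek_mult_integrable G); auto using Rabs_cos_le.
      apply (cts_comp (fun y => t * (y - x))); auto using cts_cos.
      apply cts_mult; [apply cts_const|apply cts_minus; auto using cts_id, cts_const].
  - rewrite (integ_fubini K (fun t => exp (- (eps * Rabs t))) (ek z)).
    + apply integ_ext; intros y; unfold K.
      rewrite (integ_ext _ (fun t => ek z y * (exp (- (eps * Rabs t)) * cos (t * (y - x)))))
        by (intros; ring).
      rewrite integ_scal.
      * f_equal; apply has_int_integ, has_int_exp_abs_cos; auto.
      * apply (integrable_dominated _ (fun t => exp (- (eps * Rabs t)))); [| |].
        -- apply cts_mult; [apply cts_exp_abs|]. apply cts_derive; intros; auto_derive; auto.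
        -- apply integrable_exp_abs; auto.
        -- intros t; rewrite Rabs_mult, Rabs_pos_eq by (left; apply exp_pos).
           pose proof (exp_pos (- (eps * Rabs t))); pose proof (Rabs_cos_le (t * (y - x))); nra.
    + unfold K; apply cts2_mult; [apply (cts2_fst (fun t => exp (- (eps * Rabs t)))), cts_exp_abs|].
      apply cts2_mult; [apply cts2_snd, ek_cts|].
      apply (cts2_comp cos); [apply cts_cos|].
      apply cts2_mult; [apply cts2_fst, cts_id|].
      apply (cts2_snd (fun y => y - x)), cts_minus; auto using cts_id, cts_const.
    + apply integrable_exp_abs; auto.
    + apply (ek_integrable G); auto.
    + intros; left; apply exp_pos.
    + intros; left; apply ek_pos.
    + intros t y; unfold K; rewrite !Rabs_mult, (Rabs_pos_eq (exp _)), (Rabs_pos_eq (ek z y));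
        try (left; apply exp_pos).
      apply Rmult_le_compat_l; [left; apply exp_pos|].
      pose proof (ek_pos z y); pose proof (Rabs_cos_le (t * (y - x))); nra.
Qed.

(** From [1 - exp (- (eps |t|)) <= eps |t|]: with [u = t / (z + 4)], absorbing [|u|] uses up one
    Lorentz factor of the envelope, and the other one remains integrable. *)
Lemma poisson_damping (z x eps : R) : 0 < z -> 0 < eps ->
  Rabs (integ (fun t => pw 1 z t x) - integ (fun t => exp (- (eps * Rabs t)) * pw 1 z t x)) <=
  eps * (G z * (z + 4) * integ (fun t => / (1 + (/ (z + 4) * t + 0) ^ 2))).
Proof.
  intros Hz He.
  assert (Hi : integrable (fun t => / (1 + (/ (z + 4) * t + 0) ^ 2))).
  { apply (integrable_rescale (fun u => / (1 + u ^ 2))); auto using integrable_lorentz.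
    apply Rinv_0_lt_compat; lra. }
  assert (I1 := pw_integrable 1 z x Hz (le_n 1)).
  assert (He1 : forall t, 0 <= exp (- (eps * Rabs t)) <= 1).
  { intros t; split; [left; apply exp_pos|apply exp_neg_le_1]. pose proof (Rabs_pos t); nra. }
  assert (I2 : integrable (fun t => exp (- (eps * Rabs t)) * pw 1 z t x)).
  { apply (integrable_dominated _ (fun t => Rabs (pw 1 z t x))).
    - apply cts_mult; [apply cts_exp_abs|apply I1].
    - apply integrable_abs; auto.
    - intros t; rewrite Rabs_mult, Rabs_pos_eq by apply He1.
      pose proof (He1 t); pose proof (Rabs_pos (pw 1 z t x)); nra. }
  rewrite <- integ_minus, <- integ_scal, <- integ_scal by auto using integrable_scal.
  apply integ_abs_le; auto using integrable_minus, integrable_scal.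
  intros t. replace (pw 1 z t x - exp (- (eps * Rabs t)) * pw 1 z t x) with
    ((1 - exp (- (eps * Rabs t))) * pw 1 z t x) by ring.
  rewrite Rabs_mult, Rabs_pos_eq by (pose proof (He1 t); lra).
  pose proof (pw_bound 1 z t x Hz (le_n 1)) as Hb. rewrite pow_1 in Hb.
  pose proof (exp_ineq1_le (- (eps * Rabs t))). pose proof (Rabs_pos t) as Ht.
  pose proof (Gamma_pos G HG z Hz) as HGz.
  apply Rle_trans with (eps * Rabs t * (G z * env z t)).
  - apply Rmult_le_compat; auto using Rabs_pos; [pose proof (He1 t)|]; lra.
  - unfold env. replace (/ (z + 4) * t + 0) with (t / (z + 4)) by (unfold Rdiv; ring).
    set (u := t / (z + 4)). set (l := / (1 + u ^ 2)).
    assert (Hl : 0 < l) by (apply Rinv_0_lt_compat; nra).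
    assert (Hl1 : l * (1 + u ^ 2) = 1) by (apply Rinv_l; nra).
    assert (Eu : Rabs t = (z + 4) * Rabs u).
    { rewrite <- (Rabs_pos_eq (z + 4)), <- Rabs_mult by lra. f_equal; unfold u; field; lra. }
    rewrite Eu.
    assert (Hu : Rabs u * l <= 1).
    { rewrite <- Hl1, <- (pow2_abs u), Rmult_comm. apply Rmult_le_compat_l; [lra|].
      pose proof (pow2_ge_0 (Rabs u - 1)); nra. }
    replace (eps * ((z + 4) * Rabs u) * (G z * l ^ 2)) with
      (eps * (G z * (z + 4) * l) * (Rabs u * l)) by ring.
    replace (eps * (G z * (z + 4) * l)) with (eps * (G z * (z + 4) * l) * 1) at 2 by ring.
    apply Rmult_le_compat_l; auto.
    repeat apply Rmult_le_pos; lra.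
Qed.

(** Within [del] of [x] continuity gives [eta]. Farther away the kernel is of order [eps], bounded
    in two ways: by a constant against the integrable [ek z y], and by a multiple of the kernel of
    width [1] against the constant [ek z x]. *)
Lemma poisson_approx_pointwise (z x eta del : R) : 0 < eta -> 0 < del ->
  (forall y, Rabs (y - x) < del -> Rabs (ek z y - ek z x) < eta) ->
  forall eps y, 0 < eps ->
  Rabs ((ek z y - ek z x) * poisson eps (y - x)) <=
  eta * poisson eps (y - x) +
  eps * (2 / del ^ 2 * ek z y + ek z x * (1 + / del ^ 2) * poisson 1 (y - x)).
Proof.
  intros Heta Hdel H eps y He.
  pose proof (poisson_pos eps (y - x) He) as Hp. pose proof (poisson_pos 1 (y - x) Rlt_0_1) as Hp1.
  pose proof (ek_pos z x) as Hx. pose proof (ek_pos z y) as Hy.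
  assert (Hd2 : 0 < / del ^ 2) by (apply Rinv_0_lt_compat; nra).
  rewrite Rabs_mult, (Rabs_pos_eq (poisson eps _)) by lra.
  destruct (Rlt_le_dec (Rabs (y - x)) del) as [Hs|Hs].
  - specialize (H y Hs).
    assert (0 <= eps * (2 / del ^ 2 * ek z y + ek z x * (1 + / del ^ 2) * poisson 1 (y - x))).
    { apply Rmult_le_pos; [lra|]. unfold Rdiv.
      apply Rplus_le_le_0_compat; (apply Rmult_le_pos; [apply Rmult_le_pos|]; lra). }
    assert (Rabs (ek z y - ek z x) * poisson eps (y - x) <= eta * poisson eps (y - x))
      by (apply Rmult_le_compat_r; lra).
    lra.
  - set (s := y - x) in *.
    assert (Hs2 : del ^ 2 <= s ^ 2) by (rewrite <- (pow2_abs s); apply pow_incr; lra).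
    assert (0 < del ^ 2) by nra.
    assert (H1 : poisson eps s <= eps * (2 / del ^ 2)).
    { unfold poisson, Rdiv. replace (eps * (2 * / del ^ 2)) with (2 * eps * / del ^ 2) by ring.
      apply Rmult_le_compat_l; [lra|apply Rinv_le_contravar; nra]. }
    assert (H2 : poisson eps s <= eps * ((1 + / del ^ 2) * poisson 1 s)).
    { unfold poisson. replace (eps * ((1 + / del ^ 2) * (2 * 1 / (1 ^ 2 + s ^ 2)))) with
        (2 * eps * ((1 + / del ^ 2) / (1 + s ^ 2))) by (field; split; nra).
      unfold Rdiv at 1; apply Rmult_le_compat_l; [lra|].
      apply Rle_trans with (/ s ^ 2); [apply Rinv_le_contravar; nra|].
      apply Rmult_le_reg_r with (s ^ 2 * (1 + s ^ 2)); [nra|].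
      replace (/ s ^ 2 * (s ^ 2 * (1 + s ^ 2))) with (1 + s ^ 2) by (field; nra).
      replace ((1 + / del ^ 2) / (1 + s ^ 2) * (s ^ 2 * (1 + s ^ 2))) with (s ^ 2 + s ^ 2 * / del ^ 2)
        by (field; split; nra).
      apply (Rmult_le_compat_r (/ del ^ 2)) in Hs2; [|lra].
      rewrite Rinv_r in Hs2 by lra. lra. }
    apply Rle_trans with ((ek z y + ek z x) * poisson eps s).
    { apply Rmult_le_compat_r; [lra|]. apply Rabs_le; lra. }
    assert (ek z y * poisson eps s <= ek z y * (eps * (2 / del ^ 2))) by (apply Rmult_le_compat_l; lra).
    assert (ek z x * poisson eps s <= ek z x * (eps * ((1 + / del ^ 2) * poisson 1 s)))
      by (apply Rmult_le_compat_l; lra).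
    assert (0 <= eta * poisson eps s) by (apply Rmult_le_pos; lra).
    lra.
Qed.

(** [Q] depends on [eta] through the modulus of continuity but not on [eps], so that [eps] can be
    chosen last in [fourier_inversion]. *)
Lemma ek_poisson_approx (z x eta : R) : 0 < z -> 0 < eta ->
  exists Q, 0 <= Q /\ forall eps, 0 < eps ->
  Rabs (integ (fun y => ek z y * poisson eps (y - x)) - 2 * PI * ek z x) <= 2 * PI * eta + eps * Q.
Proof.
  intros Hz Heta.
  pose proof (cts_continuity _ x (ek_cts z)) as Hc.
  destruct (proj1 (continuity_pt_locally _ _) Hc (mkposreal _ Heta)) as [[del Hdel] Hd].
  assert (Hd' : forall y, Rabs (y - x) < del -> Rabs (ek z y - ek z x) < eta)
    by (intros y Hy; apply Hd; exact Hy).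
  pose proof (poisson_approx_pointwise z x eta del Heta Hdel Hd') as Hpw.
  assert (Ie : integrable (ek z)) by (apply (ek_integrable G); auto).
  assert (Ip1 := integrable_poisson 1 x Rlt_0_1).
  set (q := fun y => 2 / del ^ 2 * ek z y + ek z x * (1 + / del ^ 2) * poisson 1 (y - x)) in *.
  assert (Iq : integrable q) by (apply integrable_plus; apply integrable_scal; auto).
  exists (integ q); split.
  { apply integ_nonneg; auto. intros y; unfold q.
    pose proof (ek_pos z y); pose proof (ek_pos z x); pose proof (poisson_pos 1 (y - x) Rlt_0_1).
    assert (0 < / del ^ 2) by (apply Rinv_0_lt_compat; nra).
    unfold Rdiv.
      apply Rplus_le_le_0_compat; (apply Rmult_le_pos; [apply Rmult_le_pos|]; lra). }
  intros eps He. assert (Ip := integrable_poisson eps x He).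
  assert (Idom : integrable (fun y => eta * poisson eps (y - x) + eps * q y))
    by (apply integrable_plus; apply integrable_scal; auto).
  assert (Id : integrable (fun y => (ek z y - ek z x) * poisson eps (y - x))).
  { refine (integrable_dominated _ _ _ Idom _).
    - apply cts_mult; [apply cts_minus; auto using ek_cts, cts_const|apply Ip].
    - intros y; apply Hpw; auto. }
  rewrite (Rmult_comm _ (ek z x)), <- (integ_poisson eps x He) at 1.
  replace (integ (fun y => ek z y * poisson eps (y - x))) with
    (integ (fun y => (ek z y - ek z x) * poisson eps (y - x)) + ek z x * integ (fun y => poisson eps (y - x))).
  2:{ rewrite <- integ_scal, <- integ_plus by auto using integrable_scal. apply integ_ext; intros; ring. }
  match goal with |- Rabs (?a + ?b - ?b) <= _ => replace (a + b - b) with a by ring end.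
  rewrite (Rmult_comm (2 * PI)), <- (integ_poisson eps x He), <- !integ_scal, <- integ_plus
    by auto using integrable_scal.
  apply integ_abs_le; auto.
Qed.

(** The damped integral is close both to the undamped one and to [2 * PI * ek z x]. With
    [eta = e / (4 * PI)] the local error is [e / 2], and [eps] makes the two terms linear in it at
    most [e / 2] together. *)
Lemma fourier_inversion (z x : R) : 0 < z -> integ (fun t => pw 1 z t x) = 2 * PI * ek z x.
Proof.
  intros Hz. pose proof PI_RGT_0.
  set (B := G z * (z + 4) * integ (fun t => / (1 + (/ (z + 4) * t + 0) ^ 2))).
  apply Rminus_diag_uniq, Rabs_eq_0, Rle_antisym; [|apply Rabs_pos].
  apply le_epsilon; intros e He; rewrite Rplus_0_l.
  assert (Heta : 0 < e / (4 * PI)) by (apply Rdiv_lt_0_compat; lra).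
  destruct (ek_poisson_approx z x _ Hz Heta) as (Q & HQ & HQe).
  assert (HB : 0 <= Rabs B + Q) by (pose proof (Rabs_pos B); lra).
  set (eps := e / (2 * (Rabs B + Q + 1))).
  assert (Heps : 0 < eps) by (apply Rdiv_lt_0_compat; lra).
  pose proof (poisson_damping z x eps Hz Heps) as H1. fold B in H1.
  rewrite pw_poisson in H1 by auto. specialize (HQe eps Heps).
  replace (2 * PI * (e / (4 * PI))) with (e / 2) in HQe by (field; lra).
  pose proof (Rle_abs B).
  assert (eps * (B + Q) <= e / 2).
  { apply Rle_trans with (eps * (Rabs B + Q + 1)); [apply Rmult_le_compat_l; lra|].
    unfold eps; right; field; lra. }
  apply Rabs_le_between in H1; apply Rabs_le_between in HQe. apply Rabs_le; lra.
Qed.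

End Inversion.

(** * The local limit theorem *)

Lemma improper_has_int (f : R -> R) (l : R) : improper_int_R f l -> has_int f l.
Proof.
  intros H eps Heps; destruct (H eps Heps) as [M HM]; exists M; intros a b Ha Hb.
  destruct (HM a b Ha Hb) as [pr Hpr]. rewrite (RInt_Reals f a b pr); auto.
Qed.

Lemma cis_pow (a : R) (n : nat) : (cis a ^ n)%C = cis (INR n * a).
Proof.
  induction n as [|n IH].
  - simpl INR; rewrite Rmult_0_l, cis_0; reflexivity.
  - rewrite Cpow_S, IH, <- cis_plus, S_INR; f_equal; ring.
Qed.

Lemma exp_pow_INR (a : R) (n : nat) : exp a ^ n = exp (INR n * a).
Proof.
  induction n as [|n IH].
  - simpl; rewrite Rmult_0_l, exp_0; auto.
  - rewrite <- tech_pow_Rmult, IH, <- exp_plus, S_INR; f_equal; ring.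
Qed.

Lemma Cmod_pow_diff (a b : C) (r : R) (n : nat) : Cmod a <= r -> Cmod b <= r ->
  Cmod (a ^ S n - b ^ S n) <= (INR n + 1) * Cmod (a - b) * r ^ n.
Proof.
  intros Ha Hb. assert (Hr : 0 <= r) by (eapply Rle_trans; [apply Cmod_ge_0|apply Ha]).
  pose proof (Cmod_ge_0 (a - b)).
  induction n as [|n IH].
  - simpl. replace (a * 1 - b * 1)%C with (a - b)%C by ring. lra.
  - rewrite (Cpow_S a (S n)), (Cpow_S b (S n)), S_INR, <- tech_pow_Rmult.
    replace (a * a ^ S n - b * b ^ S n)%C with (a * (a ^ S n - b ^ S n) + (a - b) * b ^ S n)%C by ring.
    eapply Rle_trans; [apply Cmod_triangle|]. rewrite !Cmod_mult, Cmod_pow.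
    assert (Cmod b ^ S n <= r ^ S n) by (apply pow_incr; split; auto using Cmod_ge_0).
    rewrite <- tech_pow_Rmult in H0.
    assert (Cmod a * Cmod (a ^ S n - b ^ S n) <= r * ((INR n + 1) * Cmod (a - b) * r ^ n))
      by (apply Rmult_le_compat; auto using Cmod_ge_0).
    assert (Cmod (a - b) * Cmod b ^ S n <= Cmod (a - b) * (r * r ^ n))
      by (apply Rmult_le_compat_l; auto).
    lra.
Qed.

Section Density.

Variables (G psi psi1 : R -> R) (phi : nat -> R -> R).
Hypotheses (HG : is_Gamma G) (Hpsi : is_digamma G psi) (Hpsi1 : is_trigamma psi psi1)
  (Hphi : is_logprod_exp_density phi).

(* The exponentially tilted density, [G z ^ P] times the density of a sum of [P] independent
   variables with density [ek z / G z]. *)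
Definition tilt (P : nat) (z x : R) : R := phi P x * exp ((z - 1) * x).

Lemma tilt_1 (z x : R) : tilt 1 z x = ek z x.
Proof. unfold tilt, ek; rewrite (proj1 Hphi), <- exp_plus; f_equal; ring. Qed.

(** The tilting factor is multiplicative over [x = y + (x - y)], so tilting commutes with
    convolution. *)
Lemma tilt_succ (P : nat) (z x : R) : (1 <= P)%nat -> cts (tilt P z) ->
  has_int (fun y => tilt P z y * ek z (x - y)) (tilt (S P) z x).
Proof.
  intros HP Ct.
  pose proof (improper_has_int _ _ (proj2 Hphi P x HP)) as H.
  apply (has_int_scal _ (exp ((z - 1) * x))) in H.
  - unfold tilt at 2; rewrite Rmult_comm. eapply has_int_ext; [|apply H].
    intros y; rewrite <- tilt_1; unfold tilt.
    replace ((z - 1) * x) with ((z - 1) * y + (z - 1) * (x - y)) by ring. rewrite exp_plus; ring.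
  - apply (cts_ext (fun y => tilt P z y * ek z (x - y) * exp (- ((z - 1) * x)))).
    + intros y; rewrite <- tilt_1; unfold tilt.
      replace (- ((z - 1) * x)) with (- ((z - 1) * y) + - ((z - 1) * (x - y))) by ring.
      rewrite exp_plus, !exp_Ropp. field; split; apply Rgt_not_eq, exp_pos.
    + apply cts_mult; [|apply cts_const]. apply cts_mult; auto.
      apply (cts_comp (fun y => x - y)); auto using ek_cts.
      apply cts_minus; auto using cts_const, cts_id.
Qed.

(** Induction by convolution from [fourier_inversion]. The inductive formula also makes [tilt P z]
    continuous and bounded, on which the integrability of the next convolution rests. *)
Lemma tilt_fourier (P : nat) (z x : R) : 0 < z -> (1 <= P)%nat ->
  2 * PI * tilt P z x = integ (fun t => pw P z t x).
Proof.
  intros Hz HP; revert x. pose proof PI_RGT_0.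
  induction P as [|P IH]; [lia|]. intros x.
  destruct (Nat.eq_dec P 0) as [->|HP0].
  - rewrite tilt_1; symmetry; apply (fourier_inversion G psi psi1); auto.
  - assert (HP1 : (1 <= P)%nat) by lia. specialize (IH HP1).
    assert (E : forall y, tilt P z y = / (2 * PI) * integ (fun t => pw P z t y)).
    { intros y; rewrite <- IH; field; lra. }
    assert (Ct : cts (tilt P z)).
    { apply (cts_ext _ _ (fun y => eq_sym (E y))), cts_mult; [apply cts_const|].
      apply (integ_pw_cts G psi psi1); auto. }
    rewrite <- (pw_conv G psi psi1) by auto.
    rewrite <- (has_int_integ _ _ (tilt_succ P z x HP1 Ct)).
    rewrite (integ_ext (fun y => integ (fun t => pw P z t y) * ek z (x - y))
      (fun y => 2 * PI * (tilt P z y * ek z (x - y)))) by (intros; rewrite <- IH; ring).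
    rewrite integ_scal; auto.
    apply (integrable_dominated _ (fun y => (/ (2 * PI) * (G z ^ P * integ (env z))) * ek z (x - y))).
    + apply cts_mult; auto. apply (integrable_reflect (ek z) x), (ek_integrable G); auto.
    + apply integrable_scal, integrable_reflect, (ek_integrable G); auto.
    + intros y; rewrite Rabs_mult, (Rabs_pos_eq (ek z _)) by (left; apply ek_pos).
      apply Rmult_le_compat_r; [left; apply ek_pos|].
      rewrite E, Rabs_mult, Rabs_pos_eq by (left; apply Rinv_0_lt_compat; lra).
      apply Rmult_le_compat_l; [left; apply Rinv_0_lt_compat; lra|].
      rewrite <- integ_scal by (apply env_integrable; auto).
      apply integ_abs_le.
      * apply (pw_integrable G psi psi1); auto.
      * apply integrable_scal, env_integrable; auto.
      * intros t; apply (pw_bound G psi psi1); auto.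
Qed.

Lemma tilt_cts (P : nat) (z : R) : 0 < z -> (1 <= P)%nat -> cts (tilt P z).
Proof.
  intros Hz HP; pose proof PI_RGT_0.
  apply (cts_ext (fun y => / (2 * PI) * integ (fun t => pw P z t y))).
  { intros y; rewrite <- tilt_fourier by auto; field; lra. }
  apply cts_mult; [apply cts_const|apply (integ_pw_cts G psi psi1); auto].
Qed.

(** The mode is at [y = ln z]. *)
Lemma ek_le_max (z y : R) : 0 < z -> ek z y <= exp (z * ln z - z).
Proof.
  intros Hz; unfold ek.
  assert (H : z * y - exp y <= z * ln z - z).
  { pose proof (exp_ineq1_le (y - ln z)) as H1.
    unfold Rminus in H1; rewrite exp_plus, exp_Ropp, exp_ln in H1 by auto.
    apply (Rmult_le_compat_l z) in H1; [|lra].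
    replace (z * (exp y * / z)) with (exp y) in H1 by (field; lra). lra. }
  destruct H as [H| ->]; [left; apply exp_increasing; auto|lra].
Qed.

(** Convolution with the positive function [ek z], of mass [G z], multiplies a supremum bound by at
    most [G z]. *)
Lemma tilt_bounds (P : nat) (z x : R) : 0 < z ->
  0 <= tilt (S P) z x <= exp (z * ln z - z) * G z ^ P.
Proof.
  intros Hz; pose proof (Gamma_pos G HG z Hz); revert x; induction P as [|P IH]; intros x.
  - rewrite tilt_1; pose proof (ek_le_max z x Hz); pose proof (ek_pos z x); simpl; lra.
  - assert (Ct : cts (tilt (S P) z)) by (apply tilt_cts; auto; lia).
    pose proof (tilt_succ (S P) z x ltac:(lia) Ct) as Hi.
    assert (Ir : integrable (fun y => ek z (x - y))) by (apply integrable_reflect, (ek_integrable G); auto).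
    assert (H0 : forall y, 0 <= tilt (S P) z y * ek z (x - y)).
    { intros y; apply Rmult_le_pos; [apply IH|left; apply ek_pos]. }
    assert (I : integrable (fun y => tilt (S P) z y * ek z (x - y))).
    { apply (integrable_nonneg _ _ (cts_mult _ _ Ct (proj1 Ir)) H0 Hi). }
    rewrite <- (has_int_integ _ _ Hi). split; [apply integ_nonneg; auto|].
    replace (exp (z * ln z - z) * G z ^ S P) with
      (integ (fun y => exp (z * ln z - z) * G z ^ P * ek z (x - y))).
    2:{ rewrite integ_scal, (integ_reflect (ek z) x), (integ_ek G HG) by (auto; apply (ek_integrable G); auto).
        simpl; ring. }
    apply integ_le; auto using integrable_scal.
    intros y; apply Rmult_le_compat_r; [left; apply ek_pos|apply IH].
Qed.

(** In [t = exp y] the integrand of [G (z + 1)] is [t^z exp (- t)], with maximum at [t = z]. On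
    [[z, z + sqrt (z + 1)]], one standard deviation long, it loses at most a factor [exp 1]. *)
Lemma Gamma_stirling_lower (z : R) : 0 < z ->
  exp (z * ln z - z - 1) * sqrt (z + 1) <= z * G z.
Proof.
  intros Hz; rewrite <- (Gamma_succ G HG z Hz), <- (integ_ek G HG (z + 1)) by lra.
  set (s := sqrt (z + 1)).
  assert (Hs2 : s * s = z + 1) by (apply sqrt_sqrt; lra).
  assert (Hs0 : 0 <= s) by apply sqrt_pos.
  assert (Hs : 1 <= s) by nra.
  assert (Hab : ln z <= ln (z + s)) by (left; apply ln_increasing; lra).
  apply Rle_trans with (RInt (ek (z + 1)) (ln z) (ln (z + s))).
  2:{ apply RInt_le_integ; auto; [apply (ek_integrable G); auto; lra|intros; left; apply ek_pos]. }
  assert (Ce : cts exp) by (apply cts_derive; intros; auto_derive; auto).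
  apply Rle_trans with (RInt (fun y => exp (z * ln z - z - 1) * exp y) (ln z) (ln (z + s))).
  - rewrite RInt_mul_const by auto.
    rewrite (is_RInt_unique exp _ _ (exp (ln (z + s)) - exp (ln z))).
    + rewrite !exp_ln by lra. right; ring.
    + apply (is_RInt_derive (V := R_CompleteNormedModule)); intros; [apply is_derive_exp|apply Ce].
  - apply RInt_le; auto.
    + apply cts_ex_RInt, cts_mult; auto using cts_const.
    + apply cts_ex_RInt, ek_cts.
    + intros y Hy; rewrite ek_succ; apply Rmult_le_compat_r; [left; apply exp_pos|].
      assert (H1 : z < exp y < z + s).
      { destruct Hy; split; [rewrite <- (exp_ln z) at 1 by auto|rewrite <- (exp_ln (z + s)) by lra];
          apply exp_increasing; auto. }
      assert (H : z * ln z - z - 1 <= z * y - exp y).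
      { set (t := exp y) in *.
        pose proof (exp_ineq1_le (ln z - y)) as H2.
        unfold Rminus in H2; rewrite exp_plus, exp_Ropp, exp_ln in H2 by auto. fold t in H2.
        assert (H3 : z * (1 - z * / t) <= z * (y - ln z)) by (apply Rmult_le_compat_l; lra).
        assert (H4 : t - z - 1 <= z * (1 - z * / t)); [|lra].
        apply Rmult_le_reg_r with t; [lra|].
        replace (z * (1 - z * / t) * t) with (z * t - z * z) by (field; lra).
        (* With [d = t - z] this is [d^2 <= z + d], which follows from [d < s], [s^2 = z + 1] and
           [1 <= s]. *)
        nra. }
      unfold ek; destruct H as [H|H]; [left; apply exp_increasing; auto|rewrite H; lra].
Qed.

(** At the mean the phase of the inversion formula is exactly the centering of the [P] factors. *)
Lemma pw_at_mean (P : nat) (z t : R) : 0 < z ->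
  pw P z t (INR P * psi z) = G z ^ P * Re (Yk G psi z t ^ P).
Proof.
  intros Hz; pose proof (Gamma_pos G HG z Hz) as HGz.
  assert (E : (Fk z t ^ P * cis (- (t * (INR P * psi z))))%C = (RtoC (G z ^ P) * Yk G psi z t ^ P)%C).
  { rewrite RtoC_pow, <- Cpow_mult_l.
    replace (RtoC (G z) * Yk G psi z t)%C with (Fk z t * cis (- (t * psi z)))%C.
    - rewrite Cpow_mult_l, cis_pow; do 2 f_equal; ring.
    - unfold Yk; field. intros E; apply RtoC_inj in E; lra. }
  unfold pw; rewrite E. unfold Cmult, Re, RtoC; simpl; ring.
Qed.

(** [r = (1 + s^2 t^2)^(-1/2)] bounds the moduli of both the transform and the Gaussian factor, so
    the difference of powers is at most [(n + 1) r^n] times the cubic error. The terms [+ 0] match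
    the affine form in [has_int_rescale]. *)
Lemma Yk_pow_gauss (n m : nat) (z t : R) : 0 < z -> (2 * (m + 3) <= n)%nat ->
  Rabs (Re (Yk G psi z t ^ S n) - exp (- ((sqrt (INR (S n)) * sqrt (psi1 z) * t + 0) ^ 2 / 2))) <=
  2 * (INR n + 1) * (Rabs (sqrt (psi1 z) * t + 0) ^ 3 * (/ (1 + (sqrt (psi1 z) * t + 0) ^ 2)) ^ (m + 3)).
Proof.
  intros Hz Hnm.
  pose proof (trigamma_pos G psi psi1 HG Hpsi Hpsi1 z Hz) as Hp.
  pose proof (Yk_gauss G psi psi1 HG Hpsi Hpsi1 z t Hz) as Hg.
  pose proof (Yk_sq_le G psi psi1 HG Hpsi Hpsi1 z t Hz) as Hsq.
  pose proof (pos_INR n) as Hn.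
  set (s := sqrt (psi1 z)) in *.
  assert (Hs : 0 < s) by (apply sqrt_lt_R0; auto).
  assert (Hs2 : s * s = psi1 z) by (apply sqrt_sqrt; lra).
  rewrite <- Hs2 in *. clear Hs2.
  assert (E : (sqrt (INR (S n)) * s * t + 0) ^ 2 = INR (S n) * (s * s * t ^ 2)).
  { rewrite S_INR. replace ((sqrt (INR n + 1) * s * t + 0) ^ 2) with
      ((sqrt (INR n + 1) * sqrt (INR n + 1)) * (s * s * t ^ 2)) by ring.
    rewrite sqrt_sqrt by lra; ring. }
  rewrite E, Rplus_0_r.
  replace (- (INR (S n) * (s * s * t ^ 2) / 2)) with (INR (S n) * - (s * s * t ^ 2 / 2)) by field.
  rewrite <- exp_pow_INR. set (e := exp (- (s * s * t ^ 2 / 2))) in *.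
  replace ((s * t) ^ 2) with (s * s * t ^ 2) by ring.
  set (v := / (1 + s * s * t ^ 2)). set (r := sqrt v).
  assert (Hu : 0 <= s * s * t ^ 2) by (pose proof (pow2_ge_0 t); nra).
  assert (Hv : 0 < v) by (apply Rinv_0_lt_compat; lra).
  assert (Hv1 : v <= 1) by (apply Rinv_le_1; lra).
  assert (Hr2 : r ^ 2 = v) by (unfold r; rewrite <- (sqrt_sqrt v) at 2 by lra; ring).
  assert (Hr0 : 0 <= r) by apply sqrt_pos.
  assert (Hr1 : r <= 1) by nra.
  set (y := Yk G psi z t) in *. pose proof (Cmod_ge_0 y) as Hy0.
  assert (Hy : Cmod y <= r).
  { assert (Cmod y ^ 2 <= v).
    { apply Rmult_le_reg_l with (1 + s * s * t ^ 2); [lra|].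
      unfold v; rewrite Rinv_r by lra; auto. }
    nra. }
  pose proof (exp_pos (- (s * s * t ^ 2 / 2))) as He0. fold e in He0.
  assert (He : Cmod e <= r).
  { rewrite Cmod_R, Rabs_pos_eq by lra.
    assert (e ^ 2 <= v); [|nra].
    unfold e; rewrite exp_pow_INR.
    replace (INR 2 * - (s * s * t ^ 2 / 2)) with (- (s * s * t ^ 2)) by (simpl; field).
    rewrite exp_Ropp; apply Rinv_le_contravar; [lra|apply exp_ineq1_le]. }
  replace (Re (y ^ S n) - e ^ S n) with (Re (y ^ S n - e ^ S n)%C)
    by (rewrite <- RtoC_pow; unfold Re, Cminus, Cplus, Copp, RtoC; simpl; ring).
  eapply Rle_trans; [apply re_le_Cmod|].
  eapply Rle_trans; [apply (Cmod_pow_diff _ _ r n Hy He)|].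
  assert (Hrn : r ^ n <= v ^ (m + 3)).
  { rewrite <- Hr2, <- pow_mult. replace n with (2 * (m + 3) + (n - 2 * (m + 3)))%nat at 1 by lia.
    rewrite pow_add. assert (0 <= r ^ (2 * (m + 3))) by (apply pow_le; auto).
    assert (r ^ (n - 2 * (m + 3)) <= 1).
    { apply Rle_trans with (1 ^ (n - 2 * (m + 3))); [apply pow_incr; auto|rewrite pow1; lra]. }
    nra. }
  rewrite Rabs_mult, (Rabs_pos_eq s) by lra.
  pose proof (Cmod_ge_0 (y - e)).
  assert (0 <= r ^ n) by (apply pow_le; auto).
  assert (Cmod (y - e) * r ^ n <= 2 * (s * Rabs t) ^ 3 * v ^ (m + 3)) by (apply Rmult_le_compat; auto).
  assert ((INR n + 1) * (Cmod (y - e) * r ^ n) <= (INR n + 1) * (2 * (s * Rabs t) ^ 3 * v ^ (m + 3)))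
    by (apply Rmult_le_compat_l; lra).
  lra.
Qed.

Lemma integ_Yk_pow (n m : nat) (z : R) : 0 < z -> (2 * (m + 3) <= n)%nat ->
  Rabs (integ (fun t => Re (Yk G psi z t ^ S n)) - sqrt (2 * PI) / (sqrt (INR (S n)) * sqrt (psi1 z))) <=
  2 * (INR n + 1) * (/ ((INR m + 1) * (INR m + 2)) / sqrt (psi1 z)).
Proof.
  intros Hz Hnm.
  pose proof (Gamma_pos G HG z Hz) as HGz.
  pose proof (trigamma_pos G psi psi1 HG Hpsi Hpsi1 z Hz) as Hp.
  set (s := sqrt (psi1 z)). assert (Hs : 0 < s) by (apply sqrt_lt_R0; auto).
  assert (Hn : 0 < sqrt (INR (S n))) by (apply sqrt_lt_R0, lt_0_INR; lia).
  assert (Hns : 0 < sqrt (INR (S n)) * s) by (apply Rmult_lt_0_compat; auto).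
  set (g := fun u => exp (- (u ^ 2 / 2))).
  set (c := fun u => Rabs u ^ 3 * (/ (1 + u ^ 2)) ^ (m + 3)).
  assert (Cg : cts g) by (apply cts_derive; intros; unfold g; auto_derive; auto).
  assert (Cc : cts c) by apply cts_cubic_kernel.
  assert (Ig : integrable g).
  { refine (integrable_nonneg _ _ Cg _ has_int_gauss). intros; left; apply exp_pos. }
  assert (Ic : integrable c).
  { refine (integrable_nonneg _ _ Cc _ (has_int_cubic_moment m)).
    intros u; apply Rmult_le_pos; apply pow_le; [apply Rabs_pos|left; apply Rinv_0_lt_compat; nra]. }
  rewrite <- (has_int_integ _ _ (has_int_rescale g _ 0 _ Hns Cg has_int_gauss)).
  rewrite <- (has_int_integ _ _ (has_int_rescale c _ 0 _ Hs Cc (has_int_cubic_moment m))).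
  assert (IY : integrable (fun t => Re (Yk G psi z t ^ S n))).
  { apply (integrable_ext (fun t => / G z ^ S n * pw (S n) z t (INR (S n) * psi z))).
    - intros t; rewrite pw_at_mean by auto. field. apply pow_nonzero; lra.
    - apply integrable_scal, (pw_integrable G psi psi1); auto; lia. }
  pose proof (integrable_rescale g _ 0 Hns Ig). pose proof (integrable_rescale c _ 0 Hs Ic).
  rewrite <- integ_minus, <- integ_scal by auto.
  apply integ_abs_le; auto using integrable_minus, integrable_scal.
  intros t; apply Yk_pow_gauss; auto.
Qed.

(** The factor [exp (x * (1 - z))] of the approximation undoes the tilt, which leaves the normalized
    tilted density at its mean, compared with the Gaussian peak. *)
Lemma saddle_ratio (P : nat) (z : R) : 0 < z -> (1 <= P)%nat ->
  phi P (INR P * psi z) / saddle_approx G psi1 P (INR P * psi z) z =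
  tilt P z (INR P * psi z) / G z ^ P * (sqrt (2 * PI) * (sqrt (INR P) * sqrt (psi1 z))).
Proof.
  intros Hz HP; unfold saddle_approx, tilt. set (x := INR P * psi z).
  pose proof (Gamma_pos G HG z Hz). pose proof (trigamma_pos G psi psi1 HG Hpsi Hpsi1 z Hz).
  pose proof PI_RGT_0. assert (0 < INR P) by (apply lt_0_INR; lia).
  replace ((z - 1) * x) with (- (x * (1 - z))) by ring. rewrite exp_Ropp.
  rewrite <- !sqrt_mult_alt by lra.
  replace (2 * PI * (INR P * psi1 z)) with (2 * PI * INR P * psi1 z) by ring.
  assert (0 < sqrt (2 * PI * INR P * psi1 z)).
  { apply sqrt_lt_R0, Rmult_lt_0_compat; [apply Rmult_lt_0_compat|]; lra. }
  pose proof (exp_pos (x * (1 - z))).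
  field; repeat split; try lra. apply pow_nonzero; lra.
Qed.

Lemma saddle_ratio_large (n : nat) (z : R) : 0 < z -> (6 <= n)%nat ->
  Rabs (phi (S n) (INR (S n) * psi z) / saddle_approx G psi1 (S n) (INR (S n) * psi z) z - 1) <=
  64 / sqrt (INR (S n)).
Proof.
  intros Hz Hn6. pose proof PI_RGT_0.
  pose proof (Gamma_pos G HG z Hz) as HGz.
  pose proof (trigamma_pos G psi psi1 HG Hpsi Hpsi1 z Hz) as Hp.
  rewrite saddle_ratio by (auto; lia).
  (* The largest [m] with [2 * (m + 3) <= n], available because [6 <= n]. *)
  set (m := Nat.div (n - 6) 2).
  pose proof (Nat.div_mod_eq (n - 6) 2) as Hdiv. fold m in Hdiv.
  pose proof (Nat.mod_upper_bound (n - 6) 2 ltac:(lia)) as Hmod.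
  assert (Hm1 : (2 * (m + 3) <= n)%nat) by lia.
  assert (Hm2 : INR n + 1 <= 2 * INR m + 8).
  { assert (Hnm : (n <= 2 * m + 7)%nat) by lia.
    apply le_INR in Hnm. rewrite plus_INR, mult_INR in Hnm. simpl in Hnm; lra. }
  pose proof (integ_Yk_pow n m z Hz Hm1) as HI.
  set (s := sqrt (psi1 z)) in *. assert (Hs : 0 < s) by (apply sqrt_lt_R0; auto).
  set (J := integ (fun t => Re (Yk G psi z t ^ S n))) in *.
  assert (ET : tilt (S n) z (INR (S n) * psi z) = G z ^ S n * J / (2 * PI)).
  { unfold J; rewrite <- integ_scal.
    - rewrite (integ_ext _ (fun t => pw (S n) z t (INR (S n) * psi z)))
        by (intros; symmetry; apply pw_at_mean; auto).
      rewrite <- tilt_fourier by (auto; lia). field; lra.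
    - apply (integrable_ext (fun t => / G z ^ S n * pw (S n) z t (INR (S n) * psi z))).
      + intros t; rewrite pw_at_mean by auto. field. apply pow_nonzero; lra.
      + apply integrable_scal, (pw_integrable G psi psi1); auto; lia. }
  rewrite ET. set (w := sqrt (2 * PI)) in *. set (p := sqrt (INR (S n))) in *.
  assert (Hw : 0 < w) by (apply sqrt_lt_R0; lra).
  assert (Hw2 : w * w = 2 * PI) by (apply sqrt_sqrt; lra).
  pose proof (pos_INR n) as Hn0. pose proof (pos_INR m) as Hm0.
  assert (Hp0 : 0 < p) by (apply sqrt_lt_R0; rewrite S_INR; lra).
  assert (Hp2 : p * p = INR n + 1) by (unfold p; rewrite S_INR; apply sqrt_sqrt; lra).
  replace (G z ^ S n * J / (2 * PI) / G z ^ S n * (w * (p * s)) - 1) with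
    ((J - w / (p * s)) * (p * s / w)).
  2:{ rewrite <- Hw2; field; repeat split; try lra. apply pow_nonzero; lra. }
  rewrite Rabs_mult, (Rabs_pos_eq (p * s / w)) by
    (left; apply Rdiv_lt_0_compat; auto; apply Rmult_lt_0_compat; auto).
  apply Rle_trans with (2 * (INR n + 1) * (/ ((INR m + 1) * (INR m + 2)) / s) * (p * s / w)).
  { apply Rmult_le_compat_r; auto.
    left; apply Rdiv_lt_0_compat; auto; apply Rmult_lt_0_compat; auto. }
  assert (Hw1 : 2 <= w).
  { assert (2 <= PI) by (pose proof PI2_1; lra). nra. }
  replace (2 * (INR n + 1) * (/ ((INR m + 1) * (INR m + 2)) / s) * (p * s / w)) with
    (2 / w * ((p * p * p * p / ((INR m + 1) * (INR m + 2))) * / p)).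
  2:{ rewrite <- Hp2; field; repeat split; lra. }
  unfold Rdiv at 3. rewrite <- (Rmult_1_l (64 * / p)).
  assert (Hip : 0 < / p) by (apply Rinv_0_lt_compat; auto).
  (* Here [p^4 = (n + 1)^2 <= (2 m + 8)^2 <= 64 (m + 1) (m + 2)], the origin of [64]; the other
     factor [2 / w] is at most [1]. *)
  assert (Hq : p * p * p * p / ((INR m + 1) * (INR m + 2)) <= 64).
  { apply Rmult_le_reg_r with ((INR m + 1) * (INR m + 2)); [nra|].
    replace (p * p * p * p / ((INR m + 1) * (INR m + 2)) * ((INR m + 1) * (INR m + 2))) with
      ((p * p) * (p * p)) by (field; split; lra).
    rewrite Hp2; nra. }
  assert (Hq0 : 0 <= p * p * p * p / ((INR m + 1) * (INR m + 2))).
  { apply Rmult_le_pos; [nra|left; apply Rinv_0_lt_compat; nra]. }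
  apply Rmult_le_compat.
  - left; apply Rdiv_lt_0_compat; lra.
  - apply Rmult_le_pos; lra.
  - apply Rmult_le_reg_r with w; auto. replace (2 / w * w) with 2 by (field; lra). lra.
  - apply Rmult_le_compat_r; lra.
Qed.

(** The normalized maximum is at most [exp 1 * z / sqrt (z + 1)] by the Stirling bound, and
    [sqrt (psi1 z)] is at most [sqrt (z + 1) / z]; the dependence on [z] cancels. *)
Lemma saddle_ratio_bounded (n : nat) (z : R) : 0 < z ->
  0 <= phi (S n) (INR (S n) * psi z) / saddle_approx G psi1 (S n) (INR (S n) * psi z) z <=
  3 * sqrt (2 * PI * INR (S n)).
Proof.
  intros Hz; rewrite saddle_ratio by (auto; lia). pose proof PI_RGT_0.
  pose proof (Gamma_pos G HG z Hz) as HGz.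
  pose proof (tilt_bounds n z (INR (S n) * psi z) Hz) as [Ht0 Ht].
  pose proof (Gamma_stirling_lower z Hz) as HS.
  pose proof (trigamma_le G psi psi1 HG Hpsi Hpsi1 z Hz) as Hp.
  pose proof (trigamma_pos G psi psi1 HG Hpsi Hpsi1 z Hz) as Hp0.
  set (T := tilt (S n) z (INR (S n) * psi z)) in *.
  assert (Hn : 0 < INR (S n)) by (apply lt_0_INR; lia).
  rewrite <- (Rmult_assoc (sqrt (2 * PI))), <- (sqrt_mult_alt (2 * PI)) by lra.
  set (w := sqrt (2 * PI * INR (S n))).
  assert (Hw : 0 <= w) by apply sqrt_pos.
  assert (HGn : 0 < G z ^ S n) by (apply pow_lt; auto).
  assert (Hs0 : 0 <= sqrt (psi1 z)) by apply sqrt_pos.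
  assert (Hs : sqrt (psi1 z) <= sqrt (z + 1) / z).
  { replace (sqrt (z + 1) / z) with (sqrt ((z + 1) / z ^ 2)).
    - apply sqrt_le_1_alt. eapply Rle_trans; [apply Hp|]. right; field; lra.
    - rewrite sqrt_div_alt by nra. rewrite sqrt_pow2 by lra; auto. }
  assert (HT0 : 0 <= T / G z ^ S n) by (apply Rmult_le_pos; [auto|left; apply Rinv_0_lt_compat; auto]).
  split; [apply Rmult_le_pos; auto; apply Rmult_le_pos; auto|].
  assert (Hz1 : 0 < sqrt (z + 1)) by (apply sqrt_lt_R0; lra).
  assert (HT : T / G z ^ S n <= exp 1 * z / sqrt (z + 1)).
  { apply Rmult_le_reg_r with (G z ^ S n * sqrt (z + 1)); [apply Rmult_lt_0_compat; auto|].
    replace (T / G z ^ S n * (G z ^ S n * sqrt (z + 1))) with (T * sqrt (z + 1)) by (field; lra).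
    replace (exp 1 * z / sqrt (z + 1) * (G z ^ S n * sqrt (z + 1))) with
      (exp 1 * (z * G z) * G z ^ n) by (simpl; field; lra).
    apply Rle_trans with (exp (z * ln z - z) * G z ^ n * sqrt (z + 1)); [apply Rmult_le_compat_r; lra|].
    replace (z * ln z - z) with (1 + (z * ln z - z - 1)) by ring. rewrite exp_plus.
    replace (exp 1 * exp (z * ln z - z - 1) * G z ^ n * sqrt (z + 1)) with
      (exp 1 * (exp (z * ln z - z - 1) * sqrt (z + 1)) * G z ^ n) by ring.
    apply Rmult_le_compat_r; [apply pow_le; lra|].
    apply Rmult_le_compat_l; [left; apply exp_pos|auto]. }
  apply Rle_trans with (exp 1 * z / sqrt (z + 1) * (w * (sqrt (z + 1) / z))).
  { apply Rmult_le_compat; auto.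
    - apply Rmult_le_pos; auto.
    - apply Rmult_le_compat_l; auto. }
  replace (exp 1 * z / sqrt (z + 1) * (w * (sqrt (z + 1) / z))) with (exp 1 * w) by (field; split; lra).
  apply Rmult_le_compat_r; [auto|apply exp_le_3].
Qed.

Lemma saddle_ratio_error (P : nat) (x z : R) : (1 <= P)%nat -> 0 < z -> psi z = x / INR P ->
  Rabs (phi P x / saddle_approx G psi1 P x z - 1) <= 64 / sqrt (INR P).
Proof.
  intros HP Hz Hx. assert (HP0 : 0 < INR P) by (apply lt_0_INR; lia).
  replace x with (INR P * psi z) by (rewrite Hx; field; lra).
  destruct P as [|n]; [lia|].
  destruct (Compare_dec.le_lt_dec 6 n) as [Hn|Hn]; [apply saddle_ratio_large; auto|].
  pose proof (saddle_ratio_bounded n z Hz) as [H0 H1].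
  set (q := phi (S n) (INR (S n) * psi z) / saddle_approx G psi1 (S n) (INR (S n) * psi z) z) in *.
  assert (Hn6 : INR (S n) <= 6).
  { replace 6 with (INR 6) by (simpl; ring). apply le_INR; lia. }
  pose proof PI_RGT_0; pose proof PI_4.
  assert (H7 : sqrt (2 * PI * INR (S n)) <= 7).
  { replace 7 with (sqrt (7 * 7)) by (apply sqrt_square; lra). apply sqrt_le_1_alt. nra. }
  set (p := sqrt (INR (S n))). assert (Hp : 0 < p) by (apply sqrt_lt_R0; auto).
  assert (Hp2 : p * p = INR (S n)) by (apply sqrt_sqrt; lra).
  assert (Hp5 : p <= 5 / 2) by nra.
  (* For [P <= 6], [2 * PI * P <= 48] puts the ratio in [[0, 21]], and [64 / p] exceeds [22] because
     [p <= 5 / 2]. *)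
  apply Rle_trans with 22; [apply Rabs_le; lra|].
  apply Rmult_le_reg_r with p; auto. replace (64 / p * p) with 64 by (field; lra). lra.
Qed.

End Density.

Theorem theorem4 (G psi psi1 : R -> R) (phi : nat -> R -> R)
  (HG : is_Gamma G) (Hpsi : is_digamma G psi) (Hpsi1 : is_trigamma psi psi1)
  (Hphi : is_logprod_exp_density phi) :
  (* uniform asymptotic equivalence: ratio -> 1 uniformly in x *)
  (forall eps : R, 0 < eps ->
     exists N : nat, forall P : nat, (N <= P)%nat -> (1 <= P)%nat ->
       forall x z : R, 0 < z -> psi z = x / INR P ->
         Rabs (phi P x / saddle_approx G psi1 P x z - 1) < eps) /\
  (* with relative correction O(P^(-1/2)), uniformly in x *)
  (exists C : R, forall P : nat, (1 <= P)%nat ->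
       forall x z : R, 0 < z -> psi z = x / INR P ->
         Rabs (phi P x / saddle_approx G psi1 P x z - 1) <= C / sqrt (INR P)).
Proof.
  split.
  - intros eps Heps. destruct (INR_unbounded ((64 / eps) ^ 2)) as [N HN].
    exists N; intros P HNP HP x z Hz Hx.
    eapply Rle_lt_trans; [apply (saddle_ratio_error G psi psi1); auto|].
    apply le_INR in HNP. pose proof (pow2_ge_0 (64 / eps)).
    set (p := sqrt (INR P)). assert (Hp : 0 < p) by (apply sqrt_lt_R0; lra).
    assert (Hp2 : p * p = INR P) by (apply sqrt_sqrt; lra).
    assert (H64 : 0 < 64 / eps) by (apply Rdiv_lt_0_compat; lra).
    assert (64 / eps < p) by nra.
    apply Rmult_lt_reg_r with (p / eps); [apply Rdiv_lt_0_compat; auto|].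
    replace (64 / p * (p / eps)) with (64 / eps) by (field; split; lra).
    replace (eps * (p / eps)) with p by (field; lra); auto.
  - exists 64; intros P HP x z Hz Hx; apply (saddle_ratio_error G psi psi1); auto.
Qed.
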